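(* Let $T$ be a Calder\'on--Zygmund operator on $\mathbb{R}^n$ satisfying $T(1)=0$. Then there exist a constant $\eta_n\in(0,1)$ depending only on $n$ and a constant $C>0$ depending only on $n$ and $T$ such that the following holds: for every compactly supported function $f\in L^1(\mathbb{R}^n)$ there exists an $\eta_n$-sparse family $\mathcal{S}$ of cubes in $\mathbb{R}^n$ such that $$|Tf(x)|\le C\sum_{Q\in\mathcal{S}}\Omega(f;Q)\,\chi_Q(x)$$ for almost every $x\in\mathbb{R}^n$.
   Context: **Cubes, oscillation, sparseness.** Cubes in $\mathbb{R}^n$ have sides parallel to the coordinate axes. For a cube $Q$ and a locally integrable $f$, $\langle f\rangle_Q:=|Q|^{-1}\int_Q f$, and the mean oscillation is $\Omega(f;Q):=|Q|^{-1}\int_Q|f-\langle f\rangle_Q|$. A family $\mathcal{S}$ of cubes is $\eta$-sparse ($0<\eta<1$) if each $Q\in\mathcal{S}$ contains a measurable set $E_Q\subset Q$ with $|E_Q|\ge\eta|Q|$, and the sets $E_Q$, $Q\in\mathcal{S}$, are pairwise disjoint. **Calder\'on--Zygmund operator.** This means a linear operator $T$ of weak type $(1,1)$ (i.e. bounded from $L^1(\mathbb{R}^n)$ to $L^{1,\infty}(\mathbb{R}^n)$) which is represented by $$Tf(x)=\int_{\mathbb{R}^n}K(x,y)f(y)\,dy\quad\text{for all }x\notin\operatorname{supp}f$$ for compactly supported $f\in L^1(\mathbb{R}^n)$, with a kernel $K$ satisfying the smoothness condition $$|K(x,y)-K(x',y)|\le\omega\left(\frac{|x-x'|}{|x-y|}\right)\frac{1}{|x-y|^n}\quad\text{for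 }|x-x'|\le|x-y|/2,$$ where $\omega$ is a modulus of continuity (nondecreasing, subadditive, $\omega(0)=0$) satisfying the Dini condition $\int_0^1\omega(t)\frac{dt}{t}<\infty$. **The distribution $T(1)$.** Let $\mathscr{D}_0(\mathbb{R}^n)$ be the space of smooth compactly supported functions on $\mathbb{R}^n$ with integral zero. For $\varphi\in\mathscr{D}_0(\mathbb{R}^n)$ choose $\eta\in C_c^\infty(\mathbb{R}^n)$ with $\eta=1$ on a neighborhood of $\operatorname{supp}\varphi$ and set $$\langle T(1),\varphi\rangle:=\langle T(\eta),\varphi\rangle+\int_{\mathbb{R}^n}\left(\int_{\mathbb{R}^n}K(x,y)\varphi(x)\,dx\right)(1-\eta(y))\,dy,$$ where $\langle T(\eta),\varphi\rangle=\int_{\mathbb{R}^n}T(\eta)(x)\varphi(x)\,dx$. This is independent of the choice of $\eta$. The condition $T(1)=0$ means $\langle T(1),\varphi\rangle=0$ for all $\varphi\in\mathscr{D}_0(\mathbb{R}^n)$. *)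

(* Defs.v *)
From HB Require Import structures.
From mathcomp Require Import all_boot all_order all_algebra.
From mathcomp Require Import all_classical all_reals all_analysis.

Set Implicit Arguments.
Unset Strict Implicit.
Unset Printing Implicit Defensive.

Import Order.TTheory GRing.Theory Num.Theory.
Import numFieldNormedType.Exports.

Local Open Scope classical_set_scope.
Local Open Scope ring_scope.

(* R^n is 'rV[R]_n.  It carries the sigma-algebra generated by the coordinate
   maps, i.e. the n-fold product of the Borel sigma-algebra of R, which is the
   Borel sigma-algebra of R^n. *)
Definition rV_display : measure_display. Proof. exact: default_measure_display. Qed.

Section measurable_rV.
Context {R : realType} (n : nat).

Definition rV_coord (i : 'I_n) (v : 'rV[R]_n) : measurableTypeR R := v ord0 i.

Let rV_set0 : g_sigma_preimage rV_coord set0.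
Proof. exact: sigma_algebra0. Qed.

Let rV_setC A : g_sigma_preimage rV_coord A -> g_sigma_preimage rV_coord (~` A).
Proof. exact: sigma_algebraC. Qed.

Let rV_bigcup (F : (set 'rV[R]_n)^nat) :
  (forall i, g_sigma_preimage rV_coord (F i)) ->
  g_sigma_preimage rV_coord (\bigcup_i (F i)).
Proof. exact: sigma_algebra_bigcup. Qed.

HB.instance Definition _ := @isMeasurable.Build rV_display
  'rV[R]_n (g_sigma_preimage rV_coord) rV_set0 rV_setC rV_bigcup.

End measurable_rV.

Section measurable_rV_lemmas.
Context {R : realType}.

Lemma measurable_rV_coord n (i : 'I_n) :
  measurable_fun [set: 'rV[R]_n] (rV_coord i).
Proof.
move=> _ Y mY; rewrite setTI; apply: sub_sigma_algebra => /=.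
rewrite -bigcup_seq/=; exists i => /=; first by rewrite mem_index_enum.
by exists Y => //; rewrite setTI.
Qed.

Lemma measurable_fun_rVP d (T : measurableType d) n (f : T -> 'rV[R]_n) :
  (forall i, measurable_fun [set: T] (rV_coord i \o f)) ->
  measurable_fun [set: T] f.
Proof.
move=> mf; have sub : g_sigma_preimage (fun i => rV_coord i \o f) `<=` measurable.
  apply: smallest_sub; first exact: sigma_algebra_measurable.
  case: n => [|n] in f mf *; first by rewrite big_ord0.
  by rewrite -bigcup_mkord_ord; apply: bigcup_sub => i Ii A [B mB <-]; exact: mf.
rewrite g_sigma_preimage_comp in sub.
by move=> _ A mA; apply: sub; exists A.
Qed.

Definition rV_cons n (p : measurableTypeR R * 'rV[R]_n) : 'rV[R]_n.+1 :=
  \row_i (if unlift ord0 i is Some j then p.2 ord0 j else p.1).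

Definition rV_uncons n (v : 'rV[R]_n.+1) : measurableTypeR R * 'rV[R]_n :=
  (v ord0 ord0, \row_j v ord0 (lift ord0 j)).

Lemma rV_consK n : cancel (@rV_cons n) (@rV_uncons n).
Proof.
move=> [x v]; rewrite /rV_uncons /rV_cons; congr (_, _).
  by rewrite mxE unlift_none.
by apply/rowP => j; rewrite !mxE liftK.
Qed.

Lemma measurable_rV_cons n : measurable_fun setT (@rV_cons n).
Proof.
apply: measurable_fun_rVP => i; rewrite /comp /rV_coord.
under eq_fun do rewrite mxE.
case: unliftP => [j|] _; last exact: measurable_fst.
exact: (measurableT_comp (measurable_rV_coord j) measurable_snd).
Qed.

Lemma measurable_rV_uncons n : measurable_fun setT (@rV_uncons n).
Proof.
apply/measurable_fun_pairP; split; first exact: measurable_rV_coord.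
apply: measurable_fun_rVP => i.
rewrite (_ : _ \o _ = rV_coord (lift ord0 i)); first exact: measurable_rV_coord.
by apply/funext => v; rewrite /rV_coord /= mxE.
Qed.

End measurable_rV_lemmas.

Section lebesgue_rV_cons.
Context {R : realType} (n : nat).
Variable m : {sigma_finite_measure set 'rV[R]_n -> \bar R}.

Definition lebesgue_rV_cons : set 'rV[R]_n.+1 -> \bar R :=
  pushforward (lebesgue_measure \x m)%E (@rV_cons R n).

Let cons0 : lebesgue_rV_cons set0 = 0%E.
Proof. by rewrite /lebesgue_rV_cons /pushforward preimage_set0 measure0. Qed.

Let cons_ge0 A : (0 <= lebesgue_rV_cons A)%E.
Proof. by rewrite /lebesgue_rV_cons /pushforward; apply: measure_ge0. Qed.

Let cons_sigma_additive : semi_sigma_additive lebesgue_rV_cons.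
Proof.
move=> F mF tF mUF; rewrite /lebesgue_rV_cons /pushforward preimage_bigcup.
apply: measure_semi_sigma_additive.
- by move=> k; rewrite -[X in measurable X]setTI; exact: measurable_rV_cons.
- apply/trivIsetP => /= i j _ _ ij; rewrite -preimage_setI.
  by move/trivIsetP : tF => /(_ _ _ _ _ ij) ->//; rewrite preimage_set0.
- by rewrite -preimage_bigcup -[X in measurable X]setTI; exact: measurable_rV_cons.
Qed.

HB.instance Definition _ := isMeasure.Build _ _ _ lebesgue_rV_cons
  cons0 cons_ge0 cons_sigma_additive.

Let cons_sigma_finite : sigma_finite setT lebesgue_rV_cons.
Proof.
have /sigma_finiteP[F [TF ndF mF]] := sigma_finiteT (@lebesgue_measure R).
have /sigma_finiteP[G [TG ndG mG]] := sigma_finiteT m.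
exists (fun k => @rV_uncons R n @^-1` (F k `*` G k)).
  apply/esym; rewrite -preimage_bigcup -subTset => v _ /=.
  have [i _ Fi] : (\bigcup_i F i) (rV_uncons v).1 by rewrite -TF.
  have [j _ Gj] : (\bigcup_i G i) (rV_uncons v).2 by rewrite -TG.
  exists (maxn i j) => //; split.
    by move: Fi; exact/subsetPset/ndF/leq_maxl.
  by move: Gj; exact/subsetPset/ndG/leq_maxr.
move=> k; have [mFk Fk] := mF k; have [mGk Gk] := mG k.
have mFG : measurable (F k `*` G k) by exact: measurableX.
split.
  by rewrite -[X in measurable X]setTI; exact: measurable_rV_uncons.
rewrite /lebesgue_rV_cons /pushforward -comp_preimage.
rewrite (_ : _ \o _ = id) ?preimage_id; last exact/funext/rV_consK.
by rewrite product_measure1E// lte_mul_pinfty// ge0_fin_numE.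
Qed.

HB.instance Definition _ := Measure_isSigmaFinite.Build _ _ _ lebesgue_rV_cons
  cons_sigma_finite.

End lebesgue_rV_cons.

(* Lebesgue measure on R^n, built by iterating the product with the Lebesgue
   measure of R. *)
Fixpoint lebesgue_rV {R : realType} (n : nat) :
    {sigma_finite_measure set 'rV[R]_n -> \bar R} :=
  if n is k.+1 then lebesgue_rV_cons (lebesgue_rV k)
  else \d_(0 : 'rV[R]_0).

Lemma lebesgue_rV_box {R : realType} n (a b : 'rV[R]_n) :
  (forall i, a ord0 i <= b ord0 i) ->
  lebesgue_rV n [set x | forall i, a ord0 i <= x ord0 i < b ord0 i] =
  (\prod_(i < n) (b ord0 i - a ord0 i))%:E.
Proof.
elim: n a b => [|n IH] a b ab /=.
  rewrite big_ord0 /dirac indicE mem_set//=.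
  by case.
rewrite big_ord_recl /= /lebesgue_rV_cons /pushforward.
set a' : 'rV[R]_n := \row_j a ord0 (lift ord0 j).
set b' : 'rV[R]_n := \row_j b ord0 (lift ord0 j).
pose I : set (measurableTypeR R) := `[a ord0 ord0, b ord0 ord0[%classic.
pose B : set 'rV[R]_n := [set x | forall i, a' ord0 i <= x ord0 i < b' ord0 i].
transitivity ((lebesgue_measure \x lebesgue_rV n)%E (I `*` B)).
  congr ((_ \x _)%E _); apply/seteqP; split => [[x v] /= h|[x v] /= [h1 h2] i].
    split; first by have := h ord0; rewrite !mxE unlift_none /I /= in_itv.
    by move=> i; have := h (lift ord0 i); rewrite !mxE liftK.
  rewrite !mxE; case: unliftP => [j ->|->]; last by move: h1; rewrite /I /= in_itv.
  by have := h2 j; rewrite !mxE.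
have mB : measurable B.
  rewrite (_ : B = \big[setI/setT]_(i < n)
      (rV_coord i @^-1` `[a' ord0 i, b' ord0 i[%classic)); last first.
    apply/seteqP; split => x /=.
      move=> h; rewrite -bigcap_seq => i _ /=.
      by rewrite in_itv /=; exact: h.
    rewrite -bigcap_seq => h i; have := h i; rewrite /= in_itv /=; apply.
    by rewrite mem_index_enum.
  apply: bigsetI_measurable => i _.
  by rewrite -[X in measurable X]setTI; apply: measurable_rV_coord.
have IHB : lebesgue_rV n B = (\prod_(i < n) (b' ord0 i - a' ord0 i))%:E.
  by apply: IH => i; rewrite !mxE.
rewrite product_measure1E//; last exact: measurable_itv.
rewrite [X in (_ * X)%E]IHB [X in (X * _)%E]lebesgue_measure_itv/= lte_fin.
under eq_bigr do rewrite !mxE.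
have := ab ord0; rewrite le_eqVlt => /predU1P[->|->].
  by rewrite ltxx mul0e subrr mul0r.
by rewrite -EFinB -EFinM.
Qed.

Section euclidean.
Context {R : realType} (n : nat).
Local Notation Rn := 'rV[R]_n.

(* The canonical norm of 'rV[R]_n is the sup norm, hence this definition. *)
Definition enorm (v : Rn) : R := Num.sqrt (\sum_i v ord0 i ^+ 2).

(* An element of L^1 with compact essential support has a representative whose
   support, in the present topological sense, is compact. *)
Definition supp (f : Rn -> R) : set Rn := closure [set x | f x != 0].

Definition L1 (f : Rn -> R) : Prop :=
  (lebesgue_rV n).-integrable setT (EFin \o f).

(* Half-open cubes; changing a cube by its boundary is immaterial for averages,
   for sparseness and for almost everywhere estimates. *)
Definition cube (Q : set Rn) : Prop :=
  exists (a : Rn) (l : R), 0 < l /\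
    Q = [set x | forall i, a ord0 i <= x ord0 i < a ord0 i + l].

Definition average (f : Rn -> R) (Q : set Rn) : R :=
  (fine (lebesgue_rV n Q))^-1 * \int[lebesgue_rV n]_(x in Q) f x.

Definition mean_oscillation (f : Rn -> R) (Q : set Rn) : R :=
  average (fun x => `|f x - average f Q|) Q.

Definition sparse (eta : R) (S : set (set Rn)) : Prop :=
  (forall Q, S Q -> cube Q) /\
  exists E : set Rn -> set Rn,
    (forall Q, S Q -> [/\ measurable (E Q), E Q `<=` Q &
       (eta%:E * lebesgue_rV n Q <= lebesgue_rV n (E Q))%E]) /\
    trivIset S E.

Definition iter_partial (s : seq 'I_n) (f : Rn -> R) : Rn -> R :=
  foldr (fun (i : 'I_n) (g : Rn -> R) => 'D_(delta_mx ord0 i) g) f s.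

Definition smooth (f : Rn -> R) : Prop :=
  forall s : seq 'I_n, continuous (iter_partial s f) /\
    forall (x : Rn) (i : 'I_n), derivable (iter_partial s f) x (delta_mx ord0 i).

Definition test_function (f : Rn -> R) : Prop := smooth f /\ compact (supp f).

Definition test_function0 (f : Rn -> R) : Prop :=
  test_function f /\ \int[lebesgue_rV n]_x f x = 0.

Definition dini_modulus (omega : R -> R) : Prop :=
  [/\ omega 0 = 0,
      forall s t : R, 0 <= s -> s <= t -> omega s <= omega t,
      forall s t : R, 0 <= s -> 0 <= t -> omega (s + t) <= omega s + omega t &
      (\int[lebesgue_measure]_(t in `]0%R, 1%R]) (omega t / t)%:E < +oo)%E].

(* Operators act on functions, almost everywhere equality being used where L^1
   is a space of classes; values outside L^1 are irrelevant.  Compatibility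
   with almost everywhere equality follows from linear_on_L1 and weak_type11. *)
Definition linear_on_L1 (T : (Rn -> R) -> (Rn -> R)) : Prop :=
  forall (c : R) f g, L1 f -> L1 g ->
    {ae lebesgue_rV n, forall x, T (fun y => c * f y + g y) x = c * T f x + T g x}.

Definition weak_type11 (T : (Rn -> R) -> (Rn -> R)) : Prop :=
  (forall f, L1 f -> measurable_fun setT (T f)) /\
  exists A : R, forall f, L1 f -> forall lambda : R, 0 < lambda ->
    (lambda%:E * lebesgue_rV n [set x | (lambda < `|T f x|)%R] <=
     A%:E * \int[lebesgue_rV n]_x `|f x|%:E)%E.

(* That y |-> K x y * f y is integrable is part of the meaning of the formula. *)
Definition represented_by (T : (Rn -> R) -> (Rn -> R)) (K : Rn -> Rn -> R) :
    Prop :=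
  forall f, L1 f -> compact (supp f) -> forall x, ~ supp f x ->
    L1 (fun y => K x y * f y) /\
    T f x = \int[lebesgue_rV n]_y (K x y * f y).

Definition smooth_kernel (omega : R -> R) (K : Rn -> Rn -> R) : Prop :=
  forall x x' y : Rn, x != y -> enorm (x - x') <= enorm (x - y) / 2 ->
    `|K x y - K x' y| <=
    omega (enorm (x - x') / enorm (x - y)) * (enorm (x - y) ^+ n)^-1.

Definition calderon_zygmund (T : (Rn -> R) -> (Rn -> R)) (K : Rn -> Rn -> R) :
    Prop :=
  [/\ linear_on_L1 T, weak_type11 T, represented_by T K &
      exists omega, dini_modulus omega /\ smooth_kernel omega K].

Definition T1_pairing (T : (Rn -> R) -> (Rn -> R)) (K : Rn -> Rn -> R)
    (chi phi : Rn -> R) : R :=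
  \int[lebesgue_rV n]_x (T chi x * phi x) +
  \int[lebesgue_rV n]_y
    ((\int[lebesgue_rV n]_x (K x y * phi x)) * (1 - chi y)).

(* The pairing does not depend on the cut-off function chi, so that all of them
   may be considered. *)
Definition T1_eq0 (T : (Rn -> R) -> (Rn -> R)) (K : Rn -> Rn -> R) : Prop :=
  forall phi chi, test_function0 phi -> test_function chi ->
    set_nbhs (supp phi) [set y | chi y = 1] -> T1_pairing T K chi phi = 0.

End euclidean.

(* Main.v *)
(* Fix a cube Q and let Q' be a large dilate of Q.  On Q one compares T f with T F_Q, where
   F_Q = (f - <f>_{Q'}) 1_{Q'}.  By the weak type (1,1) bound and Vitali's covering lemma, the set
   E_Q of the points of Q where |T F_Q| or the maximal function of F_Q exceeds a large multiple of
   Omega(f; Q') fills a small proportion of Q.  A dyadic subcube P of Q most of which lies outside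
   E_Q contains a point y with |T F_Q(y)| and |T F_P(y)| bounded by multiples of Omega(f; Q'), and
   F_Q = F_P + a 1_{P'} + H with |a| bounded by a multiple of Omega(f; Q') and H vanishing on P'.
   By the Dini condition T H oscillates on P by at most a multiple of Omega(f; Q'), and so does
   a T(1_{P'}) because T(1) = 0; hence |T F_Q| <= |T F_P| + C Omega(f; Q') on the whole of P.
   Stopping at the maximal dyadic cubes P for which E_Q fills too much of P and iterating bounds
   |T F_Q| by the sum of C Omega(f; P') over the selected cubes P, whose unselected parts are
   disjoint and take up at least half of each of them.

   T(1) = 0 is used through a cut-off chi equal to 1 near P': pairing T chi with approximations of
   1_{P1} / |P1| - 1_{P2} / |P2|, where P1 and P2 are dyadic subcubes of P, bounds the difference of
   the averages of T chi over P1 and P2, so T chi is within a constant of its average almost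
   everywhere on P.  That T chi is locally integrable also comes from the stopping argument, as
   the number of the selected cubes containing x is integrable in x.

   Outside a cube containing the support of f, one uses the iterated dilates of that cube: there
   |T f| is bounded by the average of |f| over a dilate at least twice as large as the support,
   which is at most three times the mean oscillation. *)

Require Import Defs.
From HB Require Import structures.
From mathcomp Require Import all_boot all_order all_algebra.
From mathcomp Require Import all_classical all_reals all_analysis.
From mathcomp Require Import measurable_realfun ring lra.

Set Implicit Arguments.
Unset Strict Implicit.
Unset Printing Implicit Defensive.

Import Order.TTheory GRing.Theory Num.Theory.
Import numFieldNormedType.Exports.

Local Open Scope classical_set_scope.
Local Open Scope ring_scope.

(** * Cubes and dyadic trees *)

(** The kernel is controlled only through its smoothness, with no bound on its size, so no value of
    [T] is read off from [K] directly. Every pointwise bound combines a good point, which exists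
    because the exceptional sets have small density, with a bound for the oscillation between that
    point and [x], coming from the Dini condition or from T(1) = 0. This holds outside the support
    of [f] as well as inside.

    The maximal function is replaced by averages over the halos of the dyadic cubes of one root:
    they are countably many, they are all that the Dini tail sees, and one form of Vitali's lemma
    serves both for them and for the stopping cubes. Lebesgue's density theorem is replaced by a
    monotone class argument on the dyadic tree.

    The sparse family consists of the dilates [star P], while the disjoint sets lie in the cubes [P]
    themselves. A selected cube keeps half of itself, and its dilate is larger by the factor
    [star_ratio], whence the sparseness constant 1 / (2 [star_ratio]). *)

Section cubes.
Context {R : realType} {n : nat}.
Local Notation Rn := 'rV[R]_n.
Local Notation mu := (lebesgue_rV (R := R) n).
Implicit Types (c : Rn * R) (x : Rn) (s t : seq {ffun 'I_n -> bool}).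

(* A cube is encoded by its lower corner and its side length. *)
Definition box c : set Rn :=
  [set x | forall i, c.1 ord0 i <= x ord0 i < c.1 ord0 i + c.2].

Definition dil (r : R) c : Rn * R :=
  (\row_i (c.1 ord0 i - r * c.2), (1 + 2 * r) * c.2).

Definition child c (e : {ffun 'I_n -> bool}) : Rn * R :=
  (\row_i (c.1 ord0 i + (e i)%:R * (c.2 / 2)), c.2 / 2).

Definition node c s := foldl child c s.

Lemma measurable_box c : measurable (box c).
Proof.
rewrite (_ : box c = \big[setI/setT]_(i < n)
    (rV_coord i @^-1` `[c.1 ord0 i, c.1 ord0 i + c.2[%classic)); last first.
  apply/seteqP; split => x /=.
    by move=> h; rewrite -bigcap_seq => i _ /=; rewrite in_itv /=; exact: h.
  rewrite -bigcap_seq => h i; have := h i; rewrite /= in_itv /=; apply.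
  by rewrite mem_index_enum.
apply: bigsetI_measurable => i _.
by rewrite -[X in measurable X]setTI; apply: measurable_rV_coord.
Qed.
Hint Resolve measurable_box : core.

Lemma mu_box c : 0 <= c.2 -> mu (box c) = (c.2 ^+ n)%:E.
Proof.
move=> c0; pose b : Rn := \row_i (c.1 ord0 i + c.2).
rewrite (_ : box c = [set x | forall i, c.1 ord0 i <= x ord0 i < b ord0 i]).
  rewrite lebesgue_rV_box => [|i]; last by rewrite mxE lerDl.
  congr EFin; under eq_bigr do rewrite mxE addrAC subrr add0r.
  by rewrite prodr_const card_ord.
by apply/seteqP; split => x /= h i; have := h i; rewrite !mxE /=.
Qed.

Lemma mu_box_lty c : 0 <= c.2 -> (mu (box c) < +oo)%E.
Proof. by move=> c0; rewrite mu_box// ltry. Qed.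

Lemma box_integrable_bounded c (f : Rn -> R) (M : R) : 0 <= c.2 ->
  measurable_fun (box c) f -> (forall x, box c x -> `|f x| <= M) ->
  mu.-integrable (box c) (EFin \o f).
Proof.
move=> c0 mf fM; apply: measurable_bounded_integrable => //.
  exact: mu_box_lty.
exists M; split; first exact: num_real.
by move=> M' MM' x cx; apply: le_trans (fM _ cx) (ltW MM').
Qed.

Lemma node_cat c s t : node c (s ++ t) = node (node c s) t.
Proof. exact: foldl_cat. Qed.

Lemma node_rcons c s e : node c (rcons s e) = child (node c s) e.
Proof. exact: foldl_rcons. Qed.

Lemma node_side c s : (node c s).2 = c.2 / 2 ^+ size s.
Proof.
elim/last_ind: s => [|s e IH]; first by rewrite expr0 divr1.
by rewrite node_rcons /= IH size_rcons exprSr invfM mulrA.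
Qed.

Lemma node_gt0 c s : 0 < c.2 -> 0 < (node c s).2.
Proof. by move=> c0; rewrite node_side divr_gt0// exprn_gt0. Qed.

Lemma child_sub c e : 0 < c.2 -> box (child c e) `<=` box c.
Proof.
move=> c0 x /= + i => /(_ i) /=; rewrite mxE => /andP[h1 h2].
by case: (e i) h1 h2; rewrite ?mul1r ?mul0r => h1 h2; apply/andP; split; lra.
Qed.

Lemma node_sub c s : 0 < c.2 -> box (node c s) `<=` box c.
Proof.
move=> c0; elim/last_ind: s => [//|s e IH].
by rewrite node_rcons; apply: subset_trans IH; exact/child_sub/node_gt0.
Qed.

Definition bits c x : {ffun 'I_n -> bool} :=
  [ffun i => c.1 ord0 i + c.2 / 2 <= x ord0 i].

Lemma child_bits c x : box c x -> box (child c (bits c x)) x.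
Proof.
move=> cx i /=; rewrite !mxE ffunE; have /andP[h1 h2] := cx i.
by case: (leP (c.1 ord0 i + c.2 / 2) (x ord0 i)) => h /=; rewrite ?mul1r ?mul0r; apply/andP; split; lra.
Qed.

Lemma bits_child c x e : 0 < c.2 -> box (child c e) x -> bits c x = e.
Proof.
move=> c0 ex; apply/ffunP => i; rewrite ffunE.
have /andP[] := ex i; rewrite !mxE /=.
by case: (e i); rewrite ?mul1r ?mul0r => h1 h2; [apply/idP|apply/negbTE; rewrite -ltNge]; lra.
Qed.

(* The path from the root [c] to the dyadic cube of generation [k] containing [x]; it is
   meaningful only for [x] in [box c]. *)
Fixpoint addr c x k : seq {ffun 'I_n -> bool} :=
  if k is k'.+1 then rcons (addr c x k') (bits (node c (addr c x k')) x)
  else [::].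

Lemma size_addr c x k : size (addr c x k) = k.
Proof. by elim: k => //= k IH; rewrite size_rcons IH. Qed.

Lemma node_addr c x k : box c x -> box (node c (addr c x k)) x.
Proof.
by move=> cx; elim: k => //= k IH; rewrite node_rcons; exact: child_bits.
Qed.

Lemma addr_node c x s : 0 < c.2 -> box (node c s) x -> addr c x (size s) = s.
Proof.
move=> c0; elim/last_ind: s => [//|s e IH]; rewrite node_rcons size_rcons => ex /=.
have sx : box (node c s) x by apply: child_sub ex; exact: node_gt0.
by rewrite IH// (@bits_child _ _ e)//; exact: node_gt0.
Qed.

Lemma prefix_addr c x k m : (k <= m)%N -> take k (addr c x m) = addr c x k.
Proof.
elim: m => [|m IH]; first by case: k.
rewrite leq_eqVlt => /predU1P[->|km]; first by rewrite -{1}(size_addr c x m.+1) take_size.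
by rewrite [addr c x m.+1]/= -cats1 take_cat size_addr; case: ltnP => h;
  [rewrite IH|rewrite (_ : k = m) ?subnn ?take0 ?cats0 //; apply/eqP; rewrite eqn_leq h -ltnS km].
Qed.

(** Passing to a child halves the margin r c.2 along with the side, so the dilates are nested like
    the cubes. *)
Lemma dil_node_sub r c s : 0 <= r -> 0 < c.2 ->
  box (dil r (node c s)) `<=` box (dil r c).
Proof.
move=> r0 c0; elim/last_ind: s => [//|s e IH].
rewrite node_rcons; apply: subset_trans IH => x /= xP i; move: {xP}(xP i).
have := node_gt0 s c0; move: (node c s) => {}c {}c0; rewrite !mxE /=.
have rc : 0 <= r * c.2 by rewrite mulr_ge0// ltW.
by case: (e i); rewrite ?mul1r ?mul0r => /andP[h1 h2]; apply/andP; split; lra.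
Qed.

Lemma sub_dil r c : 0 <= r -> 0 <= c.2 -> box c `<=` box (dil r c).
Proof.
move=> r0 c0 x /= + i => /(_ i); rewrite !mxE /= => /andP[h1 h2].
have rc : 0 <= r * c.2 by rewrite mulr_ge0.
by apply/andP; split; lra.
Qed.

Lemma dil_sub r r' c : r <= r' -> 0 <= c.2 -> box (dil r c) `<=` box (dil r' c).
Proof.
move=> rr c0 x /= + i => /(_ i); rewrite !mxE /= => /andP[h1 h2].
have rc : r * c.2 <= r' * c.2 by rewrite ler_wpM2r.
by apply/andP; split; lra.
Qed.

Lemma dil_gt0 r c : 0 <= r -> 0 < c.2 -> 0 < (dil r c).2.
Proof. by move=> r0 c0; rewrite mulr_gt0//; lra. Qed.

Lemma box_corner c : 0 < c.2 -> box c c.1.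
Proof. by move=> c0 i; rewrite lexx ltrDl. Qed.

Lemma cube_box c : 0 < c.2 -> cube (box c).
Proof. by move=> c0; exists c.1, c.2. Qed.

End cubes.
#[global] Hint Extern 0 (measurable (box _)) => exact: measurable_box : core.

(** * Dyadic cubes generate the Borel sets of a cube *)

Section nodes.
Context {R : realType} {n : nat}.
Local Notation Rn := 'rV[R]_n.
Local Notation mu := (lebesgue_rV (R := R) n).
Implicit Types (c : Rn * R) (x : Rn) (s t : seq {ffun 'I_n -> bool}).

Lemma node_in_nbhs c x (U : set Rn) : 0 < c.2 -> box c x -> nbhs x U ->
  exists k, box (node c (addr c x k)) `<=` U.
Proof.
move=> c0 cx /nbhs_ballP[e /= e0 eU].
have [k ke] : exists k, c.2 / 2 ^+ k < e.
  have := archi_boundP (ltW (divr_gt0 c0 e0)).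
  set k := Num.bound _ => ck; exists k.
  rewrite ltr_pdivrMr ?exprn_gt0// mulrC -ltr_pdivrMr//.
  apply: lt_trans ck _; rewrite -natrX ltr_nat; exact: ltn_expl.
exists k => y ky; apply: eU; split => // i j.
have := node_addr k cx; move: ky ke.
rewrite -{2}(size_addr c x k) -node_side; set d := node c _ => ky de kx.
rewrite (ord1 i) /ball /=.
have /andP[h1 h2] := kx j; have /andP[h3 h4] := ky j.
by rewrite ltr_norml; apply/andP; split; lra.
Qed.

(** The sets decided by the first [k] steps of the address, for some [k]. They form a ring, and an
    integral over such a set is a finite sum of integrals over nodes. An arbitrary predicate [A]
    avoids any bookkeeping of finite lists. *)
Definition node_union c : set (set Rn) :=
  [set B | exists k (A : seq {ffun 'I_n -> bool} -> Prop),
    B = [set x | box c x /\ A (addr c x k)]].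

Lemma node_unionE c k A m : (k <= m)%N ->
  [set x | box c x /\ A (addr c x k)] =
  [set x | box c x /\ A (take k (addr c x m))].
Proof. by move=> km; apply/seteqP; split => x /=; rewrite prefix_addr. Qed.

Lemma setring_node_union c : setring (node_union c).
Proof.
split.
- by exists 0%N, (fun=> False); apply/seteqP; split => x // [].
- move=> _ _ [k [A ->]] [l [B ->]].
  exists (maxn k l), (fun s => A (take k s) \/ B (take l s)).
  rewrite (node_unionE c A (leq_maxl k l)) (node_unionE c B (leq_maxr k l)).
  apply/seteqP; split => x /=; first by case=> -[cx h]; split => //; [left|right].
  by move=> [cx []]; [left|right].
- move=> _ _ [k [A ->]] [l [B ->]].
  exists (maxn k l), (fun s => A (take k s) /\ ~ B (take l s)).
  rewrite (node_unionE c A (leq_maxl k l)) (node_unionE c B (leq_maxr k l)).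
  apply/seteqP; split => x /=; first by case=> -[cx h] h'; split => //; split => // hB; exact: h'.
  by move=> [cx [h1 h2]]; split => // -[].
Qed.

(** The nodes around a point shrink to it, so the nodes contained in [U], taken over all
    generations, exhaust the trace of [U]. *)
Lemma open_node_union c (U : set Rn) : 0 < c.2 -> open U ->
  <<sr node_union c>> (U `&` box c).
Proof.
move=> c0 oU; have [_ _ srU] := smallest_sigma_ring (node_union c).
rewrite (_ : U `&` box c = \bigcup_k [set x | box c x /\
  (fun s => box (node c s) `<=` U) (addr c x k)]); last first.
  apply/seteqP; split => x /=.
    move=> [Ux cx].
    have [|k kU] := node_in_nbhs c0 cx (U := U); first exact: open_nbhs_nbhs.
    by exists k.
  by move=> [k _ [cx]] h; split => //; apply: h; exact: node_addr.
apply: srU => k; apply: sub_g_sigma_ring.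
by exists k, (fun s => box (node c s) `<=` U).
Qed.

(** The ring lives inside [box c] while [measurable] is a sigma-algebra on the whole space; taking
    traces bridges the two. *)
Lemma sigma_ring_trace c : sigma_algebra setT [set B | <<sr node_union c>> (B `&` box c)].
Proof.
have [sr0 srD srU] := smallest_sigma_ring (node_union c).
have src : <<sr node_union c>> (box c).
  apply: sub_g_sigma_ring; exists 0%N, (fun=> True).
  by apply/seteqP; split => x //= [].
split => /=.
- by rewrite set0I.
- move=> A Ac; rewrite (_ : _ `&` _ = box c `\` (A `&` box c)).
    exact: srD.
  by rewrite setDIr setDv setU0 setTD setIC setDE.
- by move=> F FG; rewrite setI_bigcupl; exact: srU.
Qed.

Lemma measurable_trace c (B : set Rn) : 0 < c.2 -> measurable B ->
  <<sr node_union c>> (B `&` box c).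
Proof.
move=> c0; move: B; apply: smallest_sub; first exact: sigma_ring_trace.
rewrite -bigcup_seq; apply: bigcup_sub => i Ii A [Y mY <-].
rewrite setTI /=.
suff : sigma_algebra setT [set Y | <<sr node_union c>> (rV_coord i @^-1` Y `&` box c)].
  move=> sa; move: Y mY; rewrite RGenInftyO.measurableE; apply: smallest_sub => //.
  move=> _ [q ->] /=; apply: open_node_union => //.
  have /continuousP/(_ _ (lray_open q)) := @coord_continuous R 1 n ord0 i.
  exact.
have [sa0 saC saU] := sigma_ring_trace c.
split => /=; first by rewrite preimage_set0.
- by move=> A'; rewrite !setTD => /saC /=; rewrite setTD preimage_setC.
- by move=> F FG; rewrite preimage_bigcup; exact: saU.
Qed.

Lemma measurable_node_union c : 0 < c.2 -> <<sr node_union c>> `<=` measurable.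
Proof.
move=> c0; apply: smallest_sub.
  split; [exact: measurable0|exact: measurableD|exact: bigcupT_measurable].
move=> _ [k [A ->]].
rewrite (_ : mkset _ = \bigcup_s (if `[<A s /\ size s = k>] then box c `&` box (node c s) else set0)).
  apply: countable_bigcupT_measurable => // s; case: ifP => // _; exact: measurableI.
apply/seteqP; split => x /=.
  move=> [cx Ax]; exists (addr c x k) => //.
  by rewrite ifT; [split => //; exact: node_addr|apply/asboolP; rewrite size_addr].
move=> [s _]; case: ifPn => // /asboolP[As sk] [cx sx]; split => //.
by rewrite -sk addr_node.
Qed.

(** The sigma-algebra is generated by the coordinates, so this needs an argument: the space is
    exhausted by cubes, and on each of them the trace of [U] comes from dyadic cubes. *)
Lemma measurable_open (U : set Rn) : open U -> measurable U.
Proof.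
move=> oU; pose c k : Rn * R := (\row_i - k.+1%:R, (k.+1 * 2)%:R).
have c0 k : 0 < (c k).2 by rewrite /= ltr0n.
rewrite (_ : U = \bigcup_k (U `&` box (c k))).
  apply: bigcupT_measurable => k.
  by apply: (measurable_node_union (c0 k)); exact: open_node_union.
rewrite -setI_bigcupr; apply/seteqP; split => [x Ux|x []//]; split => //.
have [M xM] : exists M : R, forall i, `|x ord0 i| <= M.
  exists (\sum_i `|x ord0 i|) => i; rewrite (bigD1 i)//= lerDl.
  by apply: sumr_ge0.
exists (Num.bound (`|M|)) => // i; rewrite /= mxE.
have := archi_boundP (normr_ge0 M); set k := Num.bound _ => Mk.
have {}Mk : M < k%:R by apply: le_lt_trans Mk; exact: ler_norm.
have := xM i; rewrite ler_norml => /andP[h1 h2].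
rewrite natrM -[k.+1]addn1 natrD; apply/andP; split; lra.
Qed.

Lemma measurable_continuous (f : Rn -> R) : continuous f -> measurable_fun setT f.
Proof.
move=> /continuousP cf.
apply: (measurability (RGenInftyO.G (R:=R)) (RGenInftyO.measurableE R)).
move=> _ [_ [q ->] <-]; rewrite setTI; apply: measurable_open; apply: cf.
exact: lray_open.
Qed.

(** Dominated convergence in a form that serves increasing unions and decreasing intersections
    alike. *)
Lemma integral_eventually (D : set Rn) (H : (set Rn)^nat) (B : set Rn) (F : Rn -> \bar R) :
  measurable D -> mu.-integrable D F -> (forall k, measurable (H k)) -> measurable B ->
  (forall x, \forall k \near \oo, H k x <-> B x) ->
  (\int[mu]_(x in D `&` H k) F x)%E @[k --> \oo] --> (\int[mu]_(x in D `&` B) F x)%E.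
Proof.
move=> mD iF mH mB HB; rewrite integral_mkcondr.
under eq_fun do rewrite integral_mkcondr.
have mF := measurable_int _ iF.
have mr (A : set Rn) : measurable A -> measurable_fun D (F \_ A : Rn -> \bar R).
  move=> mA; apply/measurable_restrict => //.
  by apply: measurable_funS mF => //; exact: subIsetl.
have [|||||_ _ ] := @dominated_convergence _ _ _ mu D mD (fun k => F \_ (H k)) (F \_ B) (abse \o F); last exact.
- by move=> k; exact: mr.
- exact: mr.
- apply: aeW => x _; apply: cvg_near_cst; near=> k.
  have kB : H k x <-> B x by near: k; exact: HB.
  by rewrite /patch; case: ifPn; case: ifPn => //; rewrite !(inE, notin_setE) => h1 h2; exfalso; tauto.
- exact: integrable_abse.
- apply: aeW => x k _; rewrite /patch; case: ifPn => //= _.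
  by rewrite normr0 abse_ge0.
Unshelve. all: by end_near.
Qed.

(* The sets over which the integral of [F] is nonpositive form a monotone class, which replaces the
   Lebesgue differentiation theorem. *)
Lemma node_integral_le0 c (F : Rn -> R) : 0 < c.2 ->
  mu.-integrable (box c) (EFin \o F) ->
  (forall s, (\int[mu]_(x in box (node c s)) (F x)%:E <= 0)%E) ->
  {ae mu, forall x, box c x -> F x <= 0}.
Proof.
move=> c0 iF F0.
pose G := [set B | measurable B /\ (\int[mu]_(x in box c `&` B) (F x)%:E <= 0)%E].
have mG : monotone G.
  split=> H mH GH; (split; first by [apply: bigcupT_measurable => k; have [] := GH k|apply: bigcapT_measurable => k; have [] := GH k]).
  - have : (\int[mu]_(x in box c `&` H k) (F x)%:E)%E @[k --> \oo] -->
        (\int[mu]_(x in box c `&` \bigcup_k H k) (F x)%:E)%E.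
      apply: integral_eventually => //.
      + by move=> k; have [] := GH k.
      + by apply: bigcupT_measurable => k; have [] := GH k.
      + move=> x; have [[k _ Hk]|nH] := pselect ((\bigcup_k H k) x).
          exists k => // m /= km; split => _; first by exists k.
          by move: x Hk; apply/subsetPset; exact: mH.
        by apply: nearW => k; split => // Hk; exfalso; apply: nH; exists k.
    apply: cvge_le => //; apply: nearW => k; by have [] := GH k.
  - have : (\int[mu]_(x in box c `&` H k) (F x)%:E)%E @[k --> \oo] -->
        (\int[mu]_(x in box c `&` \bigcap_k H k) (F x)%:E)%E.
      apply: integral_eventually => //.
      + by move=> k; have [] := GH k.
      + by apply: bigcapT_measurable => k; have [] := GH k.
      + move=> x; have [Hx|/existsNP[k /not_implyP[_ nH]]] := pselect ((\bigcap_k H k) x).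
          by apply: nearW => k; split => // _; exact: Hx.
        exists k => // m /= km; split => [Hm|/(_ m)]; last exact.
        by exfalso; apply: nH; have /subsetPset := mH _ _ km; exact.
    apply: cvge_le => //; apply: nearW => k; by have [] := GH k.
have RG : node_union c `<=` G.
  move=> B RB; split; first exact: (measurable_node_union c0 (sub_g_sigma_ring RB)).
  move: RB => [k [A ->]].
  (* The set is the disjoint union of these finitely many nodes of generation [k], so its integral
     is a sum of nonpositive terms. *)
  pose r := [seq s : k.-tuple {ffun 'I_n -> bool} <- enum {: k.-tuple {ffun 'I_n -> bool}} | `[<A s>]].
  rewrite (_ : _ `&` _ = \big[setU/set0]_(s <- r) box (node c s)).
    rewrite integral_bigsetU_EFin//=.
    - by apply: sume_le0 => s _.
    - exact/filter_uniq/enum_uniq.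
    - move=> s t _ _ [x [sx tx]]; apply: val_inj.
      have := addr_node c0 tx; have := addr_node c0 sx.
      by rewrite !size_tuple => e1 e2; exact: etrans (esym e1) e2.
    - apply: measurable_funS (measurable_int _ iF) => //.
      by rewrite -bigcup_seq; apply: bigcup_sub => s _; exact: node_sub.
  rewrite -bigcup_seq; apply/seteqP; split => x /=.
    move=> [cx [_ Ax]]; have sk : size (addr c x k) == k by rewrite size_addr.
    exists (Tuple sk) => /=; last exact: node_addr.
    by rewrite mem_filter mem_enum andbT; exact/asboolP.
  move=> [s]; rewrite /= mem_filter => /andP[/asboolP As _] sx.
  have cx : box c x by apply: node_sub sx.
  by split => //; split => //; rewrite -(size_tuple s) addr_node.
have key (B : set Rn) : measurable B -> B `<=` box c ->
    (\int[mu]_(x in B) (F x)%:E <= 0)%E.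
  move=> mB Bc; have := measurable_trace c0 mB.
  move=> /(monotone_setring_sub_g_sigma_ring mG (setring_node_union c) RG) [_].
  by rewrite (setIidl Bc) (setIidr Bc).
have mF : measurable_fun (box c) F by apply/measurable_EFinP; exact: measurable_int iF.
(* On the set where [F] is positive the integral of [F] is both nonpositive, by [key], and equal to
   that of |F|, so this set is null. *)
pose B := box c `&` [set x | 0 < F x].
have mB : measurable B.
  have := mF (measurable_box c) _ (measurable_itv `]0, +oo[).
  by rewrite (_ : _ @^-1` _ = [set x | 0 < F x])//; apply/seteqP; split => x /=; rewrite in_itv/= andbT.
have Bc : B `<=` box c by exact: subIsetl.
have : (\int[mu]_(x in B) `|(F x)%:E| = 0)%E.
  apply/eqP; rewrite eq_le integral_ge0// andbT.
  apply: le_trans (key _ mB Bc); rewrite le_eqVlt; apply/orP; left; apply/eqP.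
  by apply: eq_integral => x /set_mem[_ /= Fx]; rewrite gtr0_norm.
have mFB : measurable_fun B (EFin \o F).
  by apply: measurable_funS (measurable_int _ iF).
move=> /(ae_eq_integral_abs mu mB mFB).
apply: filterS => x /= h cx; rewrite leNgt; apply/negP => Fx.
have : (F x)%:E = 0%E by apply: h; split.
by case=> Fx0; rewrite Fx0 ltxx in Fx.
Qed.
End nodes.

(** * Covering and stopping times *)

Section vitali.
Context {R : realType} {n : nat}.
Local Notation Rn := 'rV[R]_n.
Local Notation mu := (lebesgue_rV (R := R) n).
Implicit Types (c : Rn * R) (x : Rn).

Lemma meet_sub_dil c d : d.2 <= c.2 -> box d `&` box c !=set0 ->
  box d `<=` box (dil 1 c).
Proof.
move=> dc [y [dy cy]] x dx i; rewrite !mxE /=.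
by have /andP[? ?] := dx i; have /andP[? ?] := dy i; have /andP[? ?] := cy i;
  apply/andP; split; lra.
Qed.

Lemma exists_largest (s : seq (Rn * R)) : s != [::] ->
  exists2 c, c \in s & forall d, d \in s -> d.2 <= c.2.
Proof.
elim: s => [//|a [|b s] IH] _; first by exists a; rewrite ?mem_head// => d; rewrite inE => /eqP ->.
have [//|c cs cmax] := IH.
have [ac|ca] := leP a.2 c.2.
  by exists c; [rewrite inE cs orbT|move=> d; rewrite inE => /predU1P[->//|]; exact: cmax].
exists a; first exact: mem_head.
move=> d; rewrite inE => /predU1P[->//|/cmax dc]; exact: le_trans dc (ltW ca).
Qed.

Local Open Scope ereal_scope.

(** Take a largest cube [c]: the cubes meeting it lie in its threefold dilate, which gives 3 ^ n,
    and the others form a shorter list whose union is disjoint from [c], so that the integrals add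
    up. The inequality itself goes through the recursion, without extracting a disjoint
    subfamily. *)
Lemma vitali_boxes (g : Rn -> \bar R) (l : R) (s : seq (Rn * R)) :
  (forall x, 0 <= g x) -> measurable_fun setT g -> (0 <= l)%R ->
  (forall c, c \in s -> (0 < c.2)%R /\ l%:E * mu (box c) <= \int[mu]_(x in box c) g x) ->
  l%:E * mu (\bigcup_(c in [set` s]) box c) <=
    (3 ^+ n)%:E * \int[mu]_(x in \bigcup_(c in [set` s]) box c) g x.
Proof.
move=> g0 mg l0; have mU (t : seq (Rn * R)) : measurable (\bigcup_(c in [set` t]) box c).
  by rewrite bigcup_seq; apply: bigsetU_measurable => c _; exact: measurable_box.
have [k] := ubnP (size s); elim: k s => // k IH s sk Hs.
have [->|s0] := eqVneq s [::].
  by rewrite set_nil bigcup_set0 measure0 mule0 mule_ge0// ?lee_fin ?exprn_ge0//; exact: integral_ge0.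
have [c cs cmax] := exists_largest s0.
have [c0 Hc] := Hs _ cs.
pose s' := [seq d <- s | ~~ `[<box d `&` box c !=set0>]].
have s'P d : d \in s' -> d \in s /\ box d `&` box c = set0.
  by rewrite mem_filter => /andP[/asboolP /set0P/negP]; rewrite negbK => /eqP.
have s's : (size s' < k)%N.
  apply: (@leq_trans (size s)); last by rewrite -ltnS.
  rewrite size_filter.
  rewrite -(count_predC (fun d => `[<box d `&` box c !=set0>]) s) -add1n leq_add2r.
  rewrite -has_count; apply/hasP; exists c => //; apply/asboolP; rewrite setIid.
  exists c.1; exact: box_corner.
have {}IH := IH s' s's (fun d ds' => Hs d (s'P d ds').1).
set U' := \bigcup_(_ in [set` s']) _ in IH.
set U := \bigcup_(_ in [set` s]) _.
have disj : box c `&` U' = set0.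
  rewrite /U' setI_bigcupr bigcup0// => d /= /s'P[_]; by rewrite setIC.
have sub1 : U `<=` box (dil 1 c) `|` U'.
  move=> x [d /= ds dx]; have [/asboolP h|h] := boolP `[<box d `&` box c !=set0>].
    by left; apply: (meet_sub_dil _ h dx); exact: cmax.
  by right; exists d => //=; rewrite mem_filter h.
have sub2 : box c `|` U' `<=` U.
  by move=> x [cx|[d /= /s'P[ds _] dx]]; [exists c|exists d].
have m1 : mu (box (dil 1 c)) = (3 ^+ n)%:E * mu (box c).
  rewrite !mu_box ?ltW ?dil_gt0//= -EFinM -exprMn; congr (_ ^+ _)%:E.
  by congr (_ * _)%R; lra.
apply: (@le_trans _ _ (l%:E * (mu (box (dil 1 c)) + mu U'))).
  rewrite lee_wpmul2l ?lee_fin//.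
  apply: (@le_trans _ _ (mu (box (dil 1 c) `|` U'))).
    by apply: le_measure => //; rewrite ?inE; [exact: mU|apply: measurableU => //; exact: mU].
  by apply: measureU2 => //; exact: mU.
apply: (@le_trans _ _ ((3 ^+ n)%:E * \int[mu]_(x in box c `|` U') g x)).
  rewrite ge0_integral_setU//; last 3 first.
  - exact: mU.
  - by apply: measurable_funS mg.
  - by apply/disj_setPS; rewrite disj.
  rewrite ge0_muleDr ?measure_ge0// ge0_muleDr; [|exact: integral_ge0|exact: integral_ge0].
  by apply: leeD IH; rewrite m1 muleCA lee_wpmul2l// ?lee_fin ?exprn_ge0.
rewrite lee_wpmul2l ?lee_fin ?exprn_ge0//.
apply: ge0_subset_integral => //; [|exact: mU|].
- by apply: measurableU => //; exact: mU.
- exact: measurable_funS mg.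
Qed.

(** A countable family may have no largest cube, but its union is the increasing limit of finite
    unions, and the constant in [vitali_boxes] is uniform. *)
Lemma vitali_countable (I : countType) (P : set I) (c : I -> Rn * R)
    (g : Rn -> \bar R) (l : R) :
  (forall x, 0 <= g x) -> measurable_fun setT g -> (0 <= l)%R ->
  (forall i, P i -> (0 < (c i).2)%R /\
     l%:E * mu (box (c i)) <= \int[mu]_(x in box (c i)) g x) ->
  l%:E * mu (\bigcup_(i in P) box (c i)) <= (3 ^+ n)%:E * \int[mu]_x g x.
Proof.
move=> g0 mg l0 Hc.
pose s k := [seq c i | i <- pmap (@unpickle I) (iota 0 k) & `[<P i>]].
pose U k := \bigcup_(d in [set` s k]) box d.
have mU k : measurable (U k).
  by rewrite /U bigcup_seq; apply: bigsetU_measurable => d _; exact: measurable_box.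
have UE : \bigcup_(i in P) box (c i) = \bigcup_k U k.
  apply/seteqP; split => x.
    move=> [i Pi ix]; exists (pickle i).+1 => //; exists (c i) => //=.
    apply/mapP; exists i => //; rewrite mem_filter; apply/andP; split; first exact/asboolP.
    by rewrite mem_pmap; apply/mapP; exists (pickle i); rewrite ?mem_iota ?pickleK//=.
  by move=> [k _ [d /= /mapP[i]]]; rewrite mem_filter => /andP[/asboolP Pi _] -> ix; exists i.
have ndU : nondecreasing_seq U.
  move=> j k jk; apply/subsetPset => x [d /= /mapP[i]]; rewrite mem_filter => /andP[Pi].
  rewrite mem_pmap => /mapP[p]; rewrite mem_iota => pj ip -> ix.
  exists (c i) => //=; apply/mapP; exists i => //; rewrite mem_filter Pi mem_pmap/=.
  by apply/mapP; exists p => //; rewrite mem_iota; case/andP: pj => _ pj /=; rewrite (leq_trans pj).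
have cvU : (fun k => l%:E * mu (U k)) @ \oo --> l%:E * mu (\bigcup_k U k).
  apply: cvgeZl => //; apply: (nondecreasing_cvg_mu mU) => //.
  exact: bigcupT_measurable.
rewrite UE; apply: cvge_le cvU; apply: nearW => k.
apply: (@le_trans _ _ ((3 ^+ n)%:E * \int[mu]_(x in U k) g x)).
  apply: vitali_boxes => // d /mapP[i]; rewrite mem_filter => /andP[/asboolP Pi _] ->.
  exact: Hc.
rewrite lee_wpmul2l ?lee_fin ?exprn_ge0//.
by apply: ge0_subset_integral.
Qed.

End vitali.

Lemma le_fineK {R : realDomainType} (y : \bar R) (a : R) :
  (0 <= y)%E -> (y <= a%:E)%E -> y = (fine y)%:E.
Proof. by case: y => //; rewrite ?leye_eq ?leeNy_eq. Qed.

Lemma ae_forall_countable d (T : measurableType d) (R : realType)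
    (mu : {measure set T -> \bar R}) (I : countType) (P : I -> T -> Prop) :
  (forall i, {ae mu, forall x, P i x}) -> {ae mu, forall x, forall i, P i x}.
Proof.
move=> H; have /ae_foralln : forall k : nat, {ae mu, forall x,
    forall i, unpickle k = Some i -> P i x}.
  move=> k; case: (@unpickle I k) => [i|]; last exact: aeW.
  by apply: filterS (H i) => x h j [<-].
by apply: filterS => x /= h i; apply: (h (pickle i)); rewrite pickleK.
Qed.

(** * The stopping time on the dyadic tree *)

Section stopping.
Context {R : realType} {n : nat}.
Local Notation Rn := 'rV[R]_n.
Local Notation mu := (lebesgue_rV (R := R) n).
Local Notation address := (seq {ffun 'I_n -> bool}).
Implicit Types (x : Rn) (r s t : address).

(** If the density of a set in a cube is at most this level, its density in each child is at most 2
    ^ n times as large, that is 1/4. This leaves room for a good point in a child that has just been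
    selected. *)
Definition stop_level : R := 2^-1 ^+ n.+2.
(** Vitali's lemma loses 3 ^ n, so with this density of [E r] the cubes where the density exceeds
    [stop_level] cover at most half of the cube. *)
Definition small_level : R := stop_level / (2 * 3 ^+ n).

Lemma stop_level_gt0 : 0 < stop_level.
Proof. by rewrite exprn_gt0// invr_gt0. Qed.

Lemma stop_level_le : stop_level <= 4^-1.
Proof.
rewrite /stop_level -[n.+2]addn2 exprD expr2 -invfM -natrM.
by rewrite ler_piMl ?invr_ge0// exprn_ile1// ?invr_ge0// invf_le1// ler1n.
Qed.

Lemma small_level_gt0 : 0 < small_level.
Proof. by rewrite divr_gt0 ?stop_level_gt0// mulr_gt0// exprn_gt0. Qed.

Lemma small_level_le : small_level <= stop_level.
Proof.
rewrite /small_level ler_pdivrMr ?mulr_gt0 ?exprn_gt0//.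
rewrite ler_peMr ?ltW ?stop_level_gt0//.
have : 1 <= 3 ^+ n :> R by rewrite exprn_ege1// ler1n.
by move=> h; lra.
Qed.

Variables (c : Rn * R) (E : address -> set Rn).
Hypothesis c0 : 0 < c.2.
Hypothesis mE : forall s, measurable (E s).
Hypothesis E_small : forall s,
  (mu (box (node c s) `&` E s) <= small_level%:E * mu (box (node c s)))%E.

Definition stop r t : bool :=
  (stop_level%:E * mu (box (node c t)) < mu (box (node c t) `&` E r))%E.

(** [p] is the path already read, [r] the last cube selected on it and [s] the path still to be
    read; each test refers to the exceptional set of the latest selected cube. The root counts as
    selected. *)
Fixpoint anc_from (p r s : address) : address :=
  if s is e :: s' then
    anc_from (rcons p e) (if stop r (rcons p e) then rcons p e else r) s'
  else r.

(* [anc s] is the last cube selected by the stopping time on the way from the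
   root to [s]; the selected cubes are those with [anc s = s]. *)
Definition anc s := anc_from [::] [::] s.

Lemma anc_from_rcons p r s e :
  anc_from p r (rcons s e) =
    if stop (anc_from p r s) (p ++ rcons s e) then p ++ rcons s e
    else anc_from p r s.
Proof.
elim: s p r => [|a s IH] p r /=; first by rewrite cats1.
by rewrite IH cat_rcons.
Qed.

Lemma anc_rcons s e :
  anc (rcons s e) = if stop (anc s) (rcons s e) then rcons s e else anc s.
Proof. exact: anc_from_rcons. Qed.

Lemma size_anc s : (size (anc s) <= size s)%N.
Proof.
elim/last_ind: s => [//|s e IH]; rewrite anc_rcons size_rcons.
by case: ifP => _; rewrite ?size_rcons// (leq_trans IH).
Qed.

Lemma anc_idem s : anc (anc s) = anc s.
Proof.
elim/last_ind: s => [//|s e IH].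
have := anc_rcons s e; case: ifP => [_ h|_ ->//]; by rewrite h.
Qed.

Lemma anc_addr x s : box c x -> box (node c s) x ->
  anc s = addr c x (size (anc s)).
Proof.
move=> cx; elim/last_ind: s => [//|s e IH] ex.
have sx : box (node c s) x.
  by move: ex; rewrite node_rcons; apply: child_sub; exact: node_gt0.
rewrite anc_rcons; case: ifP => _; last exact: IH.
by rewrite (addr_node c0 ex).
Qed.

(** Either the cube has just been selected and [E_small] applies to it, or the stopping test has
    failed at it. *)
Lemma anc_small s :
  (mu (box (node c s) `&` E (anc s)) <= stop_level%:E * mu (box (node c s)))%E.
Proof.
have root : (mu (box (node c [::]) `&` E [::]) <= stop_level%:E * mu (box (node c [::])))%E.
  apply: le_trans (E_small [::]) _.
  by rewrite lee_wpmul2r ?measure_ge0// lee_fin small_level_le.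
elim/last_ind: s => [|s e _]; first exact: root.
rewrite anc_rcons; case: ifPn => [_|]; last by rewrite /stop -leNgt.
apply: le_trans (E_small _) _.
by rewrite lee_wpmul2r ?measure_ge0// lee_fin small_level_le.
Qed.

Lemma mu_node_child s e :
  mu (box (node c s)) = ((2 ^+ n)%:E * mu (box (node c (rcons s e))))%E.
Proof.
rewrite !mu_box ?ltW ?node_gt0// -EFinM node_rcons/= -exprMn.
by congr ((_ ^+ _)%:E); rewrite mulrC divfK.
Qed.

(** The set is that of the ancestor of the parent, so the bound holds even if the child is selected.
    It is what licenses the passage from one selected cube to the next. *)
Lemma anc_child_small s e : (mu (box (node c (rcons s e)) `&` E (anc s)) <=
   4^-1%:E * mu (box (node c (rcons s e))))%E.
Proof.
apply: (@le_trans _ _ (mu (box (node c s) `&` E (anc s)))).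
  apply: le_measure; rewrite ?inE; [exact: measurableI|exact: measurableI|].
  by apply: setSI; rewrite node_rcons; apply: child_sub; exact: node_gt0.
apply: le_trans (anc_small s) _; rewrite (mu_node_child s e) muleA -EFinM.
rewrite lee_wpmul2r ?measure_ge0// lee_fin /stop_level -[n.+2]addn2 exprD.
rewrite mulrAC -exprMn mulVf// expr1n mul1r expr2 -invfM -natrM.
by [].
Qed.

Definition stopped_children r : set address :=
  [set t | [/\ t != [::], anc (take (size t).-1 t) = r & stop r t]].

Definition remainder r : set Rn :=
  box (node c r) `\` \bigcup_(t in stopped_children r) box (node c t).

Lemma measurable_stopped r :
  measurable (\bigcup_(t in stopped_children r) box (node c t)).
Proof.
rewrite bigcup_mkcond; apply: countable_bigcupT_measurable => // t.
by case: ifP => // _; exact: measurable_box.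
Qed.

Lemma measurable_remainder r : measurable (remainder r).
Proof. by apply: measurableD => //; exact: measurable_stopped. Qed.

(** A point of the remainder meets no further stop below [r]. Hence it determines [r], which yields
    the disjointness of the remainders. *)
Lemma remainder_anc r x k : anc r = r -> remainder r x -> (size r <= k)%N ->
  anc (addr c x k) = r.
Proof.
move=> rr [rx nx]; have cx : box c x by exact: node_sub rx.
elim: k => [|k IH] rk.
  by move: rr; have -> : r = [::] by apply/size0nil/eqP; rewrite -leqn0.
move: rk; rewrite leq_eqVlt => /predU1P[<-|rk].
  by rewrite addr_node.
have {}IH := IH rk.
have := anc_rcons (addr c x k) (bits (node c (addr c x k)) x).
rewrite -/(addr c x k.+1) IH => ->; case: ifPn => // st; exfalso; apply: nx.
exists (addr c x k.+1); last exact: node_addr.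
split => //; first by rewrite -size_eq0 size_addr.
by rewrite size_addr prefix_addr.
Qed.

Lemma trivIset_remainder : trivIset [set r | anc r = r] remainder.
Proof.
move=> r r' /= rr rr' [x [rx rx']].
rewrite -(remainder_anc (k := maxn (size r) (size r')) rr rx) ?leq_maxl//.
by apply: remainder_anc => //; rewrite leq_maxr.
Qed.

Lemma stopped_sub r t : stopped_children r t -> box (node c t) `<=` box (node c r).
Proof.
move=> [+ + _] x tx; case/lastP: t tx => // t e tx _.
rewrite size_rcons/= -cats1 take_size_cat// => tr.
have cx : box c x by exact: node_sub tx.
have sx : box (node c t) x by move: tx; rewrite node_rcons; apply: child_sub; exact: node_gt0.
by have := anc_addr cx sx; rewrite tr => ->; exact: node_addr.
Qed.

Lemma mu_remainder r : (mu (box (node c r)) <= 2%:E * mu (remainder r))%E.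
Proof.
set U := \bigcup_(t in stopped_children r) box (node c t).
have mU : measurable U by exact: measurable_stopped.
have m2 := measurable_remainder r.
pose Er := box (node c r) `&` E r.
have mEr : measurable Er by exact: measurableI.
have HU : (stop_level%:E * mu U <= (3 ^+ n)%:E * mu Er)%E.
  have := @vitali_countable R n address (stopped_children r) (node c)
    (EFin \o \1_Er) stop_level.
  rewrite integral_indic// setIT; apply.
  - by move=> x /=; rewrite lee_fin.
  - by apply/measurable_EFinP; exact: measurable_indic.
  - exact/ltW/stop_level_gt0.
  move=> t tr; split; first exact: node_gt0.
  rewrite integral_indic// setIC /Er setIA (setIidl (stopped_sub tr)).
  by case: tr => _ _ /ltW.
have {}HU : (mu U <= 2^-1%:E * mu (box (node c r)))%E.
  move: HU; rewrite -lee_pdivlMl ?stop_level_gt0// => HU.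
  apply: le_trans HU _; rewrite -lee_pdivlMl ?invr_gt0 ?stop_level_gt0// invrK.
  apply: (@le_trans _ _ ((3 ^+ n)%:E * (small_level%:E * mu (box (node c r))))%E).
    by rewrite lee_wpmul2l ?lee_fin ?exprn_ge0//; exact: E_small.
  rewrite !muleA -!EFinM lee_wpmul2r ?measure_ge0// lee_fin /small_level.
  have : 3 ^+ n != 0 :> R by rewrite expf_neq0.
  by move=> h; rewrite le_eqVlt; apply/orP; left; apply/eqP; field.
have : (mu (box (node c r)) <= mu U + mu (remainder r))%E.
  apply: (@le_trans _ _ (mu (U `|` remainder r))).
    apply: le_measure; rewrite ?inE//; first exact: measurableU.
    by move=> x rx; have [Ux|nUx] := pselect (U x); [left|right].
  exact: measureU2.
have fin : (mu (remainder r) <= mu (box (node c r)))%E.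
  by apply: le_measure; rewrite ?inE//; exact: subDsetl.
move: HU fin; rewrite mu_box; last exact/ltW/node_gt0.
move=> HU fin.
have Uf := le_fineK (measure_ge0 mu U) HU.
have rf := le_fineK (measure_ge0 mu (remainder r)) fin.
by move: HU; rewrite Uf rf -!EFinM -EFinD !lee_fin => HU *; lra.
Qed.

Definition level_selected k : set address := [set s | size s = k /\ anc s = s].

Lemma finite_level_selected k : finite_set (level_selected k).
Proof.
apply: (@sub_finite_set _ _ [set val t | t in [set: k.-tuple {ffun 'I_n -> bool}]]).
  by move=> s [/eqP sk _]; exists (Tuple sk).
exact/finite_image/finite_finset.
Qed.

Lemma level_selectedE k : [set x | box c x /\ anc (addr c x k) = addr c x k] =
  \bigcup_(s in level_selected k) box (node c s).
Proof.
apply/seteqP; split => x /=.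
  move=> [cx Fx]; exists (addr c x k); last exact: node_addr.
  by split => //; rewrite size_addr.
move=> [s [<- Fs] sx]; split; first exact: node_sub sx.
by rewrite addr_node.
Qed.

Lemma measurable_level_selected k :
  measurable (\bigcup_(s in level_selected k) box (node c s)).
Proof.
rewrite bigcup_mkcond; apply: countable_bigcupT_measurable => // t.
by case: ifP => // _; exact: measurable_box.
Qed.

Lemma mu_level_selected k : (mu (\bigcup_(s in level_selected k) box (node c s)) <=
  2%:E * mu (\bigcup_(s in level_selected k) remainder s))%E.
Proof.
have fk := finite_level_selected k.
rewrite (measure_fin_bigcup mu fk)//; last first.
  by move=> s t [sk _] [tk _] [x [sx tx]]; rewrite -(addr_node c0 sx) -(addr_node c0 tx) sk tk.
rewrite (measure_fin_bigcup mu fk)//; last 2 first.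
- by apply: sub_trivIset trivIset_remainder => s [].
- by move=> s _; exact: measurable_remainder.
rewrite ge0_mule_fsumr; last by move=> s; exact: measure_ge0.
by apply: lee_fsum => // s _; exact: mu_remainder.
Qed.

(** The Carleson packing condition: in each generation the selected cubes have at most twice the
    measure of their remainders, and all the remainders are disjoint subsets of [box c]. *)
Lemma carleson : (\int[mu]_(x in box c)
  \sum_(k <oo) (anc (addr c x k) == addr c x k)%:R%:E < +oo)%E.
Proof.
pose B k := \bigcup_(s in level_selected k) box (node c s).
pose A k := \bigcup_(s in level_selected k) remainder s.
have mB k : measurable (B k) by exact: measurable_level_selected.
have mA k : measurable (A k).
  rewrite /A bigcup_mkcond; apply: countable_bigcupT_measurable => // t.
  by case: ifP => // _; exact: measurable_remainder.
have BE x k : box c x -> (anc (addr c x k) == addr c x k)%:R = \1_(B k) x :> R.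
  move=> cx; rewrite indicE /B -level_selectedE; congr (_ %:R); congr nat_of_bool.
  by apply/eqP/idP => [h|]; rewrite inE /=; [|case].
under eq_integral => x /set_mem cx.
  under eq_eseriesr => k _ do rewrite BE//.
  over.
rewrite integral_nneseries//; last first.
  by move=> k; apply/measurable_EFinP; exact: measurable_indic.
apply: (@le_lt_trans _ _ (\sum_(k <oo) 2%:E * mu (A k))%E).
  apply: lee_nneseries => [k _ _|k _]; first by apply: integral_ge0 => x _; rewrite lee_fin.
  rewrite integral_indic//; apply: le_trans (mu_level_selected k).
  apply: le_measure; rewrite ?inE; [exact: measurableI|exact: mB|].
  exact: subIsetl.
rewrite nneseriesZl//.
rewrite -measure_semi_bigcup//; first last.
- exact: bigcupT_measurable.
- move=> j k _ _ [x [[s [sj Fs] sx] [t [tk Ft] tx]]].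
  have st : s = t by apply: trivIset_remainder Fs Ft _; exists x.
  by rewrite -sj st.
have Ac : (mu (\bigcup_k A k) <= mu (box c))%E.
  apply: le_measure; rewrite ?inE//; first exact: bigcupT_measurable.
  by move=> x [k _ [s _ [sx _]]]; exact: node_sub sx.
move: Ac; rewrite mu_box; last exact: ltW.
move=> Ac.
apply: (@le_lt_trans _ _ (2%:E * (c.2 ^+ n)%:E)%E); last by rewrite -EFinM ltry.
by apply: lee_wpmul2l; rewrite ?lee_fin.
Qed.

Lemma size_anc_le x j k : (j <= k)%N ->
  (size (anc (addr c x j)) <= size (anc (addr c x k)))%N.
Proof.
elim: k => [|k IH]; first by rewrite leqn0 => /eqP ->.
rewrite leq_eqVlt => /predU1P[->//|jk]; apply: leq_trans (IH jk) _.
rewrite [addr c x k.+1]/= anc_rcons; case: ifP => // _.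
by rewrite size_rcons (leq_trans (size_anc _))// size_addr.
Qed.

Lemma integrable_height : mu.-integrable (box c)
  (fun x => \sum_(k <oo) (anc (addr c x k) == addr c x k)%:R%:E)%E.
Proof.
have m k : measurable_fun (box c) (fun x => (anc (addr c x k) == addr c x k)%:R%:E : \bar R).
  apply/measurable_EFinP.
  pose B := \bigcup_(s in level_selected k) box (node c s).
  apply: (@eq_measurable_fun _ _ _ _ _ (\1_B : Rn -> R)); last first.
    by apply: measurable_indic; exact: measurable_level_selected.
  move=> x /set_mem cx; rewrite indicE /B -level_selectedE; congr (_ %:R); congr nat_of_bool.
  by apply/idP/eqP; rewrite inE /=; [case|].
apply/integrableP; split; first exact: ge0_emeasurable_sum.
under eq_integral do rewrite gee0_abs ?nneseries_ge0//.
exact: carleson.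
Qed.

(** The number of selected cubes containing [x] is integrable, hence finite almost everywhere, and
    then [x] lies in the remainder of the last one. *)
Lemma ae_remainder :
  {ae mu, forall x, box c x -> exists2 r, anc r = r & remainder r x}.
Proof.
have := integrable_height.
move=> /(integrable_ae (measurable_box c)); apply: filterS => x /= h cx.
have {}h := h cx.
have [k0 k0P] : exists k0, forall k, (k0 <= k)%N -> anc (addr c x k) != addr c x k.
  pose f k : \bar R := (anc (addr c x k) == addr c x k)%:R%:E.
  have f0 k : (0 <= f k)%E by rewrite lee_fin.
  have fty : (\sum_(k <oo) f k < +oo)%E by move: h; rewrite fin_numE => /andP[_]; rewrite ltey.
  have cv := nneseries_tail_cvg fty (fun k _ => f0 k).
  (* The terms are 0 or 1, so a tail of sum less than 1 vanishes. *)
  have /cv[N _ HN] : nbhs (0%E : \bar R) [set y | (y < 1%E)%E].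
    by apply: open_nbhs_nbhs; split; [exact: open_ereal_lt_ereal|rewrite /= lte01].
  exists N => k Nk; apply/eqP => ek; have := HN N (leqnn N); rewrite /= ltNge => /negP; apply.
  apply: le_trans (@nneseries_lim_ge _ f xpredT N k.+1 _); last by move=> *; exact: f0.
  rewrite big_nat_recr//= /f ek eqxx leeDr//; apply: sume_ge0 => i _; exact: f0.
have anck k : (k0 <= k)%N -> anc (addr c x k) = anc (addr c x k0).
  elim: k => [|k IH]; first by rewrite leqn0 => /eqP ->.
  rewrite leq_eqVlt => /predU1P[->//|k0k]; rewrite -IH//.
  have := k0P k.+1 (leqW k0k); rewrite [addr c x k.+1]/= anc_rcons.
  by case: ifP => //; rewrite eqxx.
pose r := anc (addr c x k0); exists r; first exact: anc_idem.
have rE : r = addr c x (size r) by apply: anc_addr => //; exact: node_addr.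
have rk0 : (size r <= k0)%N by have := size_anc (addr c x k0); rewrite size_addr.
split; first by rewrite rE; exact: node_addr.
move=> [t tr tx]; have [t0 tanc st] := tr.
have tE := addr_node c0 tx.
case/lastP: t tr t0 tanc st tx tE => // t e tr _.
rewrite size_rcons/= -cats1 take_size_cat// cats1 => tanc st tx tE.
have te : anc (addr c x (size t).+1) = rcons t e by rewrite /= tE anc_rcons tanc st.
have rt : (size r <= size t)%N by rewrite -tanc size_anc.
have [kt|tk] := leqP k0 (size t).+1.
  by have := anck _ kt; rewrite te -/r => h'; move: rt; rewrite -h' size_rcons ltnn.
by have := size_anc_le x (ltnW tk); rewrite te -/r size_rcons ltnNge rt.
Qed.

(** This set has density at most [stop_level] < 1 in every node, so its indicator minus [stop_level]
    has nonpositive integrals over nodes and is nonpositive almost everywhere, which fails at each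
    point of the set. *)
Lemma remainder_negligible r : anc r = r -> mu.-negligible (remainder r `&` E r).
Proof.
move=> rr; have mD : measurable (remainder r `&` E r).
  by apply: measurableI => //; exact: measurable_remainder.
set D := _ `&` _ in mD *.
have Dc : D `<=` box c by move=> x [[rx _] _]; exact: node_sub rx.
(* A node that meets the remainder either still has [r] as its selected ancestor, so that
   [anc_small] applies, or it contains the node [r], where [E r] is already small. *)
have dens s : (mu (box (node c s) `&` D) <= stop_level%:E * mu (box (node c s)))%E.
  have [[x [sx rx]]|/set0P/negP] := pselect (box (node c s) `&` remainder r !=set0); last first.
    rewrite negbK => /eqP s0; rewrite (_ : _ `&` D = set0).
      by rewrite measure0 mule_ge0 ?measure_ge0// lee_fin ltW// stop_level_gt0.
    by rewrite /D setIA s0 set0I.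
  have cx : box c x by exact: node_sub sx.
  have sE := addr_node c0 sx.
  have [rs|sr] := leqP (size r) (size s).
    have := anc_small s; rewrite -{2}sE (remainder_anc rr rx rs).
    apply: le_trans; apply: le_measure; rewrite ?inE; [exact: measurableI|exact: measurableI|].
    by apply: setIS; exact: subIsetr.
  have sub : box (node c r) `<=` box (node c s).
    move=> y ry; have rE := addr_node c0 (proj1 rx).
    have -> : s = addr c y (size s).
      rewrite -sE !size_addr -(prefix_addr _ _ (ltnW sr)) -(prefix_addr c y (ltnW sr)).
      by rewrite rE addr_node.
    by apply: node_addr; exact: node_sub ry.
  apply: (@le_trans _ _ (mu (box (node c r) `&` E r))).
    apply: le_measure; rewrite ?inE; [exact: measurableI|exact: measurableI|].
    by move=> y [_ [[ry _] Ey]].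
  apply: le_trans (E_small r) _; apply: lee_pmul => //.
  - by rewrite lee_fin ltW// small_level_gt0.
  - by rewrite lee_fin small_level_le.
  - by apply: le_measure; rewrite ?inE.
have := @node_integral_le0 R n c (fun x => \1_D x - stop_level) c0.
case.
- apply: (@box_integrable_bounded _ _ _ _ 2); [exact: ltW| |].
    by apply: measurable_funB => //; exact: measurable_indic.
  move=> x _ /=; rewrite indicE; have := stop_level_le; have := stop_level_gt0.
  by case: (x \in D) => /= h1 h2; rewrite ler_norml; apply/andP; split; lra.
- move=> s; have s0 := ltW (node_gt0 s c0); under eq_integral do rewrite EFinB.
  rewrite integralB//.
  + rewrite integral_indic// integral_cst//.
    have := dens s; rewrite setIC; set a := (_ * mu _)%E => ds.
    have afin : a \is a fin_num by rewrite /a mu_box.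
    by rewrite leeBlDr// add0e.
  + apply: (@box_integrable_bounded _ _ _ _ 1) => //.
    by move=> x _; rewrite indicE; case: (x \in D); rewrite ?normr1 ?normr0.
  + exact: (@box_integrable_bounded _ _ _ (cst stop_level) `|stop_level|).
move=> N [mN N0 NP]; exists N; split => // x Dx; apply: NP => /= h.
have /h : box c x by exact: Dc.
rewrite indicE mem_set//=; have := stop_level_le; have := stop_level_gt0.
by move=> *; clear rr N0; lra.
Qed.

Lemma stopping_domination (u : address -> Rn -> R) (w : address -> R) :
  (forall s, {ae mu, forall x, box (node c s) x -> ~ E s x -> u s x <= w s}) ->
  (forall s t, (mu (box (node c (s ++ t)) `&` E s) <=
       4^-1%:E * mu (box (node c (s ++ t))))%E ->
     {ae mu, forall x, box (node c (s ++ t)) x -> u s x <= w s + u (s ++ t) x}) ->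
  {ae mu, forall x, box c x -> exists m,
     u [::] x <= \sum_(k < m | anc (addr c x k) == addr c x k) w (addr c x k)}.
Proof.
move=> H1 H2.
have aer : {ae mu, forall x, forall r, anc r = r -> ~ (remainder r x /\ E r x)}.
  apply: ae_forall_countable => r; have [rr|nr] := pselect (anc r = r); last exact: aeW.
  apply: negligibleS (remainder_negligible rr) => x /= h; apply: contrapT => nx.
  by apply: h => _ h'; apply: nx.
have {}H1 := ae_forall_countable H1.
have {}H2 : {ae mu, forall x, forall p : address * address,
    (mu (box (node c (p.1 ++ p.2)) `&` E p.1) <=
       4^-1%:E * mu (box (node c (p.1 ++ p.2))))%E ->
    box (node c (p.1 ++ p.2)) x -> u p.1 x <= w p.1 + u (p.1 ++ p.2) x}.
  apply: ae_forall_countable => -[s t] /=.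
  have [h|nh] := pselect (mu (box (node c (s ++ t)) `&` E s) <=
       4^-1%:E * mu (box (node c (s ++ t))))%E; last exact: aeW.
  by apply: filterS (H2 s t h) => x h' _.
apply: (filterS _ (filterI (filterI (filterI aer H1) H2) ae_remainder)).
move=> x [[[nE {}H1] {}H2] H3] cx.
have [r rr rx] := H3 cx.
(* The [w] of the last selected cube stands on both sides: it is cancelled either by the cost of
   passing to the next selected cube or, at the end, by the bound [u r x <= w r] outside [E r]. *)
have step m : u [::] x + w (anc (addr c x m)) <=
    \sum_(k < m.+1 | anc (addr c x k) == addr c x k) w (addr c x k) +
    u (anc (addr c x m)) x.
  elim: m => [|m IH]; first by rewrite big_mkcond big_ord_recr big_ord0/= ?eqxx add0r addrC.
  rewrite big_mkcond big_ord_recr/= -big_mkcond/= -/(addr c x m.+1).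
  have mx : box (node c (addr c x m)) x by exact: node_addr.
  have tx : box (node c (addr c x m.+1)) x by exact: node_addr.
  set s := addr c x m in IH mx *; set e := bits (node c s) x.
  have -> : addr c x m.+1 = rcons s e by [].
  rewrite anc_rcons; case: ifPn => st; last first.
    rewrite ifF ?addr0//; apply/negP => /eqP h.
    by have := size_anc s; rewrite h size_rcons ltnn.
  rewrite eqxx.
  have [t tE] : exists t, rcons s e = anc s ++ t.
    exists (drop (size (anc s)) (rcons s e)).
    rewrite -{1}(cat_take_drop (size (anc s)) (rcons s e)); congr (_ ++ _).
    rewrite {2}(anc_addr cx mx) (_ : rcons s e = addr c x m.+1)// prefix_addr//.
    by rewrite (leq_trans (size_anc _))// size_addr.
  have := H2 (anc s, t); rewrite /= -tE => /(_ (anc_child_small s e) tx) h.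
  have : u [::] x + w (anc s) <= \sum_(k < m.+1 | anc (addr c x k) == addr c x k) w (addr c x k) +
     (w (anc s) + u (rcons s e) x) by apply: le_trans IH _; rewrite lerD2l.
  set S := \sum_(_ < _ | _) _ => h'; clear rr tE; lra.
exists (size r).+1; have := step (size r).
rewrite (remainder_anc rr rx (leqnn _)).
have : u r x <= w r by apply: H1; [exact: (proj1 rx)|move=> Er; apply: (nE r rr); split].
set S := \sum_(_ < _ | _) _ => h' h; clear rr; lra.
Qed.

End stopping.

(* [F] holds at the selected cubes.  The last clause is to be used with [u s = |T F_Q|] and
   [E s = E_Q], where [Q = node c s]: [u] is dominated at the cost of [w] off the exceptional set, and
   when passing to a descendant in which that set has small density. *)
Lemma stopping_time {R : realType} {n : nat} (c : 'rV[R]_n * R)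
    (E : seq {ffun 'I_n -> bool} -> set 'rV[R]_n) :
  let mu := lebesgue_rV (R := R) n in
  0 < c.2 -> (forall s, measurable (E s)) ->
  (forall s, (mu (box (node c s) `&` E s) <=
     (small_level (R := R) (n := n))%:E * mu (box (node c s)))%E) ->
  exists (F : pred (seq {ffun 'I_n -> bool}))
         (A : seq {ffun 'I_n -> bool} -> set 'rV[R]_n),
  [/\ F [::],
      forall s, [/\ measurable (A s), A s `<=` box (node c s) &
        (mu (box (node c s)) <= 2%:E * mu (A s))%E],
      trivIset [set s | F s] A,
      mu.-integrable (box c) (fun x => \sum_(k <oo) (F (addr c x k))%:R%:E)%E &
      forall (u : seq {ffun 'I_n -> bool} -> 'rV[R]_n -> R) w,
        (forall s, {ae mu, forall x, box (node c s) x -> ~ E s x -> u s x <= w s}) ->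
        (forall s t, (mu (box (node c (s ++ t)) `&` E s) <=
             4^-1%:E * mu (box (node c (s ++ t))))%E ->
           {ae mu, forall x, box (node c (s ++ t)) x -> u s x <= w s + u (s ++ t) x}) ->
        {ae mu, forall x, box c x -> exists m,
           u [::] x <= \sum_(k < m | F (addr c x k)) w (addr c x k)}].
Proof.
move=> mu c0 mE sE; exists (fun s => anc c E s == s), (remainder c E); split.
- by rewrite eqxx.
- move=> s; split; [exact: measurable_remainder|exact: subDsetl|exact: mu_remainder].
- apply: sub_trivIset (trivIset_remainder c0 (E := E)) => s /=; exact/eqP.
- exact: integrable_height.
- by move=> u w H1 H2; exact: stopping_domination.
Qed.

(** * Dini kernels *)

Section modulus.
Context {R : realType}.
Variable omega : R -> R.
Hypothesis omega_dini : dini_modulus omega.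

Lemma omega_ge0 t : 0 <= t -> 0 <= omega t.
Proof. by case: omega_dini => w0 mono _ _ t0; rewrite -w0 mono. Qed.

(** On the interval from 2^-(k+1) to 2^-k the integrand is at least omega(2^-(k+1)) / 2^-k;
    multiplying by the length gives half of the term of the series. *)
Lemma omega_series : (\sum_(k <oo) (omega (2^-1 ^+ k.+1))%:E < +oo)%E.
Proof.
have [_ mono _ dini] := omega_dini.
pose F k : set R := [set` `]2^-1 ^+ k.+1, 2^-1 ^+ k]].
have h0 k : 0 < 2^-1 ^+ k :> R by rewrite exprn_gt0// invr_gt0.
have hle j k : (j <= k)%N -> 2^-1 ^+ k <= 2^-1 ^+ j :> R.
  by move=> jk; rewrite ler_wiXn2l// ?invr_ge0// invf_le1// ler1n.
have F01 k : F k `<=` [set` `]0, 1]].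
  move=> t; rewrite /F /= !in_itv/= => /andP[t1 t2]; apply/andP; split.
    exact: lt_trans t1.
  by apply: le_trans t2 (hle 0%N k _).
have tF : trivIset setT F.
  apply/trivIsetP => i j _ _; wlog ij : i j / (i < j)%N => [h|_].
    move=> ij; have := ij; rewrite neq_ltn => /orP[/h|/h]; first exact.
    by rewrite eq_sym setIC; apply.
  apply/seteqP; split => // t [] /=; rewrite /F /= !in_itv/= => /andP[t1 _] /andP[_ t2].
  by have := lt_le_trans t1 (le_trans t2 (hle _ _ ij)); rewrite ltxx.
have mF k : measurable (F k) by exact: measurable_itv.
have mI : measurable ([set` `]0, 1]] : set R) by exact: measurable_itv.
have mw : measurable_fun ([set` `]0, 1]] : set R) (fun t => omega t / t).
  apply: measurable_funM.
    (* Monotonicity is only given on nonnegative arguments; truncation extends it to the line. *)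
    apply: (eq_measurable_fun (fun t : R => omega (Num.max t 0))).
      by move=> t; rewrite inE /= in_itv/= => /andP[t0 _]; rewrite max_l// ltW.
    apply: nondecreasing_measurable => // s t st.
    apply: mono; first by rewrite le_max lexx orbT.
    by rewrite ge_max !le_max st lexx !orbT.
  apply: (measurable_funS (measurable_itv `]0, +oo[)).
    by move=> t /=; rewrite !in_itv/= andbT => /andP[].
  apply: open_continuous_measurable_fun; first exact: interval_open.
  move=> t; rewrite inE /= in_itv/= andbT => t0; apply: inv_continuous.
  by rewrite gt_eqF.
have mwE : measurable_fun ([set` `]0, 1]] : set R) (fun t => (omega t / t)%:E).
  exact/measurable_EFinP.
have ge0 t : ([set` `]0, 1]] : set R) t -> (0 <= (omega t / t)%:E)%E.
  by rewrite /= in_itv/= => /andP[t0 _]; rewrite lee_fin divr_ge0 ?omega_ge0 ?ltW.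
have UF : \bigcup_k F k `<=` [set` `]0, 1]] by apply: bigcup_sub => k _; exact: F01.
have : (\sum_(k <oo) (2^-1)%:E * (omega (2^-1 ^+ k.+1))%:E < +oo)%E.
  apply: le_lt_trans dini.
  apply: (@le_trans _ _ (\int[lebesgue_measure]_(t in \bigcup_k F k) (omega t / t)%:E)%E).
    rewrite ge0_integral_bigcup//; last 2 first.
    - by apply: measurable_funS mwE.
    - by move=> t /UF; exact: ge0.
    apply: lee_nneseries => [k _ _|k _].
      by rewrite -EFinM lee_fin mulr_ge0 ?invr_ge0// omega_ge0// ltW.
    have : (\int[lebesgue_measure]_(t in F k) (cst ((omega (2^-1 ^+ k.+1) / 2^-1 ^+ k)%:E) t)
       <= \int[lebesgue_measure]_(t in F k) (omega t / t)%:E)%E.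
      apply: ge0_le_integral => //.
      - exact: mF.
      - by move=> t _; rewrite lee_fin divr_ge0 ?omega_ge0 ?ltW.
      - by apply: measurable_funS mwE.
      - move=> t /[dup] /F01 /=; rewrite /F/= !in_itv/= => /andP[t0 _] /andP[t1 t2].
        rewrite lee_fin; apply: ler_pM; [exact/omega_ge0/ltW|by rewrite invr_ge0 ltW| |].
          by apply: mono; exact: ltW.
        by rewrite lef_pV2 ?posrE.
    rewrite integral_cst; last exact: mF.
    apply: le_trans.
    rewrite [X in (_ <= _ * X)%E]lebesgue_measure_itv/= lte_fin ifT; last first.
      by rewrite exprSr ltr_pdivrMr// ltr_pMr// ltr1n.
    rewrite -EFinB -!EFinM lee_fin exprS.
    have := h0 k; move: (2^-1 ^+ k) => a a0.
    rewrite le_eqVlt; apply/orP; left; apply/eqP; field.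
    by rewrite gt_eqF.
  by apply: ge0_subset_integral => //; exact: bigcupT_measurable.
rewrite nneseriesZl; last by move=> k _; rewrite lee_fin omega_ge0// ltW.
have : (0 <= \sum_(k <oo) (omega (2^-1 ^+ k.+1))%:E)%E.
  by apply: nneseries_ge0 => k _ _; rewrite lee_fin omega_ge0// ltW.
case: (\sum_(k <oo) _)%E => [r _ _| _|//]; first by rewrite ltry.
by rewrite gt0_muley// lte_fin invr_gt0.
Qed.

End modulus.

Section kernel.
Context {R : realType} {n : nat}.
Local Notation Rn := 'rV[R]_n.
Local Notation mu := (lebesgue_rV (R := R) n).
Hypothesis n_gt0 : (0 < n)%N.
Implicit Types (c : Rn * R) (x y : Rn).

(* With this ratio, [enorm (x - x') <= enorm (x - y) / 2] when [x] and [x'] lie in a cube and [y]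
   outside its dilate. *)
Definition halo_ratio : R := (2 * n)%:R.

Definition halo c k := dil (halo_ratio * 2 ^+ k) c.

Definition star c := halo c 0.

Lemma halo_ratio_ge1 : 1 <= halo_ratio.
Proof. by rewrite /halo_ratio -[1]/(1%:R) ler_nat muln_gt0. Qed.

Lemma halo_ratio2_ge1 k : 1 <= halo_ratio * 2 ^+ k.
Proof.
apply: (le_trans halo_ratio_ge1); apply: ler_peMr; first by rewrite /halo_ratio ler0n.
by apply: exprn_ege1; rewrite ler1n.
Qed.

Lemma halo_gt0 c k : 0 < c.2 -> 0 < (halo c k).2.
Proof. by move=> c0; apply: dil_gt0 => //; rewrite (le_trans _ (halo_ratio2_ge1 k)). Qed.

Lemma star_gt0 c : 0 < c.2 -> 0 < (star c).2.
Proof. exact: halo_gt0. Qed.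

Lemma sub_halo c k : 0 < c.2 -> box c `<=` box (halo c k).
Proof.
by move=> c0; apply: sub_dil; [rewrite (le_trans _ (halo_ratio2_ge1 k))|exact: ltW].
Qed.

Lemma le_enorm (v : Rn) i : `|v ord0 i| <= enorm v.
Proof.
rewrite /enorm -sqrtr_sqr ler_wsqrtr// (bigD1 i)//= lerDl.
by apply: sumr_ge0 => j _; exact: sqr_ge0.
Qed.

Lemma enorm_ge0 (v : Rn) : 0 <= enorm v.
Proof. exact: sqrtr_ge0. Qed.

Lemma enorm_box c x x' : 0 <= c.2 -> box c x -> box c x' ->
  enorm (x - x') <= n%:R * c.2.
Proof.
move=> c0 cx cx'.
have nc : 0 <= n%:R * c.2 by rewrite mulr_ge0.
rewrite /enorm -(ger0_norm nc) -sqrtr_sqr ler_wsqrtr//.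
apply: (@le_trans _ _ (\sum_(i < n) c.2 ^+ 2)).
  apply: ler_sum => i _; rewrite !mxE -real_normK ?num_real// lerXn2r ?nnegrE//.
  have /andP[h1 h2] := cx i; have /andP[h3 h4] := cx' i.
  by rewrite ler_norml; apply/andP; split; lra.
rewrite sumr_const card_ord exprMn -[leLHS]mulr_natl ler_wpM2r ?sqr_ge0//.
by rewrite -natrX ler_nat expnS expn1 leq_pmulr.
Qed.

Lemma halo_far c k x y : box c x -> ~ box (halo c k) y ->
  halo_ratio * 2 ^+ k * c.2 < enorm (x - y).
Proof.
move=> cx /existsNP[i /negP]; rewrite !mxE /= negb_and -ltNge -leNgt => h.
apply: lt_le_trans (le_enorm _ i); rewrite !mxE.
have /andP[h1 h2] := cx i; move: (halo_ratio * 2 ^+ k) h => r h.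
by rewrite lter_normr; case/orP: h => h; apply/orP; [left|right]; lra.
Qed.

Lemma halo_cover c y : 0 < c.2 -> exists k, box (halo c k) y.
Proof.
move=> c0; pose M := \sum_i (`|y ord0 i - c.1 ord0 i|) / c.2.
have M0 : 0 <= M.
  by apply: sumr_ge0 => i _; rewrite divr_ge0// ltW.
pose k := Num.bound M; exists k => i; rewrite !mxE /=.
have kM : M < k%:R by exact: archi_boundP.
have k2 : k%:R <= halo_ratio * 2 ^+ k :> R.
  rewrite -[k%:R]mul1r ler_pM ?halo_ratio_ge1// -natrX ler_nat ltnW//.
  exact: ltn_expl.
have : `|y ord0 i - c.1 ord0 i| / c.2 <= M.
  rewrite /M (bigD1 i)//= lerDl; apply: sumr_ge0 => j _.
  by rewrite divr_ge0// ltW.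
rewrite ler_pdivrMr// ler_norml => /andP[h1 h2].
have : M * c.2 < halo_ratio * 2 ^+ k * c.2 by rewrite ltr_pM2r//; exact: lt_le_trans kM k2.
by move: (halo_ratio * 2 ^+ k) => r ?; apply/andP; split; lra.
Qed.

Variables (K : Rn -> Rn -> R) (omega : R -> R).
Hypothesis omega_dini : dini_modulus omega.
Hypothesis K_smooth : smooth_kernel omega K.

(** For [y] outside [halo c k] and [x], [x'] in the cube, |x - y| exceeds 2 n 2^k c.2 and |x - x'|
    is at most n c.2. The quotient in the smoothness condition is thus at most 2^-(k+1). *)
Definition tail_coef c k : R :=
  omega (2^-1 ^+ k.+1) / (halo_ratio * 2 ^+ k * c.2) ^+ n.

(* A majorant of [K x y - K x' y] for [x], [x'] in [box c] and [y] outside of [box (star c)]. *)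
Definition tail c y : \bar R :=
  (\sum_(k <oo) (tail_coef c k * \1_(box (halo c k.+1)) y)%:E)%E.

Lemma tail_coef_ge0 c k : 0 < c.2 -> 0 <= tail_coef c k.
Proof.
move=> c0; apply: divr_ge0; first by apply: omega_ge0 => //; rewrite exprn_ge0 ?invr_ge0.
by apply: exprn_ge0; rewrite mulr_ge0 ?(ltW c0)// (le_trans _ (halo_ratio2_ge1 k)).
Qed.

Lemma tail_term_ge0 c k y : 0 < c.2 ->
  (0 <= (tail_coef c k * \1_(box (halo c k.+1)) y)%:E)%E.
Proof. by move=> c0; rewrite lee_fin mulr_ge0 ?tail_coef_ge0// indicE. Qed.

Lemma tail_ge0 c y : 0 < c.2 -> (0 <= tail c y)%E.
Proof. by move=> c0; apply: nneseries_ge0 => k _ _; exact: tail_term_ge0. Qed.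

Lemma measurable_tail_term c k :
  measurable_fun setT (fun y => (tail_coef c k * \1_(box (halo c k.+1)) y)%:E).
Proof.
apply/measurable_EFinP; apply: measurable_funM => //.
Qed.

Lemma measurable_tail c : 0 < c.2 -> measurable_fun setT (tail c).
Proof.
move=> c0; apply: ge0_emeasurable_sum => [k y _ _|k _]; first exact: tail_term_ge0.
exact: measurable_tail_term.
Qed.

Lemma kernel_tail c x x' y : 0 < c.2 -> box c x -> box c x' -> ~ box (star c) y ->
  (`|K x y - K x' y|%:E <= tail c y)%E.
Proof.
move=> c0 cx cx' ny.
(* The term of the shell containing [y] already majorises the difference. *)
have [k ky] : exists k, box (halo c k.+1) y /\ ~ box (halo c k) y.
  have /cid[m hm] := halo_cover y c0.
  elim: m hm => [//|m IH] hm.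
  by have [h|h] := pselect (box (halo c m) y); [exact: IH|exists m].
have [ky1 ky2] := ky.
have far := halo_far cx ky2.
set r := halo_ratio * 2 ^+ k * c.2 in far.
have r0 : 0 < r by rewrite mulr_gt0//; apply: lt_le_trans (halo_ratio2_ge1 k).
have e0 : 0 < enorm (x - y) := lt_trans r0 far.
have near := enorm_box (ltW c0) cx cx'.
have ratio : enorm (x - x') / enorm (x - y) <= 2^-1 ^+ k.+1.
  rewrite ler_pdivrMr//; apply: le_trans near _.
  apply: (@le_trans _ _ (2^-1 ^+ k.+1 * r)); last by rewrite ler_wpM2l ?exprn_ge0 ?invr_ge0// ltW.
  rewrite /r /halo_ratio natrM !mulrA; rewrite exprS.
  rewrite -[X in _ <= X * _]mulrA.
  have : 2^-1 ^+ k * 2 ^+ k = 1 :> R by rewrite -exprMn mulVf// expr1n.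
  move: (2^-1 ^+ k) (2 ^+ k) => a b ab.
  by rewrite le_eqVlt; apply/orP; left; apply/eqP; field: ab.
have xy : x != y.
  apply/eqP => xy; move: e0; rewrite xy subrr /enorm big1 ?sqrtr0 ?ltxx//.
  by move=> i _; rewrite mxE expr0n.
have half : enorm (x - x') <= enorm (x - y) / 2.
  rewrite -ler_pdivrMl// mulrC; apply: le_trans ratio _.
  by rewrite exprS ler_piMr ?invr_ge0// exprn_ile1 ?invr_ge0// invf_le1// ler1n.
have [_ mono _ _] := omega_dini.
apply: (@le_trans _ _ (tail_coef c k)%:E).
  rewrite lee_fin; apply: le_trans (K_smooth xy half) _.
  have q0 : 0 <= enorm (x - x') / enorm (x - y) by rewrite divr_ge0 ?enorm_ge0.
  apply: ler_pM; [exact: omega_ge0|by rewrite invr_ge0 exprn_ge0// enorm_ge0|exact: mono|].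
  rewrite lef_pV2 ?posrE ?exprn_gt0//.
  by rewrite lerXn2r ?nnegrE ?(ltW r0) ?(ltW e0)// ltW.
rewrite /tail.
have := @nneseries_lim_ge R (fun k => (tail_coef c k * \1_(box (halo c k.+1)) y)%:E)
  xpredT 0 k.+1 (fun j _ _ => tail_term_ge0 j y c0).
apply: le_trans; rewrite big_nat_recr//= indicE mem_set// mulr1 leeDr//.
by apply: sume_ge0 => j _; exact: tail_term_ge0.
Qed.

Definition dini_sum : R := fine (\sum_(k <oo) (omega (2^-1 ^+ k.+1))%:E).

Lemma dini_sumE : (\sum_(k <oo) (omega (2^-1 ^+ k.+1))%:E)%E = dini_sum%:E.
Proof.
rewrite /dini_sum fineK// ge0_fin_numE ?omega_series//.
by apply: nneseries_ge0 => k _ _; rewrite lee_fin omega_ge0// exprn_ge0// invr_ge0.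
Qed.

Lemma dini_sum_ge0 : 0 <= dini_sum.
Proof.
rewrite -lee_fin -dini_sumE.
by apply: nneseries_ge0 => k _ _; rewrite lee_fin omega_ge0// exprn_ge0// invr_ge0.
Qed.

Definition tail_const : R := 5 ^+ n * dini_sum.

(** With a = [halo_ratio] 2^k, the side is (1 + 4 a) c.2, at most 5 a c.2 since a >= 1. *)
Lemma mu_halo c k : 0 < c.2 ->
  (mu (box (halo c k.+1)) <= (5 ^+ n * (halo_ratio * 2 ^+ k * c.2) ^+ n)%:E)%E.
Proof.
move=> c0; rewrite mu_box; last exact/ltW/halo_gt0.
have r1 := halo_ratio2_ge1 k; have r2 := halo_ratio2_ge1 k.+1.
have hk : (halo c k.+1).2 <= 5 * (halo_ratio * 2 ^+ k * c.2).
  rewrite /halo /dil /= [leRHS]mulrA ler_wpM2r ?(ltW c0)//.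
  rewrite exprS (mulrCA halo_ratio); move: (halo_ratio * 2 ^+ k) r1 => a a1; lra.
rewrite lee_fin -exprMn lerXn2r ?nnegrE//; first exact/ltW/halo_gt0.
by apply: le_trans hk; exact/ltW/halo_gt0.
Qed.

(** Only averages over the concentric halos enter, which is why these suffice in the definition of
    the exceptional sets. *)
Lemma tail_integral c (F : Rn -> R) (l : R) : 0 < c.2 ->
  (forall y, 0 <= F y) -> measurable_fun setT F -> 0 <= l ->
  (forall k, \int[mu]_(y in box (halo c k.+1)) (F y)%:E <=
             l%:E * mu (box (halo c k.+1)))%E ->
  (\int[mu]_y (tail c y * (F y)%:E) <= (tail_const * l)%:E)%E.
Proof.
move=> c0 F0 mF l0 Fl.
have mFE : measurable_fun setT (EFin \o F) by exact/measurable_EFinP.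
have -> : (\int[mu]_y (tail c y * (F y)%:E))%E =
    (\int[mu]_y \sum_(k <oo) ((F y)%:E * (tail_coef c k * \1_(box (halo c k.+1)) y)%:E))%E.
  apply: eq_integral => y _; rewrite muleC /tail nneseriesZl//.
  by move=> k _; exact: tail_term_ge0.
rewrite integral_nneseries//; last 2 first.
- by move=> k; apply: emeasurable_funM => //; exact: measurable_tail_term.
- by move=> k y _; rewrite mule_ge0 ?lee_fin//; exact: tail_term_ge0.
apply: (@le_trans _ _ (\sum_(k <oo) (5 ^+ n * l)%:E * (omega (2^-1 ^+ k.+1))%:E)%E).
  apply: lee_nneseries.
    move=> k _ _; apply: integral_ge0 => y _.
    by rewrite mule_ge0 ?lee_fin//; exact: tail_term_ge0.
  move=> k _.
  have -> : (\int[mu]_y ((F y)%:E * (tail_coef c k * \1_(box (halo c k.+1)) y)%:E) =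
     \int[mu]_y ((tail_coef c k)%:E * ((EFin \o F) \_ (box (halo c k.+1))) y))%E.
    apply: eq_integral => y _; rewrite /patch indicE; case: ifPn => yB /=.
      by rewrite mulr1 muleC.
    by rewrite mulr0 !mule0.
  rewrite ge0_integralZl//; last 3 first.
  - apply/(measurable_restrictT _ (measurable_box _)).
    exact: measurable_funTS.
  - by move=> y _; rewrite /patch; case: ifPn => //= _; rewrite lee_fin.
  - by rewrite lee_fin tail_coef_ge0.
  rewrite -integral_mkcond.
  apply: (@le_trans _ _ ((tail_coef c k)%:E * (l%:E * mu (box (halo c k.+1))))%E).
    by rewrite lee_wpmul2l ?lee_fin ?tail_coef_ge0//; exact: Fl.
  apply: (@le_trans _ _ ((tail_coef c k)%:E * (l%:E * (5 ^+ n * (halo_ratio * 2 ^+ k * c.2) ^+ n)%:E))%E).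
    by rewrite lee_wpmul2l ?lee_fin ?tail_coef_ge0// lee_wpmul2l ?lee_fin//; exact: mu_halo.
  rewrite -!EFinM lee_fin /tail_coef.
  have r0 : 0 < halo_ratio * 2 ^+ k * c.2 by rewrite mulr_gt0//; apply: lt_le_trans (halo_ratio2_ge1 k).
  have := exprn_gt0 n r0; move: (_ ^+ n) => a a0.
  rewrite le_eqVlt; apply/orP; left; apply/eqP; field.
  by rewrite gt_eqF.
rewrite nneseriesZl; last first.
  by move=> k _; rewrite lee_fin omega_ge0// exprn_ge0// invr_ge0.
by rewrite dini_sumE -EFinM lee_fin /tail_const mulrAC.
Qed.
End kernel.

(** * Operators of weak type and Dini kernels *)

Section supports.
Context {R : realType} {n : nat}.
Local Notation Rn := 'rV[R]_n.
Local Notation mu := (lebesgue_rV (R := R) n).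
Implicit Types (c : Rn * R) (x y : Rn) (f g : Rn -> R).

Lemma coord_le_norm x i : `|x ord0 i| <= `|x|.
Proof. by rewrite [leRHS]/Num.norm /= mx_normrE; apply/bigmax_geP; right => /=; exists (ord0, i). Qed.

Lemma compact_supp_sub (a b : Rn) f :
  (forall x, f x != 0 -> forall i, a ord0 i <= x ord0 i <= b ord0 i) ->
  compact (supp f).
Proof.
move=> fab.
pose B : set Rn := [set x | forall i, `[a ord0 i, b ord0 i]%classic (x ord0 i)].
have cB : compact B.
  by apply: (rV_compact (A := fun i => `[a ord0 i, b ord0 i]%classic)) => i; exact: segment_compact.
have clB : closed B by apply: compact_closed => //; exact: norm_hausdorff.
apply: (@subclosed_compact _ (supp f) B) => //; first exact: closed_closure.
rewrite [X in _ `<=` X](closure_id B).1//; apply: closure_subset => x /= fx i.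
by rewrite /= in_itv/=; exact: fab.
Qed.

Lemma compact_supp_box c f : (forall x, ~ box c x -> f x = 0) -> compact (supp f).
Proof.
move=> fc; apply: (@compact_supp_sub c.1 (\row_i (c.1 ord0 i + c.2))) => x fx i.
have cx : box c x by apply: contrapT => /fc fx0; rewrite fx0 eqxx in fx.
by have /andP[h1 h2] := cx i; rewrite !mxE h1 ltW.
Qed.

Lemma supp_in_box f : compact (supp f) ->
  exists c, 0 < c.2 /\ forall x, ~ box c x -> f x = 0.
Proof.
move=> /compact_bounded[M [_ HM]].
pose L := `|M| + 1.
exists (\row_i - L, 2 * L + 1); split.
  by rewrite /= /L; have := normr_ge0 M; lra.
move=> x nx; apply: contrapT => /eqP fx; apply: nx => i.
have ML : M < L by rewrite /L; have := ler_norm M; lra.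
have : `|x| <= L by apply: HM => //; apply: subset_closure.
move=> /(le_trans (coord_le_norm x i)); rewrite ler_norml /= mxE => /andP[h1 h2].
by apply/andP; split; lra.
Qed.

Lemma compact_supp_mul f g : compact (supp f) -> compact (supp (fun x => f x * g x)).
Proof.
move=> /supp_in_box[c [_ fc]]; apply: (@compact_supp_box c) => x nx.
by rewrite fc// mul0r.
Qed.

Lemma compact_supp_comb f g (h : Rn -> R) : compact (supp f) -> compact (supp g) ->
  (forall x, f x = 0 -> g x = 0 -> h x = 0) -> compact (supp h).
Proof.
move=> /supp_in_box[c [_ fc]] /supp_in_box[d [_ gd]] hfg.
apply: (@compact_supp_sub (\row_i Num.min (c.1 ord0 i) (d.1 ord0 i))
  (\row_i Num.max (c.1 ord0 i + c.2) (d.1 ord0 i + d.2))) => x hx i.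
rewrite !mxE ge_min le_max; have [cx|ncx] := pselect (box c x).
  by have /andP[h1 h2] := cx i; rewrite h1 (ltW h2).
have [dx|ndx] := pselect (box d x).
  by have /andP[h1 h2] := dx i; rewrite h1 (ltW h2) !orbT.
by move: hx; rewrite hfg ?eqxx//; [exact: fc|exact: gd].
Qed.

Lemma not_supp f x (e : R) : 0 < e ->
  (forall y, (forall i, `|x ord0 i - y ord0 i| < e) -> f y = 0) -> ~ supp f x.
Proof.
move=> e0 fe; rewrite /supp => /(_ (ball x e) (nbhsx_ballx x e e0))[y [/= fy [_ xy]]].
by move: fy; rewrite fe ?eqxx// => i; have := xy ord0 i.
Qed.

Lemma L1_indic c : 0 <= c.2 -> L1 (\1_(box c) : Rn -> R).
Proof.
move=> c0; apply/integrableP; split.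
  by apply/measurable_EFinP; exact: measurable_indic.
under eq_integral do rewrite /= ger0_norm//.
by rewrite integral_indic// setIT mu_box_lty.
Qed.

Lemma L1_measurable f : L1 f -> measurable_fun setT f.
Proof. by move=> /measurable_int/measurable_EFinP. Qed.

Lemma L1_mul f g : L1 f -> measurable_fun setT g -> (forall x, `|g x| <= 1) ->
  L1 (fun x => f x * g x).
Proof.
move=> fL gm g1; apply: (le_integrable measurableT _ _ fL).
  by apply/measurable_EFinP; apply: measurable_funM => //; exact: L1_measurable.
by move=> x _; rewrite lee_fin normrM ler_piMr.
Qed.

Lemma indic_le1 (A : set Rn) x : `|\1_A x : R| <= 1.
Proof. by rewrite indicE; case: (_ \in _); rewrite ?normr1 ?normr0. Qed.

Lemma L1_restrict f (A : set Rn) : L1 f -> measurable A -> L1 (fun x => f x * \1_A x).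
Proof.
by move=> fL mA; apply: L1_mul => // x; exact: indic_le1.
Qed.

Lemma L1_lin a f g : L1 f -> L1 g -> L1 (fun x => a * f x + g x).
Proof.
move=> fL gL; have := integrableD measurableT (integrableZl measurableT a fL) gL.
exact: eq_integrable.
Qed.

Lemma L1_norm_fin f : L1 f -> (\int[mu]_x `|f x|%:E)%E = (\int[mu]_x `|f x|)%:E.
Proof.
move=> fL; rewrite /Rintegral fineK//; apply: integrable_fin_num => //.
exact: (integrable_norm fL).
Qed.

End supports.

Section operator.
Context {R : realType} {n : nat}.
Local Notation Rn := 'rV[R]_n.
Local Notation mu := (lebesgue_rV (R := R) n).
Implicit Types (c : Rn * R) (x y : Rn) (f g : Rn -> R).
Hypothesis n_gt0 : (0 < n)%N.
Variables (T : (Rn -> R) -> Rn -> R) (K : Rn -> Rn -> R) (omega : R -> R).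
Hypothesis omega_dini : dini_modulus omega.
Hypothesis K_smooth : smooth_kernel omega K.
Hypothesis T_repr : represented_by T K.
Hypothesis T_lin : linear_on_L1 T.
Hypothesis T_meas : forall f, L1 f -> measurable_fun setT (T f).
Variable A : R.
Hypothesis A_gt0 : 0 < A.
Hypothesis T_weak : forall f, L1 f -> forall l : R, 0 < l ->
  (l%:E * mu [set x | (l < `|T f x|)%R] <= A%:E * \int[mu]_x `|f x|%:E)%E.

Lemma star_supp c f x : 0 < c.2 -> (forall y, box (star c) y -> f y = 0) ->
  box c x -> ~ supp f x.
Proof.
move=> c0 fc cx; have rad := halo_ratio_ge1 (R := R) n_gt0.
apply: (@not_supp _ _ _ _ (halo_ratio (R := R) (n := n) * c.2)).
  by rewrite mulr_gt0// (lt_le_trans _ rad).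
move=> y xy; apply: fc => i; rewrite !mxE /= expr0 mulr1.
have /andP[h1 h2] := cx i; have := xy i; rewrite ltr_norml => /andP[h3 h4].
by move: (halo_ratio (R := R) (n := n)) h3 h4 {rad xy} => r h3 h4; apply/andP; split; lra.
Qed.

(** Both points are off the support, so the kernel formula holds at each of them, and the bound is
    valid everywhere on the cube, not just almost everywhere. *)
Lemma T_osc c f x x' : 0 < c.2 -> L1 f -> compact (supp f) ->
  (forall y, box (star c) y -> f y = 0) -> box c x -> box c x' ->
  (`|T f x - T f x'|%:E <= \int[mu]_y (tail omega c y * `|f y|%:E))%E.
Proof.
move=> c0 fL fs fc cx cx'.
have [i1 ->] := T_repr fL fs (star_supp c0 fc cx).
have [i2 ->] := T_repr fL fs (star_supp c0 fc cx').
rewrite -RintegralB//.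
have iD : L1 (fun y => K x y * f y - K x' y * f y).
  have := integrableB measurableT i1 i2; exact: eq_integrable.
apply: (@le_trans _ _ (\int[mu]_y `|K x y * f y - K x' y * f y|)%:E).
  by rewrite lee_fin; exact: le_normr_Rintegral.
rewrite -L1_norm_fin//; apply: ge0_le_integral => //.
- by apply/measurable_EFinP; apply: measurableT_comp => //; exact: L1_measurable.
- apply: emeasurable_funM; first exact: measurable_tail.
  by apply/measurable_EFinP; apply: measurableT_comp => //; exact: L1_measurable.
- move=> y _; have [sy|ny] := pselect (box (star c) y).
    by rewrite fc// !mulr0 subr0 normr0 mule0.
  rewrite -mulrBl normrM EFinM lee_wpmul2r// ?lee_fin//.
  exact: kernel_tail.
Qed.

Lemma measurable_weak f (l : R) : L1 f -> measurable [set x | l < `|T f x|].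
Proof.
move=> fL; have := T_meas fL => mf.
have : measurable_fun setT (fun x => `|T f x|) by exact: measurableT_comp.
move=> /(_ measurableT _ (measurable_itv `]l, +oo[)).
by rewrite setTI; congr measurable; apply/seteqP; split => x /=; rewrite in_itv/= andbT.
Qed.

Lemma weak_small f (B O m : R) : L1 f -> 0 < B -> 0 <= O -> 0 <= m ->
  (\int[mu]_x `|f x|%:E <= (O * m)%:E)%E ->
  (mu [set x | (B * O < `|T f x|)%R] <= (A / B * m)%:E)%E.
Proof.
move=> fL B0; rewrite le_eqVlt => /predU1P[<-|O0] m0 fO; last first.
  have BO : 0 < B * O by rewrite mulr_gt0.
  have := T_weak fL BO; rewrite -lee_pdivlMl// => h; apply: le_trans h _.
  apply: (@le_trans _ _ (((B * O)^-1)%:E * (A%:E * (O * m)%:E))%E).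
    rewrite lee_wpmul2l ?lee_fin ?invr_ge0 ?(ltW BO)//.
    by rewrite lee_wpmul2l ?lee_fin ?(ltW A_gt0).
  rewrite -!EFinM lee_fin le_eqVlt; apply/orP; left; apply/eqP; field.
  by rewrite !gt_eqF.
have f0 : (\int[mu]_x `|f x|%:E = 0)%E.
  by apply/eqP; rewrite eq_le integral_ge0// andbT (le_trans fO)// mul0r.
(* For [O] = 0 the level is 0, out of reach of the weak type bound, so the set is exhausted by
   positive levels, each giving a null set. *)
rewrite mulr0 (_ : [set x | _] = \bigcup_k [set x | k.+1%:R^-1 < `|T f x|]); last first.
  apply/seteqP; split => x /=; last first.
    by move=> [k _]; apply: lt_trans; rewrite invr_gt0.
  move=> Tx; have iT : 0 <= `|T f x|^-1 by rewrite invr_ge0.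
  have := archi_boundP iT; set k := Num.bound _ => ik; exists k => //=.
  rewrite invf_plt ?posrE//; apply: (lt_trans ik); by rewrite ltr_nat.
rewrite (_ : mu _ = 0%E); first by rewrite lee_fin mulr_ge0 ?divr_ge0 ?(ltW A_gt0) ?(ltW B0).
apply/negligibleP; first by apply: bigcupT_measurable => k; exact: measurable_weak.
apply: negligible_bigcup => k; apply/negligibleP; first exact: measurable_weak.
have k0 : 0 < k.+1%:R^-1 :> R by rewrite invr_gt0.
have := T_weak fL k0; rewrite f0 mule0 -lee_pdivlMl// mule0 => h.
by apply/eqP; rewrite eq_le h measure_ge0.
Qed.

End operator.

(** Two sets whose densities add up to less than 1 leave positive measure in the cube, which no null
    set can cover. *)
Lemma good_point {R : realType} {n : nat} (c : 'rV[R]_n * R)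
    (E1 E2 : set 'rV[R]_n) (a b : R) (Q : 'rV[R]_n -> Prop) :
  let mu := lebesgue_rV (R := R) n in
  0 < c.2 -> measurable E1 -> measurable E2 -> a + b < 1 ->
  (mu (box c `&` E1) <= a%:E * mu (box c))%E ->
  (mu (box c `&` E2) <= b%:E * mu (box c))%E ->
  {ae mu, forall x, Q x} ->
  exists x, [/\ box c x, ~ E1 x, ~ E2 x & Q x].
Proof.
move=> mu c0 m1 m2 ab e1 e2 [N [mN N0 QN]]; apply: contrapT => nx.
have sub : box c `<=` ((box c `&` E1) `|` (box c `&` E2)) `|` N.
  move=> x cx; apply: contrapT => h; apply: nx; exists x; split => //.
  - by move=> E1x; apply: h; left; left.
  - by move=> E2x; apply: h; left; right.
  - by apply: contrapT => nQ; apply: h; right; apply: QN.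
have mI1 : measurable (box c `&` E1) by exact: measurableI.
have mI2 : measurable (box c `&` E2) by exact: measurableI.
have mU : measurable ((box c `&` E1) `|` (box c `&` E2)) by exact: measurableU.
have h1 : (mu (box c) <= mu (((box c `&` E1) `|` (box c `&` E2)) `|` N))%E.
  by apply: le_measure; rewrite ?inE//; exact: measurableU.
have h2 : (mu (((box c `&` E1) `|` (box c `&` E2)) `|` N) <=
    mu ((box c `&` E1) `|` (box c `&` E2)) + mu N)%E by exact: measureU2.
have h3 : (mu ((box c `&` E1) `|` (box c `&` E2)) <=
    mu (box c `&` E1) + mu (box c `&` E2))%E by exact: measureU2.
have := le_trans h1 h2; rewrite N0 adde0 => /le_trans/(_ h3)/le_trans/(_ (leeD e1 e2)).
rewrite mu_box; last exact: ltW.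
rewrite -!EFinM -EFinD lee_fin -mulrDl.
have := exprn_gt0 n c0; move: (_ ^+ n) => v v0.
by rewrite leNgt gtr_pMl// ab.
Qed.

(** * Local integrability of [T f] for bounded [f] *)

Section john_stromberg.
Context {R : realType} {n : nat}.
Local Notation Rn := 'rV[R]_n.
Local Notation mu := (lebesgue_rV (R := R) n).
Implicit Types (c : Rn * R) (x y : Rn) (f g : Rn -> R).
Hypothesis n_gt0 : (0 < n)%N.
Variables (T : (Rn -> R) -> Rn -> R) (K : Rn -> Rn -> R) (omega : R -> R).
Hypothesis omega_dini : dini_modulus omega.
Hypothesis K_smooth : smooth_kernel omega K.
Hypothesis T_repr : represented_by T K.
Hypothesis T_lin : linear_on_L1 T.
Hypothesis T_meas : forall f, L1 f -> measurable_fun setT (T f).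
Variable A : R.
Hypothesis A_gt0 : 0 < A.
Hypothesis T_weak : forall f, L1 f -> forall l : R, 0 < l ->
  (l%:E * mu [set x | (l < `|T f x|)%R] <= A%:E * \int[mu]_x `|f x|%:E)%E.

Definition star_ratio : R := (1 + 2 * halo_ratio (R := R) (n := n)) ^+ n.

Lemma star_ratio_gt0 : 0 < star_ratio.
Proof. by rewrite exprn_gt0// addr_gt0// mulr_gt0// (lt_le_trans _ (halo_ratio_ge1 n_gt0)). Qed.

Lemma mu_star c : 0 < c.2 -> mu (box (star c)) = (star_ratio * c.2 ^+ n)%:E.
Proof.
move=> c0; rewrite mu_box; last exact/ltW/star_gt0.
by rewrite /star /halo /dil /= expr0 mulr1 exprMn.
Qed.

Lemma T_add f g h a : L1 g -> L1 h -> (forall y, f y = a * g y + h y) ->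
  {ae mu, forall x, T f x = a * T g x + T h x}.
Proof.
move=> gL hL fE; have -> : f = fun y => a * g y + h y by exact/funext.
exact: T_lin.
Qed.

Lemma tail_bounded c f : 0 < c.2 -> L1 f -> (forall y, `|f y| <= 1) ->
  (\int[mu]_y (tail omega c y * `|f y|%:E) <= (tail_const (n := n) omega)%:E)%E.
Proof.
move=> c0 fL f1; rewrite -[tail_const _]mulr1; apply: tail_integral => //.
  by apply: measurableT_comp => //; exact: L1_measurable.
move=> k; rewrite mul1e.
apply: (@le_trans _ _ (\int[mu]_(y in box (halo c k.+1)) cst 1%E y)%E); last first.
  by rewrite integral_cst// mul1e.
apply: ge0_le_integral => //.
- by apply/measurable_EFinP; apply: measurableT_comp => //; apply: measurable_funTS; exact: L1_measurable.
- by move=> y _; rewrite lee_fin.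
Qed.

(** The solution of A [star_ratio] / B = [small_level] / 2: large values of [T] get half of the
    allowed exceptional measure, bad halos will get the other half. *)
Definition weak_const : R := 2 * A * star_ratio / small_level (R := R) (n := n).

Lemma weak_const_gt0 : 0 < weak_const.
Proof. by rewrite divr_gt0 ?small_level_gt0// !mulr_gt0 ?star_ratio_gt0. Qed.

Lemma weak_star c f (O : R) : 0 < c.2 -> L1 f -> 0 <= O ->
  (\int[mu]_x `|f x|%:E <= O%:E * mu (box (star c)))%E ->
  (mu [set x | (weak_const * O < `|T f x|)%R] <=
     (small_level (R := R) (n := n) / 2)%:E * mu (box c))%E.
Proof.
move=> c0 fL O0; rewrite mu_star// -EFinM => fO.
have v0 : 0 <= star_ratio * c.2 ^+ n.
  by apply: mulr_ge0; [exact: ltW star_ratio_gt0|by rewrite exprn_ge0// ltW].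
have /le_trans := weak_small T_meas A_gt0 T_weak fL weak_const_gt0 O0 v0 fO; apply.
rewrite mu_box ?(ltW c0)// -EFinM lee_fin /weak_const.
have := small_level_gt0 (R := R) (n := n); have := star_ratio_gt0.
move: (small_level (R := R) (n := n)) star_ratio => e k k0 e0.
by rewrite le_eqVlt; apply/orP; left; apply/eqP; field; rewrite !gt_eqF.
Qed.

(** A weak type bound does not give integrability on a cube. The stopping argument is therefore run
    with constant costs: on each node the near part is controlled off [E s] and the far part stays
    close to the constant [b s], so |T f - b [::]| is at most a constant times the number of
    selected cubes around the point. *)
Lemma bounded_T_integrable c f : 0 < c.2 -> L1 f -> compact (supp f) ->
  (forall y, `|f y| <= 1) -> mu.-integrable (box c) (EFin \o T f).
Proof.
move=> c0 fL fs f1.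
pose near_ s y := f y * \1_(box (star (node c s))) y.
pose far_ s y := f y * \1_(~` box (star (node c s))) y.
have nearL s : L1 (near_ s) by exact: L1_restrict.
have farL s : L1 (far_ s) by apply: L1_restrict => //; exact: measurableC.
have near_small s : (\int[mu]_x `|near_ s x|%:E <= 1%:E * mu (box (star (node c s))))%E.
  rewrite mul1e.
  apply: (@le_trans _ _ (\int[mu]_x (\1_(box (star (node c s))) x)%:E)%E); last first.
    by rewrite integral_indic// setIT.
  apply: ge0_le_integral => //.
  - by apply/measurable_EFinP; apply: measurableT_comp => //; exact: L1_measurable.
  - by apply/measurable_EFinP; exact: measurable_indic.
  - move=> x _; rewrite lee_fin /near_ indicE; case: (_ \in _) => /=.
      by rewrite mulr1.
    by rewrite mulr0 normr0.
pose E s := [set x | weak_const * 1 < `|T (near_ s) x|].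
have mE s : measurable (E s) by exact: measurable_weak.
have E_small s : (mu (box (node c s) `&` E s) <=
    (small_level (R := R) (n := n))%:E * mu (box (node c s)))%E.
  have s0 := node_gt0 s c0.
  apply: (@le_trans _ _ (mu (E s))).
    by apply: le_measure; rewrite ?inE//; exact: measurableI.
  apply: le_trans (weak_star s0 (nearL s) ler01 (near_small s)) _.
  rewrite lee_wpmul2r// lee_fin.
  have := small_level_gt0 (R := R) (n := n); move: (small_level (R := R) (n := n)) => e; lra.
pose b s := T (far_ s) (node c s).1.
pose w := weak_const + tail_const (n := n) omega.
have far_osc s x : box (node c s) x -> `|T (far_ s) x - b s| <= tail_const (n := n) omega.
  move=> sx; have s0 := node_gt0 s c0.
  rewrite -lee_fin; apply: le_trans (tail_bounded s0 (farL s) _).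
    apply: (T_osc n_gt0 omega_dini K_smooth T_repr) => //.
    - exact: compact_supp_mul.
    - by move=> y sy; rewrite /far_ indicE memNset ?mulr0//=; apply.
    - exact: box_corner.
  by move=> y; rewrite normrM -[leRHS]mulr1 ler_pM// indic_le1.
have split s : {ae mu, forall x, T f x = 1 * T (near_ s) x + T (far_ s) x}.
  apply: T_add => // y; rewrite mul1r /near_ /far_ !indicE in_setC.
  by case: (y \in _); rewrite /= !(mulr0,mulr1,addr0,add0r).
have H1 s : {ae mu, forall x, box (node c s) x -> ~ E s x -> `|T f x - b s| <= w}.
  apply: filterS (split s) => x Tx sx nE.
  have h1 : `|T (near_ s) x| <= weak_const.
    by rewrite leNgt; apply/negP => h; apply: nE; rewrite /E /= mulr1.
  rewrite Tx mul1r -addrA; apply: le_trans (ler_normD _ _) _.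
  by rewrite lerD// far_osc.
have [F [_ [_ _ _ iF dom]]] := stopping_time c0 mE E_small.
(* At a common good point [T f] is within [w] of both [b s] and [b (s ++ t)], so these differ by at
   most 2 w. *)
have {}dom := dom (fun s x => `|T f x - b s|) (fun=> 2 * w).
have w0 : 0 <= w.
  rewrite addr_ge0 ?(ltW weak_const_gt0)// mulr_ge0 ?exprn_ge0//.
  exact: dini_sum_ge0.
have {}dom : {ae mu, forall x, box c x -> exists m,
    `|T f x - b [::]| <= \sum_(k < m | F (addr c x k)) 2 * w}.
  apply: dom.
    move=> s; apply: filterS (H1 s) => x h sx nE; apply: le_trans (h sx nE) _; lra.
  move=> s t st; apply: aeW => x tx.
  have t0 := node_gt0 (s ++ t) c0.
  have sub : box (node c (s ++ t)) `<=` box (node c s).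
    by rewrite node_cat; apply: node_sub; exact: node_gt0.
  have [|z [tz nEs nEt [h1 h2]]] := good_point t0 (mE s) (mE (s ++ t)) _ st
    (E_small (s ++ t)) (filterI (H1 s) (H1 (s ++ t))).
    have := small_level_le (R := R) (n := n); have := stop_level_le (R := R) (n := n).
    by move=> *; lra.
  have {}h1 := h1 (sub _ tz) nEs; have {}h2 := h2 tz nEt.
  have : `|b (s ++ t) - b s| <= 2 * w.
    rewrite (_ : _ - _ = (T f z - b s) - (T f z - b (s ++ t))); last by ring.
    by apply: le_trans (ler_normB _ _) _; lra.
  rewrite (_ : T f x - b s = (T f x - b (s ++ t)) + (b (s ++ t) - b s)); last by ring.
  move=> h; apply: le_trans (ler_normD _ _) _; lra.
pose N (x : Rn) : \bar R := (\sum_(k <oo) (F (addr c x k))%:R%:E)%E.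
have N0 x : (0 <= N x)%E by apply: nneseries_ge0 => k _ _; rewrite lee_fin.
apply/integrableP; split.
  by apply/measurable_EFinP; apply: measurable_funTS; exact: T_meas.
have iG : mu.-integrable (box c) (fun x => (`|b [::]|)%:E + (2 * w)%:E * N x)%E.
  apply: integrableD => //; last exact: integrableZl.
  apply: (@box_integrable_bounded _ _ _ (cst `|b [::]|) `|b [::]|) => //.
    exact: ltW.
  by move=> x _; rewrite /= normr_id.
apply: le_lt_trans (integrable_lty (measurable_box c) iG).
apply: ae_ge0_le_integral => //.
- apply/measurable_EFinP; apply: measurableT_comp => //.
  by apply: measurable_funTS; exact: T_meas.
- by move=> x _; rewrite adde_ge0 ?lee_fin// mule_ge0// lee_fin mulr_ge0.
- exact: measurable_int iG.
apply: filterS dom => x h cx; have [m hm] := h cx.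
apply: (@le_trans _ _ (`|b [::]| + 2 * w * \sum_(k < m) (F (addr c x k))%:R)%:E).
  rewrite lee_fin -[T f x](subrK (b [::])) addrC; apply: le_trans (ler_normD _ _) _.
  rewrite lerD2l; apply: le_trans hm _; rewrite mulr_sumr big_mkcond/=.
  by apply: ler_sum => k _; case: (F _); rewrite ?mulr1 ?mulr0.
rewrite EFinD EFinM leeD2l// lee_wpmul2l ?lee_fin ?mulr_ge0//.
rewrite -sumEFin -(big_mkord xpredT (fun k => (F (addr c x k))%:R%:E)).
by apply: nneseries_lim_ge => k _ _; rewrite lee_fin.
Qed.

End john_stromberg.

(** * Smooth functions *)

Section smooth_real_line.
Context {R : realType}.
Implicit Types (f g : R -> R) (p : {poly R}).

(* [k] times differentiable; the last derivative need not be continuous. *)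
Fixpoint Ck k f : Prop :=
  if k is k'.+1 then (forall x, derivable f x 1) /\ Ck k' (derive1 f) else True.

Lemma Ck_le k f : Ck k.+1 f -> Ck k f.
Proof. by elim: k f => [//|k IH] f [df /IH]. Qed.

Lemma Ck_add k f g : Ck k f -> Ck k g -> Ck k (f \+ g).
Proof.
elim: k f g => [//|k IH] f g [df cf] [dg cg]; split.
  by move=> x; exact: derivableD.
rewrite (_ : derive1 (f \+ g) = derive1 f \+ derive1 g); first exact: IH.
by apply/funext => x; rewrite /= !derive1E deriveD.
Qed.

Lemma Ck_mul k f g : Ck k f -> Ck k g -> Ck k (f \* g).
Proof.
elim: k f g => [//|k IH] f g [df cf] [dg cg]; split.
  by move=> x; exact: derivableM.
rewrite (_ : derive1 (f \* g) = (f \* derive1 g) \+ (g \* derive1 f)).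
  by apply: Ck_add; apply: IH => //; exact: Ck_le.
by apply/funext => x; rewrite /= !derive1E deriveM.
Qed.

Lemma Ck_comp k f g : Ck k f -> Ck k g -> Ck k (f \o g).
Proof.
elim: k f g => [//|k IH] f g [df cf] [dg cg]; split.
  move=> x; apply/derivable1_diffP; apply: differentiable_comp.
    exact/derivable1_diffP.
  exact/derivable1_diffP.
rewrite (_ : derive1 (f \o g) = (derive1 f \o g) \* derive1 g).
  by apply: Ck_mul => //; apply: IH => //; exact: Ck_le.
by apply/funext => x; rewrite derive1_comp.
Qed.

Lemma Ck_cst k (a : R) : Ck k (cst a).
Proof.
elim: k a => [//|k IH] a; split; first by move=> x; exact: derivable_cst.
rewrite (_ : derive1 _ = (cst 0 : R -> R)); first exact: IH.
by apply/funext => x; rewrite derive1_cst.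
Qed.

Lemma Ck_id k : Ck k (@id R).
Proof.
case: k => [//|k]; split; first by move=> x; exact: derivable_id.
rewrite (_ : derive1 _ = (cst 1 : R -> R)); first exact: Ck_cst.
by apply/funext => x; rewrite derive1_id.
Qed.

Lemma Ck_affine k (a b : R) : Ck k (fun t => a * t + b).
Proof.
apply: (Ck_add (g := cst b)); last exact: Ck_cst.
apply: (Ck_mul (f := cst a)); [exact: Ck_cst|exact: Ck_id].
Qed.

Lemma Ck_continuous k f : Ck k.+1 f -> continuous f.
Proof. by move=> [df _] x; apply: differentiable_continuous; exact/derivable1_diffP. Qed.

(* The derivatives of [exp (- 1 / t)] extended by [0] to [t <= 0] are all of this form, see
   [is_derive_flat]. *)
Definition flat p (t : R) : R := if 0 < t then p.[t^-1] * expR (- t^-1) else 0.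

(** The k-th power of s/k <= exp(s/k). *)
Lemma exprn_le_expR (k : nat) (s : R) : 0 <= s -> s ^+ k <= (k ^ k)%:R * expR s.
Proof.
move=> s0; case: k => [|k]; first by rewrite expr0 mul1r -expR0 ler_expR.
have := @expR_ge1Dx R (s / k.+1%:R).
move=> h; have {}h : s / k.+1%:R <= expR (s / k.+1%:R) by apply: le_trans h; rewrite lerDr.
have : (s / k.+1%:R) ^+ k.+1 <= expR (s / k.+1%:R) ^+ k.+1.
  by rewrite lerXn2r ?nnegrE ?expR_ge0// divr_ge0.
rewrite -expRM_natl mulrCA divff ?pnatr_eq0// mulr1 expr_div_n ler_pdivrMr ?exprn_gt0//.
by rewrite natrX mulrC.
Qed.

Lemma poly_le_expR p : exists C, 0 <= C /\ forall s, 0 <= s -> `|p.[s]| <= C * expR s.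
Proof.
exists (\sum_(i < size p) `|p`_i| * (i ^ i)%:R); split.
  by apply: sumr_ge0 => i _; rewrite mulr_ge0.
move=> s s0; rewrite horner_coef mulr_suml; apply: le_trans (ler_norm_sum _ _ _) _.
apply: ler_sum => i _; rewrite normrM -mulrA ler_wpM2l// ger0_norm ?exprn_ge0//.
exact: exprn_le_expR.
Qed.

(** With s = 1/t, the derivative of p(s) exp(-s) in t is s^2 (p - p')(s) exp(-s): the family is
    closed under differentiation, and smoothness becomes an induction over all polynomials at
    once. *)
Lemma is_derive_flat p (t : R) :
  is_derive t (1 : R) (flat p) (flat ('X ^+ 2 * (p - p^`())) t).
Proof.
have [t0|t0|<-] := ltgtP 0 t.
- have tn0 : t != 0 by rewrite gt_eqF.
  have dinv : is_derive t (1 : R) (fun s : R => s^-1) (- t ^- 2).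
    have := is_deriveV (f := id) tn0 (is_derive_id t (1 : R)).
    by rewrite /GRing.scale /= mulr1.
  have dp := is_derive1_comp (is_derive_poly p t^-1) dinv.
  have de := @is_derive1_comp R expR (fun s => - s^-1) t _ _ (is_derive_expR (- t^-1)) (is_deriveN dinv).
  apply: (near_eq_is_derive (f := (horner p \o (fun s : R => s^-1)) \*
      (expR \o (fun s : R => - s^-1)))).
    near=> s; rewrite /flat ifT//=.
    by near: s; exact: lt_nbhsr.
  have dM := is_deriveM dp de.
  apply: (is_derive_eq dM).
  rewrite /GRing.scale /= /flat t0 hornerM hornerXn hornerD hornerN exprVn.
  move: (p.[_]) (p^`().[_]) (expR _) => a b e; ring.
- have -> : flat ('X ^+ 2 * (p - p^`())) t = 0 by rewrite /flat ltNge (ltW t0).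
  apply: (near_eq_is_derive (f := cst (0 : R))).
  near=> s; rewrite /flat ifF//=; apply/negbTE; rewrite -leNgt ltW//.
  by near: s; exact: lt_nbhsl.
- have -> : flat ('X ^+ 2 * (p - p^`())) 0 = 0 by rewrite /flat ltxx.
  (* Bounding X^2 p instead of p gains h^2, so the difference quotient at 0 is at most C h. *)
  have [C [C0 HC]] := poly_le_expR ('X ^+ 2 * p).
  have cv : (fun h : R => h^-1 *: ((flat p \o shift 0) (h *: (1:R)) - flat p 0)) @ 0^' --> (0 : R).
    apply/cvgrPdist_le => eps eps0; near=> h.
    rewrite sub0r normrN /= addr0 [flat p 0]/flat ltxx subr0.
    rewrite /GRing.scale /= mulr1 /flat; case: ifPn => h0; last by rewrite mulr0 normr0 ltW.
    apply: (@le_trans _ _ (C * h)).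
      have hi : 0 <= h^-1 by rewrite invr_ge0 ltW.
      have := HC _ hi; rewrite !hornerE normrM (ger0_norm (exprn_ge0 2 hi)) => H.
      rewrite !normrM (ger0_norm hi) (ger0_norm (expR_ge0 _)) expRN.
      rewrite ler_pdivrMr ?expR_gt0//.
      move: (expR _) H => e H.
      have -> : C * h * e = h * (C * e) by ring.
      rewrite -ler_pdivrMl//; apply: le_trans H.
      by rewrite exprVn expr2 invfM mulrA.
    have hs : `|h| <= eps / (C + 1).
      by near: h; apply: dnbhs0_le; rewrite divr_gt0// ltr_wpDl.
    move: hs; rewrite ger0_norm ?(ltW h0)// ler_pdivlMr ?ltr_wpDl// => hs.
    by apply: le_trans hs; have := ltW h0; nra.
  apply: DeriveDef; first by apply/cvg_ex; exists 0.
  exact: cvg_lim cv.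
Unshelve. all: by end_near.
Qed.

Lemma Ck_flat k p : Ck k (flat p).
Proof.
elim: k p => [//|k IH] p; split.
  by move=> t; have [] := is_derive_flat p t.
rewrite (_ : derive1 (flat p) = flat ('X ^+ 2 * (p - p^`()))); first exact: IH.
by apply/funext => t; rewrite derive1E; have [] := is_derive_flat p t.
Qed.

Definition hill (t : R) := flat 1 t.

Lemma hillE t : hill t = if 0 < t then expR (- t^-1) else 0.
Proof. by rewrite /hill /flat hornerC mul1r. Qed.

Lemma hill_ge0 t : 0 <= hill t.
Proof. by rewrite hillE; case: ifP => // _; exact: expR_ge0. Qed.

Lemma hill_gt0 t : (0 < hill t) = (0 < t).
Proof. by rewrite hillE; case: ifP => // _; rewrite ?expR_gt0 ?ltxx. Qed.

Lemma hill_le1 t : hill t <= 1.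
Proof.
rewrite hillE; case: ifP => // t0; rewrite -expR0 ler_expR oppr_le0 invr_ge0.
exact: ltW.
Qed.

Lemma hill_le s t : s <= t -> hill s <= hill t.
Proof.
move=> st; rewrite !hillE; case: ifPn => s0; last by case: ifP => // _; exact: expR_ge0.
have t0 := lt_le_trans s0 st.
by rewrite t0 ler_expR lerN2 lef_pV2.
Qed.

Lemma hill_cvg (u : R^nat) : u @ \oo --> +oo -> (hill \o u) @ \oo --> (1 : R).
Proof.
move=> uy; have u0 : \forall k \near \oo, 0 < u k.
  by have /cvgryPgt := uy; exact.
have cv : (fun k => expR (- (u k)^-1)) @ \oo --> expR (- 0 : R).
  apply: (@continuous_cvg _ _ _ _ _ (fun k => - (u k)^-1) expR (- 0)); first exact: continuous_expR.
  by apply: cvgN; apply/gtr0_cvgV0.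
rewrite -expR0 -oppr0; apply: cvg_trans cv; apply: near_eq_cvg.
by near=> k; rewrite /= hillE ifT//; near: k.
Unshelve. all: by end_near.
Qed.

(** A smooth step obtained by composition alone: the inner function is 1 for t <= 0 and nonpositive
    for t >= 1, where the outer [hill] vanishes. *)
Definition plateau (t : R) : R := hill (- (hill 1)^-1 * hill t + 1) / hill 1.

Lemma plateau_eq1 t : t <= 0 -> plateau t = 1.
Proof.
move=> t0; rewrite /plateau [hill t]hillE ltNge t0/= mulr0 add0r divff//.
by rewrite gt_eqF// hill_gt0.
Qed.

Lemma plateau_eq0 t : 1 <= t -> plateau t = 0.
Proof.
move=> t1; rewrite /plateau [hill (_ + _)]hillE ifF ?mul0r//.
apply/negbTE; rewrite -leNgt mulNr addrC subr_le0 mulrC ler_pdivlMr ?hill_gt0// mul1r.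
exact: hill_le.
Qed.

Lemma plateau_ge0 t : 0 <= plateau t.
Proof. by rewrite /plateau divr_ge0 ?hill_ge0. Qed.

Lemma plateau_le1 t : plateau t <= 1.
Proof.
rewrite /plateau ler_pdivrMr ?hill_gt0// mul1r; apply: hill_le.
by rewrite mulNr addrC gerBl mulr_ge0 ?invr_ge0 ?hill_ge0.
Qed.

Lemma Ck_hill_affine k (a b : R) : Ck k (fun t => hill (a * t + b)).
Proof. by apply: (Ck_comp (f := hill)); [exact: Ck_flat|exact: Ck_affine]. Qed.

Lemma Ck_plateau_affine k (a b : R) : Ck k (fun t => plateau (a * t + b)).
Proof.
apply: (Ck_comp (f := plateau)); last exact: Ck_affine.
apply: (Ck_mul (g := cst (hill 1)^-1)); last exact: Ck_cst.
apply: (Ck_comp (f := hill)); first exact: Ck_flat.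
apply: (Ck_add (g := cst 1)); last exact: Ck_cst.
by apply: (Ck_mul (f := cst _)); [exact: Ck_cst|exact: Ck_flat].
Qed.

End smooth_real_line.

(** * Smooth cut-offs and approximate indicators of cubes *)

Section tensor.
Context {R : realType} {n : nat}.
Local Notation Rn := 'rV[R]_n.
Local Notation mu := (lebesgue_rV (R := R) n).
Implicit Types (c : Rn * R) (x y : Rn) (g : 'I_n -> R -> R).

(** A partial derivative of a product of functions of one coordinate is again such a product, which
    reduces [smooth] to the real line. *)
Definition tensor g x := \prod_i g i (x ord0 i).

Definition tensor_partial (i : 'I_n) g j := if j == i then derive1 (g j) else g j.

Definition smooth_factors g := forall i k, Ck k (g i).

Lemma smooth_factors_partial i g : smooth_factors g ->
  smooth_factors (tensor_partial i g).
Proof.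
move=> sg j k; rewrite /tensor_partial; case: ifP => // _.
by have [] := sg j k.+1.
Qed.

Lemma is_derive_tensor g x (i : 'I_n) : smooth_factors g ->
  is_derive x (delta_mx ord0 i) (tensor g) (tensor (tensor_partial i g) x).
Proof.
move=> sg; pose P := \prod_(j | j != i) g j (x ord0 j).
have dg : derivable (g i) (x ord0 i) 1 by have [] := sg i 1%N.
have E h : h^-1 *: ((tensor g \o shift x) (h *: delta_mx ord0 i) - tensor g x) =
    P * (h^-1 *: ((g i \o shift (x ord0 i)) (h *: (1 : R)) - g i (x ord0 i))).
  rewrite /tensor /= (bigD1 i)//= [X in _ - X](bigD1 i)//= !mxE !eqxx/=.
  rewrite (eq_bigr (fun j => g j (x ord0 j))); last first.
    by move=> j /negbTE ji; rewrite !mxE eqxx ji mulr0 add0r.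
  rewrite -/P /GRing.scale /= mulr1.
  move: (h^-1) (g i _) (g i _) => a b d.
  by ring.
have cv : (fun h => h^-1 *: ((tensor g \o shift x) (h *: delta_mx ord0 i) - tensor g x)) @ 0^' -->
    P * derive1 (g i) (x ord0 i).
  under eq_fun do rewrite E.
  by apply: cvgMr; rewrite derive1E; exact: dg.
have vE : tensor (tensor_partial i g) x = P * derive1 (g i) (x ord0 i).
  rewrite /tensor (bigD1 i)//= /tensor_partial eqxx mulrC; congr (_ * _).
  by apply: eq_bigr => j /negbTE ->.
apply: DeriveDef; first by apply/cvg_ex; eexists; exact: cv.
by rewrite vE; exact: cvg_lim cv.
Qed.

Lemma iter_partial_tensor g s : smooth_factors g ->
  iter_partial s (tensor g) = tensor (foldr tensor_partial g s) /\
  smooth_factors (foldr tensor_partial g s).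
Proof.
move=> sg; elim: s => [//|i s [IH sIH]]; split; last exact: smooth_factors_partial.
have -> : iter_partial (i :: s) (tensor g) = 'D_(delta_mx ord0 i) (iter_partial s (tensor g)) by [].
by rewrite IH; apply/funext => x; have [] := is_derive_tensor x i sIH.
Qed.

Lemma continuous_tensor g : smooth_factors g -> continuous (tensor g).
Proof.
move=> sg x; rewrite /tensor; apply: cvg_big.
- by move=> [a b]; exact: mul_continuous.
- exact: (nbhs_filter x).
move=> i _.
have cc : {for x, continuous (fun y : Rn => y ord0 i)} by exact: coord_continuous.
have h : {for (x ord0 i : R), continuous (g i)} by move: (x ord0 i : R); exact: (Ck_continuous (sg i 1%N)).
exact: (@continuous_comp _ _ _ (fun y : Rn => y ord0 i) (g i) x cc h).
Qed.

Lemma smooth_tensor g : smooth_factors g -> smooth (tensor g).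
Proof.
move=> sg s; have [-> sg'] := iter_partial_tensor s sg; split.
  exact: continuous_tensor.
by move=> x i; have [] := is_derive_tensor x i sg'.
Qed.

Lemma is_derive_lin (f1 f2 : Rn -> R) (a b : R) x (v : Rn) :
  derivable f1 x v -> derivable f2 x v ->
  is_derive x v (fun x => a * f1 x + b * f2 x) (a * 'D_v f1 x + b * 'D_v f2 x).
Proof.
move=> d1 d2; have da : derivable (a \*: f1) x v by exact: derivableZ.
have db : derivable (b \*: f2) x v by exact: derivableZ.
apply: DeriveDef; first exact: (derivableD da db).
have -> : 'D_v (fun x => a * f1 x + b * f2 x) x = 'D_v ((a \*: f1) + (b \*: f2)) x by [].
by rewrite deriveD// deriveZ// deriveZ.
Qed.

Lemma smooth_lin (f1 f2 : Rn -> R) (a b : R) : smooth f1 -> smooth f2 ->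
  smooth (fun x => a * f1 x + b * f2 x).
Proof.
move=> s1 s2; have E s : iter_partial s (fun x => a * f1 x + b * f2 x) =
    (fun x => a * iter_partial s f1 x + b * iter_partial s f2 x).
  elim: s => [//|i s IH].
  have -> : iter_partial (i :: s) (fun x => a * f1 x + b * f2 x) =
    'D_(delta_mx ord0 i) (iter_partial s (fun x => a * f1 x + b * f2 x)) by [].
  rewrite IH; apply/funext => x; have [_ /(_ x i) d1] := s1 s; have [_ /(_ x i) d2] := s2 s.
  by have [] := is_derive_lin a b d1 d2.
move=> s; rewrite E; have [c1 d1] := s1 s; have [c2 d2] := s2 s; split.
  move=> x; apply: (@continuousD _ _ _ (fun x => a * iter_partial s f1 x)
    (fun x => b * iter_partial s f2 x)).
    apply: (@continuousM _ _ (cst a) (iter_partial s f1)); [exact: cst_continuous|exact: c1].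
  apply: (@continuousM _ _ (cst b) (iter_partial s f2)); [exact: cst_continuous|exact: c2].
by move=> x i; have [] := is_derive_lin a b (d1 x i) (d2 x i).
Qed.

Lemma smooth_continuous (f : Rn -> R) : smooth f -> continuous f.
Proof. by move=> /(_ [::])[]. Qed.

Lemma prod01 (F : 'I_n -> R) : (forall i, 0 <= F i <= 1) -> 0 <= \prod_i F i <= 1.
Proof.
move=> F01; apply/andP; split; first by apply: prodr_ge0 => i _; case/andP: (F01 i).
by apply: prodr_ile1 => i _; exact: F01.
Qed.

Lemma cutoff c : 0 < c.2 -> exists chi : Rn -> R,
  [/\ test_function chi, forall x, 0 <= chi x <= 1, L1 chi &
    forall x, (forall i, c.1 ord0 i <= x ord0 i <= c.1 ord0 i + c.2) ->
      nbhs x [set y | chi y = 1]].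
Proof.
move=> c0.
(* Each factor is 1 up to distance 1 from the interval, so that the unit ball around any point of
   the closed cube lies in the set where the product is 1, and it is 0 from distance 2 on. *)
pose g i t := plateau (-1 * t + (c.1 ord0 i - 1)) * plateau (1 * t + (- (c.1 ord0 i + c.2 + 1))).
have sg : smooth_factors g.
  move=> i k; apply: (Ck_mul (f := fun t => plateau (-1 * t + (c.1 ord0 i - 1)))
    (g := fun t => plateau (1 * t + (- (c.1 ord0 i + c.2 + 1)))));
  exact: Ck_plateau_affine.
have g01 x : 0 <= tensor g x <= 1.
  apply: prod01 => i; rewrite mulr_ge0 ?plateau_ge0//=.
  by rewrite mulr_ile1 ?plateau_ge0 ?plateau_le1.
have g0 x i : g i (x ord0 i) = 0 -> tensor g x = 0.
  by move=> gi; rewrite /tensor (bigD1 i)//= gi mul0r.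
pose d : Rn * R := (\row_i (c.1 ord0 i - 2), c.2 + 5).
have gd x : ~ box d x -> tensor g x = 0.
  move=> /existsNP[i /negP]; rewrite !mxE /= negb_and -ltNge -leNgt => h.
  apply: (g0 x i); rewrite /g; case/orP: h => h.
    by rewrite plateau_eq0 ?mul0r//; lra.
  by rewrite [X in _ * X]plateau_eq0 ?mulr0//; lra.
have ct := continuous_tensor sg.
exists (tensor g); split => //.
- by split; [exact: smooth_tensor|exact: compact_supp_box gd].
- rewrite /L1 (_ : EFin \o tensor g = (EFin \o tensor g) \_ (box d)).
    apply: (integrable_mkcond _ (measurable_box d)).1.
    apply: (@box_integrable_bounded _ _ _ _ 1).
    + by rewrite /= addr_ge0// ltW.
    + by apply: measurable_funTS; exact: measurable_continuous.
    + by move=> x _; have /andP[h1 h2] := g01 x; rewrite ger0_norm.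
  apply/funext => x; rewrite /patch; case: ifPn => //=.
  by rewrite notin_setE => /gd ->.
- move=> x cx.
  have : nbhs x (ball x 1) by exact: nbhsx_ballx.
  apply: filterS => y [_ xy] /=; rewrite /tensor big1// => i _.
  have := xy ord0 i; rewrite /ball /= ltr_norml => /andP[h1 h2].
  have /andP[h3 h4] := cx i.
  by rewrite /g !plateau_eq1 ?mulr1//; lra.
Qed.

(* The limit is [1] on the lower faces too: there the first factor of [g k i] below is
   [hill (m k)], and [m k] tends to infinity. *)
Lemma indicator_approx c (L : R) : 0 < L -> exists b : nat -> Rn -> R,
  [/\ forall k, smooth (b k), forall k x, 0 <= b k x <= 1,
   forall k x, b k x != 0 -> forall i, c.1 ord0 i - L < x ord0 i < c.1 ord0 i + c.2 &
   forall x, b ^~ x @ \oo --> (\1_(box c) x : R)].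
Proof.
(* The first factor below vanishes at distance 1 / [m k] under the lower face; dividing by [L] keeps
   that distance at most [L]. *)
move=> L0; pose m (k : nat) : R := k.+1%:R / L.
have m0 k : 0 < m k by rewrite divr_gt0.
have mL k : L^-1 <= m k by rewrite /m ler_peMl ?invr_ge0 ?(ltW L0)// ler1n.
pose g k (i : 'I_n) (t : R) := hill (m k ^+ 2 * t + (m k - m k ^+ 2 * c.1 ord0 i)) *
  hill (- m k * t + m k * (c.1 ord0 i + c.2)).
have sg k : smooth_factors (g k).
  move=> i j; apply: (Ck_mul (f := fun t : R => hill (m k ^+ 2 * t + (m k - m k ^+ 2 * c.1 ord0 i)))
    (g := fun t : R => hill (- m k * t + m k * (c.1 ord0 i + c.2))));
  exact: Ck_hill_affine.
exists (fun k => tensor (g k)); split.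
- by move=> k; exact: smooth_tensor.
- move=> k x; apply: prod01 => i; rewrite mulr_ge0 ?hill_ge0//=.
  by rewrite mulr_ile1 ?hill_ge0 ?hill_le1.
- move=> k x kx i.
  have : g k i (x ord0 i) != 0.
    by apply: contraNN kx => /eqP gi; rewrite /tensor (bigD1 i)//= gi mul0r.
  rewrite mulf_eq0 negb_or => /andP[].
  have bn0 (t : R) : hill t != 0 -> 0 < t.
    by move=> t0; rewrite -hill_gt0 lt_def t0 hill_ge0.
  move=> /bn0 h1 /bn0 h2; have := m0 k; have := mL k; move: (m k) h1 h2 => a h1 h2 aL a0.
  have aL1 : 1 <= a * L by rewrite -ler_pdivrMr// mul1r.
  apply/andP; split; last first.
    have : 0 < a * (c.1 ord0 i + c.2 - x ord0 i) by move: h2; lra.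
    by rewrite pmulr_rgt0//; lra.
  have : 0 < a * (a * (x ord0 i - c.1 ord0 i) + 1) by move: h1; lra.
  rewrite pmulr_rgt0// => h3.
  have : 0 < a * (x ord0 i - c.1 ord0 i + L) by lra.
  by rewrite pmulr_rgt0//; lra.
- have my : m @ \oo --> +oo.
    apply/cvgryPge => M; have [k kM] : exists k : nat, M * L <= k%:R.
      exists (Num.bound `|M * L|); apply: le_trans (ler_norm _) _.
      exact/ltW/archi_boundP.
    exists k => // j /= kj; rewrite /m ler_pdivlMr//; apply: le_trans kM _.
    by rewrite ler_nat (leq_trans kj).
  have mMy a : 0 < a -> (fun k => m k * a) @ \oo --> +oo.
    move=> a0; apply/cvgryPge => M; have /cvgryPge/(_ (M / a)) := my.
    by apply: filterS => k; rewrite ler_pdivrMr.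
  move=> x; rewrite indicE; have [cx|ncx] := boolP (x \in box c).
    have {}cx : box c x by exact: set_mem.
    rewrite (_ : true%:R = \prod_(i < n) (1 : R)); last by rewrite big1.
    apply: cvg_big => //; first by move=> [a b]; exact: mul_continuous.
    move=> i _; rewrite -[1]mulr1 /g; have /andP[h1 h2] := cx i.
    apply: cvgM; apply: hill_cvg; last first.
      under eq_fun do rewrite mulNr addrC -mulrBr.
      by apply: mMy; rewrite subr_gt0.
    apply: (ger_cvgy _ my); near=> k.
    have -> : m k ^+ 2 * x ord0 i + (m k - m k ^+ 2 * c.1 ord0 i) =
      m k + m k ^+ 2 * (x ord0 i - c.1 ord0 i) by ring.
    by rewrite lerDl mulr_ge0 ?sqr_ge0// subr_ge0.
  have /existsNP[i /negP] : ~ box c x by move=> cx; rewrite mem_set in ncx.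
  rewrite negb_and -ltNge -leNgt => h.
  have h0 : \forall k \near \oo, tensor (g k) x = (0 : R).
    have [h1|h1] := orP h.
      have /cvgryPge/(_ 1) : (fun k => m k * (c.1 ord0 i - x ord0 i)) @ \oo --> +oo.
        by apply: mMy; rewrite subr_gt0.
      apply: filterS => k mk; rewrite /tensor (bigD1 i)//= /g hillE ifF ?mul0r//.
      apply/negbTE; rewrite -leNgt.
      have -> : m k ^+ 2 * x ord0 i + (m k - m k ^+ 2 * c.1 ord0 i) =
        m k * (1 - m k * (c.1 ord0 i - x ord0 i)) by ring.
      by rewrite pmulr_rle0// subr_le0.
    apply: nearW => k; rewrite /tensor (bigD1 i)//= /g [X in _ * X * _]hillE ifF ?mulr0 ?mul0r//.
    by apply/negbTE; rewrite -leNgt mulNr addrC subr_le0 ler_pM2l.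
  exact: cvg_near_cst h0.
Unshelve. all: by end_near.
Qed.
End tensor.

(** The integral of a nonnegative function is a supremum over simple functions below it, so the
    comparison also covers the outer integrand of the pairing, whose measurability is not
    established. The positive and negative parts both have integral in [0, M], hence [M] and not 2
    M. *)
Lemma Rintegral_bound d (T : measurableType d) (R : realType)
    (mu : {measure set T -> \bar R}) (h : T -> R) (G : T -> \bar R) (M : R) :
  (forall y, (`|h y|%:E <= G y)%E) -> (\int[mu]_y G y <= M%:E)%E ->
  `|\int[mu]_y h y| <= M.
Proof.
move=> hG GM.
have G0 y : (0 <= G y)%E by apply: le_trans (hG y); rewrite lee_fin.
have bound (F : T -> \bar R) : (forall y, 0 <= F y)%E -> (forall y, F y <= G y)%E ->
    (0 <= \int[mu]_y F y <= M%:E)%E.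
  move=> F0 FG; rewrite integral_ge0//= ; apply: le_trans GM.
  rewrite !ge0_integralTE//; apply: le_ereal_sup => _ [k kF <-]; exists k => // y.
  exact: le_trans (kF y) (FG y).
rewrite /Rintegral integralE.
have /andP[p0 pM] : (0 <= \int[mu]_y ((fun y => (h y)%:E)^\+ y) <= M%:E)%E.
  apply: bound => y; first exact: funepos_ge0.
  by rewrite funeposE; apply: le_trans (hG y); rewrite -EFin_max lee_fin ge_max ler_norm normr_ge0.
have /andP[n0 nM] : (0 <= \int[mu]_y ((fun y => (h y)%:E)^\- y) <= M%:E)%E.
  apply: bound => y; first exact: funeneg_ge0.
  by rewrite funenegE; apply: le_trans (hG y); rewrite -EFinN -EFin_max lee_fin ge_max -normrN ler_norm normr_ge0.
have pf := le_fineK p0 pM; have nf := le_fineK n0 nM.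
move: p0 pM n0 nM; rewrite pf nf -EFinB !lee_fin /= => *.
by rewrite ler_norml; apply/andP; split; lra.
Qed.

(** * Averages of T(1) *)

Section dini_kernel.
Context {R : realType} {n : nat}.
Local Notation Rn := 'rV[R]_n.
Local Notation mu := (lebesgue_rV (R := R) n).
Implicit Types (c : Rn * R) (x y : Rn) (f g : Rn -> R).
Hypothesis n_gt0 : (0 < n)%N.
Variables (K : Rn -> Rn -> R) (omega : R -> R).
Hypothesis omega_dini : dini_modulus omega.
Hypothesis K_smooth : smooth_kernel omega K.

Lemma omega_small (e : R) : 0 < e -> exists k, omega (2^-1 ^+ k.+1) < e.
Proof.
move=> e0.
have w0 k : (0 <= (omega (2^-1 ^+ k.+1))%:E)%E.
  by rewrite lee_fin omega_ge0// exprn_ge0// invr_ge0.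
have cv := nneseries_tail_cvg (omega_series omega_dini) (fun k _ => w0 k).
have /cv[N _ HN] : nbhs (0%E : \bar R) [set y | (y < e%:E)%E].
  by apply: open_nbhs_nbhs; split; [exact: open_ereal_lt_ereal|rewrite /= lte_fin].
exists N; rewrite -lte_fin; apply: le_lt_trans (HN N (leqnn N)).
apply: le_trans (@nneseries_lim_ge _ (fun k => (omega (2^-1 ^+ k.+1))%:E) xpredT N N.+1 _).
  by rewrite big_nat1.
by move=> k _ _; exact: w0.
Qed.

Lemma enorm_le_norm (v : Rn) : enorm v <= n%:R * `|v|.
Proof.
have nv : 0 <= n%:R * `|v| by rewrite mulr_ge0.
rewrite /enorm -(ger0_norm nv) -sqrtr_sqr ler_wsqrtr//.
apply: (@le_trans _ _ (\sum_(i < n) `|v| ^+ 2)).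
  apply: ler_sum => i _; rewrite -real_normK ?num_real// lerXn2r ?nnegrE//.
  exact: coord_le_norm.
rewrite sumr_const card_ord exprMn -[leLHS]mulr_natl ler_wpM2r ?sqr_ge0//.
by rewrite -natrX ler_nat expnS expn1 leq_pmulr.
Qed.

Lemma enorm_gt0 (v : Rn) : v != 0 -> 0 < enorm v.
Proof.
move=> v0; rewrite lt_def enorm_ge0 andbT; apply: contraNN v0 => /eqP e0.
apply/eqP/rowP => i; rewrite mxE; apply/eqP; rewrite -normr_le0 -e0; exact: le_enorm.
Qed.

(** The modulus is small at small dyadic points, being the general term of a convergent series.
    Continuity supplies the measurability of the inner integrand of the pairing. *)
Lemma kernel_continuous x y : x != y -> {for x, continuous (K ^~ y)}.
Proof.
move=> xy; have r0 : 0 < enorm (x - y) by rewrite enorm_gt0// subr_eq0.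
set r := enorm (x - y) in r0.
have rn0 : 0 < r ^+ n by rewrite exprn_gt0.
apply/(@cvgrPdist_lt _ _ _ (nbhs x) (nbhs_filter x)) => e e0.
have [k wk] := omega_small (mulr_gt0 e0 rn0).
have h0 : 0 < 2^-1 ^+ k.+1 :> R by rewrite exprn_gt0// invr_gt0.
have d0 : 0 < 2^-1 ^+ k.+1 * r / n.+1%:R by rewrite divr_gt0// mulr_gt0.
near=> x'.
have xx' : `|x - x'| < 2^-1 ^+ k.+1 * r / n.+1%:R.
  near: x'; have := @nbhsx_ballx R Rn x _ d0; apply: filterS => x'.
  by rewrite -ball_normE.
have ex : enorm (x - x') <= 2^-1 ^+ k.+1 * r.
  apply: le_trans (enorm_le_norm _) _.
  apply: (@le_trans _ _ (n.+1%:R * `|x - x'|)); first by rewrite ler_wpM2r// ler_nat.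
  by rewrite mulrC -ler_pdivlMr// ltW.
apply: le_lt_trans (K_smooth xy _) _.
  apply: le_trans ex _; rewrite mulrC ler_wpM2l ?(ltW r0)// exprS.
  by rewrite ler_piMr ?invr_ge0// exprn_ile1 ?invr_ge0// invf_le1// ler1n.
rewrite ltr_pdivrMr//; apply: le_lt_trans wk.
have [_ mono _ _] := omega_dini.
by apply: mono; rewrite ?divr_ge0 ?enorm_ge0// ler_pdivrMr.
Unshelve. all: by end_near.
Qed.

Lemma tail_lty c y : 0 < c.2 -> (tail omega c y < +oo)%E.
Proof.
move=> c0; pose a : R := ((halo_ratio (R := R) (n := n) * c.2) ^+ n)^-1.
have r0 : 0 < halo_ratio (R := R) (n := n) by apply: lt_le_trans (halo_ratio_ge1 n_gt0).
have a0 : 0 < halo_ratio (R := R) (n := n) * c.2 by rewrite mulr_gt0.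
apply: (@le_lt_trans _ _ (\sum_(k <oo) a%:E * (omega (2^-1 ^+ k.+1))%:E)%E).
  apply: lee_nneseries => [k _ _|k _]; first exact: tail_term_ge0.
  have w0 : 0 <= omega (2^-1 ^+ k.+1) by rewrite omega_ge0// exprn_ge0// invr_ge0.
  rewrite -EFinM lee_fin /tail_coef.
  apply: (@le_trans _ _ (omega (2^-1 ^+ k.+1) / (halo_ratio (R := R) (n := n) * 2 ^+ k * c.2) ^+ n)).
    apply: ler_piMr; last by rewrite indicE; case: (_ \in _).
    by rewrite divr_ge0// exprn_ge0// !mulr_ge0 ?(ltW c0) ?(ltW r0).
  rewrite mulrC ler_wpM2r// lef_pV2 ?posrE ?exprn_gt0//; last by rewrite !mulr_gt0.
  rewrite lerXn2r ?nnegrE ?(ltW a0)//; first by rewrite !mulr_ge0 ?(ltW c0) ?(ltW r0).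
  by rewrite ler_wpM2r ?(ltW c0)// ler_peMr ?(ltW r0)// exprn_ege1// ler1n.
rewrite nneseriesZl; last by move=> k _; rewrite lee_fin omega_ge0// exprn_ge0// invr_ge0.
by rewrite (dini_sumE omega_dini) -EFinM ltry.
Qed.

End dini_kernel.

Section T1.
Context {R : realType} {n : nat}.
Local Notation Rn := 'rV[R]_n.
Local Notation mu := (lebesgue_rV (R := R) n).
Implicit Types (c : Rn * R) (x y : Rn) (f g : Rn -> R).
Hypothesis n_gt0 : (0 < n)%N.
Variables (T : (Rn -> R) -> Rn -> R) (K : Rn -> Rn -> R) (omega : R -> R).
Hypothesis omega_dini : dini_modulus omega.
Hypothesis K_smooth : smooth_kernel omega K.
Hypothesis T_repr : represented_by T K.
Hypothesis T_lin : linear_on_L1 T.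
Hypothesis T_meas : forall f, L1 f -> measurable_fun setT (T f).
Variable A : R.
Hypothesis A_gt0 : 0 < A.
Hypothesis T_weak : forall f, L1 f -> forall l : R, 0 < l ->
  (l%:E * mu [set x | (l < `|T f x|)%R] <= A%:E * \int[mu]_x `|f x|%:E)%E.
Hypothesis T1 : T1_eq0 T K.

Let C := tail_const (n := n) omega.

Lemma supp_sub_closed (a b : Rn) f :
  (forall x, f x != 0 -> forall i, a ord0 i <= x ord0 i <= b ord0 i) ->
  forall x, supp f x -> forall i, a ord0 i <= x ord0 i <= b ord0 i.
Proof.
move=> fab x fx i; apply/andP; split; rewrite leNgt; apply/negP => h;
  [pose e := a ord0 i - x ord0 i|pose e := x ord0 i - b ord0 i];
  (have e0 : 0 < e by rewrite subr_gt0);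
  apply: not_supp e0 _ fx => y xy; apply: contrapT => /eqP/fab/(_ i)/andP[h1 h2];
  have := xy i; rewrite ltr_norml => /andP[h3 h4]; rewrite /e in h3 h4; lra.
Qed.

Lemma tail_total c : 0 < c.2 -> (\int[mu]_y tail omega c y <= C%:E)%E.
Proof.
move=> c0; have := @tail_integral R n n_gt0 omega omega_dini c (cst 1) 1 c0.
rewrite mulr1; under eq_integral do rewrite mule1.
apply => //.
move=> k; have h := integral_cst mu (measurable_box (halo c k.+1)) 1%E.
by rewrite -h.
Qed.

Lemma smooth_L1 c f (M : R) : 0 < c.2 -> smooth f -> (forall x, `|f x| <= M) ->
  (forall x, f x != 0 -> box c x) -> L1 f.
Proof.
move=> c0 sf fM fc; rewrite /L1 (_ : EFin \o f = (EFin \o f) \_ (box c)).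
  apply: (integrable_mkcond _ (measurable_box c)).1.
  apply: (@box_integrable_bounded _ _ _ _ M) => //; first exact: ltW.
  by apply: measurable_funTS; apply: measurable_continuous; exact: smooth_continuous.
apply/funext => x; rewrite /patch; case: ifPn => //=.
rewrite notin_setE => nx; have [->//|/fc] := eqVneq (f x) 0; by move=> /nx.
Qed.

(** T(1) = 0 replaces the pairing with [T chi] by the kernel term. There 1 - [chi] vanishes on
    [star c], and since [phi] has integral zero, [K c.1 y] may be subtracted from the kernel, which
    leaves a difference bounded by [tail]. *)
Lemma T1_test c chi phi (M : R) : 0 < c.2 ->
  test_function chi -> (forall x, 0 <= chi x <= 1) ->
  (forall x, (forall i, (star c).1 ord0 i <= x ord0 i <= (star c).1 ord0 i + (star c).2) ->
      nbhs x [set y | chi y = 1]) ->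
  smooth phi -> (forall x, `|phi x| <= M) ->
  (forall x, phi x != 0 -> box c x) -> \int[mu]_x phi x = 0 ->
  `|\int[mu]_x (T chi x * phi x)| <= C * \int[mu]_x `|phi x|.
Proof.
move=> c0 tchi chi01 chi1 sphi phiM phic phi0.
have phiL : L1 phi by exact: smooth_L1 phiM phic.
have phiL' : (\int[mu]_x `|phi x|%:E)%E = (\int[mu]_x `|phi x|)%:E by exact: L1_norm_fin.
have mphi := L1_measurable phiL.
have phi0' x : ~ box c x -> phi x = 0.
  by move=> nx; apply: contrapT => /eqP /phic.
have chi1' y : box (star c) y -> chi y = 1.
  move=> cy; apply: (@nbhs_singleton _ y [set y | chi y = 1]); apply: chi1 => i.
  by have /andP[h1 h2] := cy i; rewrite h1 ltW.
have csc : forall x, (forall i, c.1 ord0 i <= x ord0 i <= c.1 ord0 i + c.2) ->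
   nbhs x [set y | chi y = 1].
  move=> x cx; apply: chi1 => i; have /andP[h1 h2] := cx i.
  rewrite !mxE /=; have := halo_ratio_ge1 (R := R) n_gt0; rewrite expr0 mulr1.
  move: (halo_ratio (R := R) (n := n)) => r r1.
  have : 0 <= r * c.2 by rewrite mulr_ge0 ?(ltW c0)// (le_trans _ r1).
  by move=> rc; apply/andP; split; lra.
have : T1_pairing T K chi phi = 0.
  apply: T1 => //.
  - by split => //; split => //; apply: (compact_supp_box phi0').
  - move=> x /(supp_sub_closed (a := c.1) (b := \row_i (c.1 ord0 i + c.2))) h.
    apply: csc => i; have := h _ i; rewrite mxE; apply => z /phic cz j.
    by rewrite mxE; have /andP[h1 h2] := cz j; rewrite h1 ltW.
rewrite /T1_pairing => /eqP; rewrite addr_eq0 => /eqP ->; rewrite normrN.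
set h := (fun y => _).
apply: (@Rintegral_bound _ _ _ _ _
  (fun y => tail omega c y * (\int[mu]_x `|phi x|)%:E)%E); last first.
  rewrite -phiL'; under eq_integral do rewrite muleC.
  rewrite ge0_integralZl//; last 3 first.
  - exact: measurable_tail.
  - by move=> y _; exact: tail_ge0.
  - exact: integral_ge0.
  rewrite phiL' mulrC EFinM.
  by rewrite lee_wpmul2l ?tail_total// lee_fin Rintegral_ge0.
move=> y; rewrite /h; have [sy|nsy] := pselect (box (star c) y).
  rewrite chi1'// subrr mulr0 normr0 mule_ge0 ?tail_ge0// lee_fin Rintegral_ge0//.
rewrite normrM.
apply: (@le_trans _ _ (`|\int[mu]_x (K x y * phi x)|%:E)).
  rewrite lee_fin ler_piMr// ler_norml; have /andP[h1 h2] := chi01 y.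
  by apply/andP; split; lra.
have cc : box c c.1 by exact: box_corner.
have ncy x : box c x -> x != y.
  by move=> cx; apply/eqP => xy; apply: nsy; rewrite -xy; exact: sub_halo.
pose F x := (K x y - K c.1 y) * phi x.
have tfin := tail_lty n_gt0 omega_dini y c0.
have tfE : tail omega c y = (fine (tail omega c y))%:E.
  by rewrite fineK// ge0_fin_numE// tail_ge0.
have Ftail x : `|F x| <= fine (tail omega c y) * `|phi x|.
  have [cx|ncx] := pselect (box c x); last by rewrite /F phi0'// !mulr0 normr0 mulr0.
  rewrite normrM ler_wpM2r// -lee_fin -tfE.
  exact: (kernel_tail n_gt0 omega_dini K_smooth).
have mF : measurable_fun setT F.
  (* On the diagonal nothing is known of [K], but [y] lies outside [star c], so [phi] vanishes near
     [y]. *)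
  apply: measurable_continuous => x; have [->|xy] := eqVneq x y.
    have r0 : 0 < halo_ratio (R := R) (n := n) * c.2.
      by rewrite mulr_gt0// (lt_le_trans _ (halo_ratio_ge1 n_gt0)).
    have F0 : \forall z \near nbhs y, F z = F y.
      have := @nbhsx_ballx R Rn y _ r0; apply: filterS => z [_ yz].
      have Fz w : ~ box c w -> F w = 0 by move=> cw; rewrite /F phi0' ?mulr0.
      rewrite !Fz//; first by move=> cy; apply: nsy; exact: sub_halo.
      move=> cz; apply: nsy => i; have := yz ord0 i; rewrite /ball /= ltr_norml => /andP[h1 h2].
      have /andP[h3 h4] := cz i; rewrite !mxE /= expr0 mulr1.
      move: (halo_ratio (R := R) (n := n)) h1 h2 => r h1 h2.
      by apply/andP; split; lra.
    exact: (@cvg_near_cst _ _ (F y) F (nbhs y) (nbhs_filter y) F0).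
  apply: (@continuousM _ _ (fun x => K x y - K c.1 y) phi x).
    apply: (@continuousB _ _ _ (K ^~ y) (cst (K c.1 y)) x).
      exact: (kernel_continuous n_gt0 omega_dini K_smooth xy).
    exact: cst_continuous.
  exact: smooth_continuous.
have tf0 : 0 <= fine (tail omega c y) by rewrite fine_ge0// tail_ge0.
have FL : L1 F.
  apply: (le_integrable measurableT _ _ (integrableZl measurableT (fine (tail omega c y)) phiL)).
    exact/measurable_EFinP.
  by move=> x _; rewrite /= lee_fin [leRHS]normrM (ger0_norm tf0).
have -> : \int[mu]_x (K x y * phi x) = \int[mu]_x F x.
  have -> : (fun x => K x y * phi x) = (fun x => F x + K c.1 y * phi x).
    by apply/funext => x; rewrite /F; ring.
  have pL : L1 (fun x => K c.1 y * phi x) by exact: (integrableZl measurableT (K c.1 y) phiL).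
  by rewrite RintegralD// RintegralZl// phi0 mulr0 addr0.
rewrite tfE -EFinM lee_fin; apply: (@Rintegral_bound _ _ _ _ _
  (fun x => ((fine (tail omega c y))%:E * `|phi x|%:E)%E)).
  by move=> x; rewrite -EFinM lee_fin.
rewrite ge0_integralZl//; last first.
  by apply/measurable_EFinP; apply: measurableT_comp.
by rewrite phiL' -EFinM.
Qed.

End T1.

Lemma Rintegral_restrict {R : realType} {n : nat} (c : 'rV[R]_n * R) (h : 'rV[R]_n -> R) :
  (forall x, ~ box c x -> h x = 0) ->
  \int[lebesgue_rV n]_x h x = \int[lebesgue_rV n]_(x in box c) h x.
Proof.
move=> hc; rewrite [RHS]Rintegral_mkcond; apply: eq_Rintegral => x _.
by rewrite /patch; case: ifPn => //; rewrite notin_setE => /hc.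
Qed.

Lemma Rintegral_indicator_approx {R : realType} {n : nat} (c d : 'rV[R]_n * R)
    (b : nat -> 'rV[R]_n -> R) (g : 'rV[R]_n -> R) :
  let mu := lebesgue_rV (R := R) n in
  box d `<=` box c -> mu.-integrable (box c) (EFin \o g) ->
  (forall k, measurable_fun setT (b k)) -> (forall k x, 0 <= b k x <= 1) ->
  (forall x, b ^~ x @ \oo --> (\1_(box d) x : R)) ->
  (fun k => \int[mu]_(x in box c) (g x * b k x)) @ \oo --> \int[mu]_(x in box d) g x.
Proof.
move=> mu dc ig mb b01 cb.
have mg : measurable_fun (box c) g by apply/measurable_EFinP; exact: measurable_int ig.
have [||||| i _ cv] := @dominated_convergence _ _ _ mu (box c) (measurable_box c)
  (fun k x => (g x * b k x)%:E) (fun x => (g x * \1_(box d) x)%:E) (fun x => `|g x|%:E).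
- by move=> k; apply/measurable_EFinP; apply: measurable_funM => //; exact: measurable_funTS.
- by apply/measurable_EFinP; apply: measurable_funM => //; exact: measurable_indic.
- apply: aeW => x _; apply: cvg_EFin; first by apply: nearW.
  by apply: cvgMr; exact: cb.
- exact: (integrable_norm ig).
- apply: aeW => x k _; rewrite lee_fin normrM ler_piMr//.
  by have /andP[h1 h2] := b01 k x; rewrite ger0_norm.
have E : (\int[mu]_(x in box c) (g x * \1_(box d) x)%:E)%E = (\int[mu]_(x in box d) (g x)%:E)%E.
  rewrite -(setIidr dc) [RHS]integral_mkcondr; apply: eq_integral => x _.
  rewrite /patch indicE; case: ifPn => [xd|/negbTE xd].
    by rewrite setIidr ?xd ?mulr1// .
  by rewrite setIidr ?xd ?mulr0.
rewrite E in cv i.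
have fin : (\int[mu]_(x in box d) (g x)%:E)%E \is a fin_num.
  by apply: integrable_fin_num => //; exact: integrableS ig.
by move: cv; rewrite -(fineK fin) => /fine_cvg; exact.
Qed.

Section T1_osc.
Context {R : realType} {n : nat}.
Local Notation Rn := 'rV[R]_n.
Local Notation mu := (lebesgue_rV (R := R) n).
Implicit Types (c d : Rn * R) (x y : Rn) (f g : Rn -> R).
Hypothesis n_gt0 : (0 < n)%N.
Variables (T : (Rn -> R) -> Rn -> R) (K : Rn -> Rn -> R) (omega : R -> R).
Hypothesis omega_dini : dini_modulus omega.
Hypothesis K_smooth : smooth_kernel omega K.
Hypothesis T_repr : represented_by T K.
Hypothesis T_lin : linear_on_L1 T.
Hypothesis T_meas : forall f, L1 f -> measurable_fun setT (T f).
Variable A : R.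
Hypothesis A_gt0 : 0 < A.
Hypothesis T_weak : forall f, L1 f -> forall l : R, 0 < l ->
  (l%:E * mu [set x | (l < `|T f x|)%R] <= A%:E * \int[mu]_x `|f x|%:E)%E.
Hypothesis T1 : T1_eq0 T K.

Let C := tail_const (n := n) omega.

(** The difference of two averages, multiplied by both volumes so that the limit involves no
    quotient. [L] is the room for the smooth approximations, which leave a cube through its lower
    faces only. *)
Lemma T1_averages c d1 d2 (chi : Rn -> R) (L : R) : 0 < c.2 -> 0 < L ->
  0 <= d1.2 -> 0 <= d2.2 ->
  (forall d x, d = d1 \/ d = d2 ->
     (forall i, d.1 ord0 i - L < x ord0 i < d.1 ord0 i + d.2) -> box c x) ->
  box d1 `<=` box c -> box d2 `<=` box c ->
  test_function chi -> (forall x, 0 <= chi x <= 1) -> L1 chi ->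
  (forall x, (forall i, (star c).1 ord0 i <= x ord0 i <= (star c).1 ord0 i + (star c).2) ->
      nbhs x [set y | chi y = 1]) ->
  `|d2.2 ^+ n * \int[mu]_(x in box d1) T chi x -
    d1.2 ^+ n * \int[mu]_(x in box d2) T chi x| <= C * (2 * (d1.2 ^+ n * d2.2 ^+ n)).
Proof.
(* The passage to the limit in the pairing is by dominated convergence, with [T chi] as the
   integrable bound. *)
move=> c0 L0 d10 d20 dc dc1 dc2 tchi chi01 chiL chi1.
have ig : mu.-integrable (box c) (EFin \o T chi).
  apply: (bounded_T_integrable n_gt0 omega_dini K_smooth T_repr T_lin T_meas A_gt0 T_weak) => //.
    by case: tchi.
  by move=> x; have /andP[h1 h2] := chi01 x; rewrite ger0_norm.
have i1 : mu.-integrable (box c) (EFin \o cst (1 : R)).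
  by apply: (@box_integrable_bounded _ _ _ _ 1) => //; [exact: ltW|move=> x _; rewrite normr1].
have mg : measurable_fun (box c) (T chi) by apply: measurable_funTS; exact: T_meas.
have [b1 [s1 b101 b1s cb1]] := indicator_approx d1 L0.
have [b2 [s2 b201 b2s cb2]] := indicator_approx d2 L0.
have mb1 k : measurable_fun setT (b1 k) by apply: measurable_continuous; exact: smooth_continuous.
have mb2 k : measurable_fun setT (b2 k) by apply: measurable_continuous; exact: smooth_continuous.
have cI1 := Rintegral_indicator_approx dc1 ig mb1 b101 cb1.
have cI2 := Rintegral_indicator_approx dc2 ig mb2 b201 cb2.
have cm1 := Rintegral_indicator_approx dc1 i1 mb1 b101 cb1.
have cm2 := Rintegral_indicator_approx dc2 i1 mb2 b201 cb2.
set I1 := (fun k => _) in cI1; set I2 := (fun k => _) in cI2.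
set m1 := (fun k => _) in cm1; set m2 := (fun k => _) in cm2.
have vol d : 0 <= d.2 -> \int[mu]_(x in box d) cst (1 : R) x = d.2 ^+ n.
  by move=> d0; rewrite Rintegral_cst// mul1r; exact: (congr1 fine (mu_box d0)).
rewrite (vol _ d10) in cm1; rewrite (vol _ d20) in cm2.
have lhs : (fun k => `|m2 k * I1 k - m1 k * I2 k|) @ \oo -->
    `|d2.2 ^+ n * \int[mu]_(x in box d1) T chi x - d1.2 ^+ n * \int[mu]_(x in box d2) T chi x|.
  by apply: cvg_norm; apply: cvgB; apply: cvgM.
have rhs : (fun k => C * (2 * (m1 k * m2 k))) @ \oo --> C * (2 * (d1.2 ^+ n * d2.2 ^+ n)).
  by apply: cvgMr; apply: cvgMr; apply: cvgM.
apply: (ler_cvg_to lhs rhs); apply: nearW => k.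
(* The weights are the integrals of the approximations and not the volumes, so that [phi] has
   integral exactly zero for each [k]. *)
pose phi x := m2 k * b1 k x + (- m1 k) * b2 k x.
have ib1 : mu.-integrable (box c) (EFin \o b1 k).
  apply: (@box_integrable_bounded _ _ _ _ 1); [exact: ltW|exact: measurable_funTS|].
  by move=> x _; have /andP[h1 h2] := b101 k x; rewrite ger0_norm.
have ib2 : mu.-integrable (box c) (EFin \o b2 k).
  apply: (@box_integrable_bounded _ _ _ _ 1); [exact: ltW|exact: measurable_funTS|].
  by move=> x _; have /andP[h1 h2] := b201 k x; rewrite ger0_norm.
have m1E : m1 k = \int[mu]_(x in box c) b1 k x.
  by apply: eq_Rintegral => x _; rewrite mul1r.
have m2E : m2 k = \int[mu]_(x in box c) b2 k x.
  by apply: eq_Rintegral => x _; rewrite mul1r.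
have m10 : 0 <= m1 k by rewrite m1E; apply: Rintegral_ge0 => x _; case/andP: (b101 k x).
have m20 : 0 <= m2 k by rewrite m2E; apply: Rintegral_ge0 => x _; case/andP: (b201 k x).
have phic x : ~ box c x -> phi x = 0.
  move=> ncx; have b1x : b1 k x = 0.
    by apply: contrapT => /eqP /b1s h; apply: ncx; apply: (dc d1) => //; left.
  have b2x : b2 k x = 0.
    by apply: contrapT => /eqP /b2s h; apply: ncx; apply: (dc d2) => //; right.
  by rewrite /phi b1x b2x !mulr0 addr0.
have iZ (f : Rn -> R) a : mu.-integrable (box c) (EFin \o f) ->
  mu.-integrable (box c) (EFin \o (fun x => a * f x)).
  by move=> fi; exact: (integrableZl (measurable_box c) a fi).
have phi0 : \int[mu]_x phi x = 0.
  rewrite (Rintegral_restrict phic) /phi RintegralD//; [|exact: iZ|exact: iZ].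
  by rewrite !RintegralZl// -m1E -m2E; ring.
have ib1g : mu.-integrable (box c) (EFin \o (fun x => T chi x * b1 k x)).
  apply: le_integrable ig => //.
    by apply/measurable_EFinP; apply: measurable_funM => //; exact: measurable_funTS.
  move=> x _; rewrite /= lee_fin normrM ler_piMr//.
  by have /andP[h1 h2] := b101 k x; rewrite ger0_norm.
have ib2g : mu.-integrable (box c) (EFin \o (fun x => T chi x * b2 k x)).
  apply: le_integrable ig => //.
    by apply/measurable_EFinP; apply: measurable_funM => //; exact: measurable_funTS.
  move=> x _; rewrite /= lee_fin normrM ler_piMr//.
  by have /andP[h1 h2] := b201 k x; rewrite ger0_norm.
have gphi : \int[mu]_x (T chi x * phi x) = m2 k * I1 k - m1 k * I2 k.
  rewrite (@Rintegral_restrict _ _ c); last by move=> x /phic ->; rewrite mulr0.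
  have -> : (fun x => T chi x * phi x) =
      (fun x => m2 k * (T chi x * b1 k x) + (- m1 k) * (T chi x * b2 k x)).
    by apply/funext => x; rewrite /phi; ring.
  rewrite RintegralD//; [|exact: iZ|exact: iZ].
  by rewrite !RintegralZl// mulNr.
rewrite -gphi; apply: (@le_trans _ _ (C * \int[mu]_x `|phi x|)).
  apply: (@T1_test _ _ n_gt0 _ _ _ omega_dini K_smooth T1 c chi phi (m2 k + m1 k)) => //.
  - exact: smooth_lin.
  - move=> x; apply: le_trans (ler_normD _ _) _; rewrite !normrM normrN.
    rewrite (ger0_norm m10) (ger0_norm m20); have /andP[h1 h2] := b101 k x.
    have /andP[h3 h4] := b201 k x; rewrite !ger0_norm//.
    by rewrite lerD// ler_piMr.
  - by move=> x /eqP px; apply: contrapT => /phic.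
rewrite ler_wpM2l//.
  by rewrite mulr_ge0 ?exprn_ge0// dini_sum_ge0.
rewrite (@Rintegral_restrict _ _ c); last by move=> x /phic ->; rewrite normr0.
apply: (@le_trans _ _ (\int[mu]_(x in box c) (m2 k * b1 k x + m1 k * b2 k x))).
  apply: le_Rintegral => //.
  - have ip : mu.-integrable (box c) (EFin \o phi).
      exact: (integrableD (measurable_box c) (iZ _ (m2 k) ib1) (iZ _ (- m1 k) ib2)).
    exact: (integrable_norm ip).
  - by apply: (integrableD (measurable_box c) (iZ _ _ ib1) (iZ _ _ ib2)).
  - move=> x _; apply: le_trans (ler_normD _ _) _; rewrite !normrM normrN.
    rewrite (ger0_norm m10) (ger0_norm m20); have /andP[h1 h2] := b101 k x.
    by have /andP[h3 h4] := b201 k x; rewrite !ger0_norm.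
rewrite RintegralD//; [|exact: iZ|exact: iZ].
by rewrite !RintegralZl// -m1E -m2E; lra.
Qed.

Lemma node_bounds c s i : 0 < c.2 -> c.1 ord0 i <= (node c s).1 ord0 i /\
  (node c s).1 ord0 i + (node c s).2 <= c.1 ord0 i + c.2.
Proof.
move=> c0; elim/last_ind: s => [//|s e [IH1 IH2]].
have s0 := node_gt0 s c0; rewrite node_rcons !mxE /=.
by case: (e i); rewrite ?mul1r ?mul0r; split; lra.
Qed.

(** The average of [T chi] over any node is within 2 C of that over the cube, so [T chi] itself is,
    almost everywhere; replacing [chi] by the indicator of [star c] costs another C. *)
Lemma T1_osc c : 0 < c.2 -> exists b, {ae mu, forall x, box c x ->
  `|T \1_(box (star c)) x - b| <= 3 * C}.
Proof.
(* The approximations of indicators of nodes spill out of [c] by up to c.2, so [chi] is adapted to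
   this larger cube. *)
move=> c0; pose V := dil 1 c.
have V0 : 0 < V.2 by apply: dil_gt0.
have sV0 : 0 < (star V).2 by exact: star_gt0.
have [chi [tchi chi01 chiL chi1]] := cutoff sV0.
have chi11 y : `|chi y| <= 1 by have /andP[h1 h2] := chi01 y; rewrite ger0_norm.
have cV : box c `<=` box V by apply: sub_dil => //; exact: ltW.
have ig : mu.-integrable (box c) (EFin \o T chi).
  apply: (bounded_T_integrable n_gt0 omega_dini K_smooth T_repr T_lin T_meas A_gt0 T_weak) => //.
  by case: tchi.
pose v := c.2 ^+ n; have v0 : 0 < v by rewrite exprn_gt0.
pose avg := v^-1 * \int[mu]_(x in box c) T chi x.
have C0 : 0 <= C by rewrite mulr_ge0 ?exprn_ge0// dini_sum_ge0.
have avgs s : `|\int[mu]_(x in box (node c s)) T chi x - (node c s).2 ^+ n * avg| <=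
    2 * C * (node c s).2 ^+ n.
  have s0 := node_gt0 s c0; have vs0 : 0 < (node c s).2 ^+ n by rewrite exprn_gt0.
  have := @T1_averages V (node c s) c chi c.2 V0 c0 (ltW s0) (ltW c0).
  have H d x : d = node c s \/ d = c ->
      (forall i, d.1 ord0 i - c.2 < x ord0 i < d.1 ord0 i + d.2) -> box V x.
    move=> dE h i; have /andP[h1 h2] := h i; rewrite !mxE /=.
    have [b1 b2] : c.1 ord0 i <= d.1 ord0 i /\ d.1 ord0 i + d.2 <= c.1 ord0 i + c.2.
      by case: dE => ->; [exact: node_bounds|split].
    by apply/andP; split; lra.
  have sV : box (node c s) `<=` box V by apply: subset_trans cV; exact: node_sub.
  move=> /(_ H sV cV tchi chi01 chiL chi1) h.
  rewrite -(ler_pM2l v0) -{1}(ger0_norm (ltW v0)) -normrM mulrBr.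
  rewrite [X in _ - X](_ : _ = (node c s).2 ^+ n * \int[mu]_(x in box c) T chi x).
    by apply: le_trans h _; rewrite -/v le_eqVlt; apply/orP; left; apply/eqP; ring.
  by rewrite /avg mulrCA mulVKf// gt_eqF.
have mg : measurable_fun setT (T chi) by exact: T_meas.
have igs s : mu.-integrable (box (node c s)) (EFin \o T chi).
  by apply: integrableS ig => //; exact: node_sub.
have ics s (a : R) : mu.-integrable (box (node c s)) (EFin \o cst a).
  by apply: (@box_integrable_bounded _ _ _ _ `|a|) => //; exact/ltW/node_gt0.
have vol s (a : R) : (\int[mu]_(x in box (node c s)) (cst a x)%:E = (a * (node c s).2 ^+ n)%:E)%E.
  apply: (etrans (integral_cst mu (measurable_box (node c s)) a%:E)).
  by rewrite EFinM; congr (_ * _)%E; apply: mu_box; exact/ltW/node_gt0.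
have IE s : (\int[mu]_(x in box (node c s)) (T chi x)%:E)%E =
    (\int[mu]_(x in box (node c s)) T chi x)%:E.
  by rewrite /Rintegral fineK//; exact: integrable_fin_num.
have up : {ae mu, forall x, box c x -> T chi x - (avg + 2 * C) <= 0}.
  apply: node_integral_le0 => //.
    exact: (integrableB (measurable_box c) ig (ics [::] _)).
  move=> s; under eq_integral do rewrite EFinB.
  rewrite integralB//; last exact: ics.
  rewrite IE vol -EFinB lee_fin; have := avgs s; rewrite ler_norml => /andP[_ h].
  rewrite mulrDl opprD addrA subr_le0; apply: le_trans h.
  by rewrite [avg * _]mulrC.
have dn : {ae mu, forall x, box c x -> (avg - 2 * C) - T chi x <= 0}.
  apply: node_integral_le0 => //.
    exact: (integrableB (measurable_box c) (ics [::] _) ig).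
  move=> s; under eq_integral do rewrite EFinB.
  rewrite integralB//; last exact: ics.
  rewrite IE vol -EFinB lee_fin; have := avgs s; rewrite ler_norml => /andP[h _].
  rewrite mulrBl subr_le0 lerBlDr -lerBlDl [avg * _]mulrC.
  by move: h; rewrite lerNl opprB.
pose star1 : Rn -> R := \1_(box (star c)).
(* It vanishes on [star c] and is bounded by 1, so [T d] oscillates by at most C on the cube. *)
pose d y := chi y - star1 y.
have s1L : L1 star1 by apply: L1_indic; exact/ltW/star_gt0.
have dL : L1 d.
  have := L1_lin (-1) s1L chiL; rewrite (_ : (fun x => _) = d)//.
  by apply/funext => y; rewrite /d; ring.
have starcV : box (star c) `<=` box (star V).
  move=> y yc i; have /andP[] := yc i; rewrite !mxE /= expr0 mulr1.
  have := halo_ratio_ge1 (R := R) n_gt0; move: (halo_ratio (R := R) (n := n)) => r r1.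
  have rc : 0 <= r * c.2 by rewrite mulr_ge0 ?(ltW c0)// (le_trans _ r1).
  by move=> h1 h2; apply/andP; split; lra.
have chis y : box (star V) y -> chi y = 1.
  move=> cy; apply: (@nbhs_singleton _ y [set y | chi y = 1]); apply: chi1 => i.
  by have /andP[h1 h2] := cy i; rewrite h1 ltW.
have d1 y : `|d y| <= 1.
  have /andP[h1 h2] := chi01 y; rewrite /d /star1 indicE; case: (_ \in _) => /=;
  by rewrite ler_norml; apply/andP; split; lra.
have ds y : box (star c) y -> d y = 0.
  by move=> cy; rewrite /d /star1 chis ?indicE ?mem_set ?subrr//; exact: starcV.
have cd : compact (supp d).
  apply: (compact_supp_comb (f := chi) (g := star1)); first by case: tchi.
    apply: (@compact_supp_box _ _ (star c)) => x nx.
    by rewrite /star1 indicE memNset.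
  by move=> x; rewrite /d => -> ->; rewrite subrr.
have Td : {ae mu, forall x, T chi x = 1 * T star1 x + T d x}.
  by apply: (T_add T_lin) => // y; rewrite /d; ring.
exists (avg - T d c.1).
apply: (filterS _ (filterI (filterI up dn) Td)) => x [[u l] tx] cx.
have {}u := u cx; have {}l := l cx.
have od : `|T d x - T d c.1| <= C.
  rewrite -lee_fin; apply: le_trans (T_osc n_gt0 omega_dini K_smooth T_repr c0 dL cd ds cx (box_corner c0)) _.
  exact: tail_bounded.
rewrite (_ : T star1 x - (avg - T d c.1) = (T chi x - avg) - (T d x - T d c.1)); last by rewrite tx; ring.
apply: le_trans (ler_normB _ _) _.
have : `|T chi x - avg| <= 2 * C by rewrite ler_norml; apply/andP; split; lra.
by move=> h; lra.
Qed.

End T1_osc.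

(** A sum over a set of cubes counts each cube once, so an enumeration must be injective to be
    bounded by it. *)
Lemma sum_le_esum {R : realType} {I : choiceType} (S : set I) (a : I -> \bar R)
    (e : nat -> I) (m : nat) (P : pred nat) :
  (forall k, (k < m)%N -> P k -> S (e k)) ->
  {in [pred k | (k < m)%N && P k] &, injective e} ->
  (\sum_(k < m | P k) a (e k) <= \esum_(i in S) a i)%E.
Proof.
move=> eS einj; pose r := [seq k <- iota 0 m | P k].
have rP k : k \in r = (k < m)%N && P k by rewrite mem_filter mem_iota add0n andbC.
apply: esum_ge; exists (e @` [set` r]).
  split; first exact/finite_image/finite_seq.
  by move=> _ [k /= + <-]; rewrite rP => /andP[]; exact: eS.
rewrite fsbig_image; last by move=> j k; rewrite !inE /= !rP => jr kr; exact: einj.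
rewrite -fsbig_seq; last by rewrite filter_uniq// iota_uniq.
by rewrite big_filter -(big_mkord P (fun k => a (e k))) /index_iota subn0.
Qed.

(** * Sparse domination *)

Section local_estimates.
Context {R : realType} {n : nat}.
Local Notation Rn := 'rV[R]_n.
Local Notation mu := (lebesgue_rV (R := R) n).
Implicit Types (c d : Rn * R) (x y : Rn).
Hypothesis n_gt0 : (0 < n)%N.
Variables (f : Rn -> R).
Hypothesis fL : L1 f.

Lemma L1_integrable (A : set Rn) g : measurable A -> L1 g -> mu.-integrable A (EFin \o g).
Proof. by move=> mA gL; apply: integrableS gL. Qed.

Lemma box_average c g : 0 < c.2 ->
  \int[mu]_(x in box c) g x = c.2 ^+ n * average g (box c).
Proof.
by move=> c0; rewrite /average mu_box ?(ltW c0)//= mulVKf// gt_eqF// exprn_gt0.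
Qed.

Lemma mean_oscillation_ge0 Q : 0 <= mean_oscillation f Q.
Proof.
apply: mulr_ge0; first by rewrite invr_ge0 fine_ge0// measure_ge0.
by apply: Rintegral_ge0 => x _.
Qed.

Definition centered c y : R := (f y - average f (box c)) * \1_(box c) y.

Lemma centered_L1 c : 0 < c.2 -> L1 (centered c).
Proof.
move=> c0; have h1 : L1 (fun y => f y * \1_(box c) y) by exact: L1_restrict.
have h2 : L1 (\1_(box c) : Rn -> R) by exact/L1_indic/ltW.
have := L1_lin (- average f (box c)) h2 h1; rewrite (_ : (fun x => _) = centered c)//.
by apply/funext => y; rewrite /centered; ring.
Qed.

Lemma integral_centered c (B : set Rn) : box c `<=` B ->
  (\int[mu]_(x in B) `|centered c x|%:E = \int[mu]_(x in box c) `|f x - average f (box c)|%:E)%E.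
Proof.
move=> cB; rewrite -(setIidr cB) [RHS]integral_mkcondr; apply: eq_integral => x _.
rewrite /centered /patch indicE (setIidr cB); case: ifPn => [xc|/negbTE xc]; rewrite ?xc.
  by rewrite mulr1.
by rewrite mulr0 normr0.
Qed.

Lemma centered_norm c : 0 < c.2 ->
  (\int[mu]_x `|centered c x|%:E = (mean_oscillation f (box c))%:E * mu (box c))%E.
Proof.
move=> c0; rewrite integral_centered//.
have i1 : mu.-integrable (box c) (EFin \o (fun x => f x - average f (box c))).
  have ic : mu.-integrable (box c) (EFin \o cst (average f (box c))).
    by apply: (@box_integrable_bounded _ _ _ _ `|average f (box c)|) => //; exact: ltW.
  exact: (integrableB (measurable_box c) (L1_integrable (measurable_box c) fL) ic).
have i2 := integrable_norm i1.
have -> : (\int[mu]_(x in box c) `|f x - average f (box c)|%:E)%E =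
   (\int[mu]_(x in box c) `|f x - average f (box c)|)%:E.
  by rewrite /Rintegral fineK//; exact: integrable_fin_num.
by rewrite box_average// mu_box ?(ltW c0)// -EFinM mulrC.
Qed.

(* [|f - a| = |a|] on [box d `\` box c], which is at least half of [box d]. *)
Lemma oscillation_large c d : 0 < c.2 -> 0 < d.2 -> (forall x, ~ box c x -> f x = 0) ->
  box c `<=` box d -> 2 * c.2 ^+ n <= d.2 ^+ n ->
  `|average f (box d)| <= 2 * mean_oscillation f (box d) /\
  (\int[mu]_x `|f x|%:E <= (3 * mean_oscillation f (box d) * d.2 ^+ n)%:E)%E.
Proof.
move=> c0 d0 fc cd cd2; set a := average f (box d); set O := mean_oscillation f (box d).
have v0 : 0 < d.2 ^+ n by rewrite exprn_gt0.
have OE : (\int[mu]_(x in box d) `|f x - a|%:E = (O * d.2 ^+ n)%:E)%E.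
  by rewrite -(integral_centered (B := setT))// centered_norm// mu_box// ltW.
have mf := L1_measurable fL.
have mfa : measurable_fun (box d) (fun x => `|f x - a|%:E).
  apply/measurable_EFinP; apply: measurableT_comp => //; apply: measurable_funB => //.
  exact: measurable_funTS.
have aO : `|a| <= 2 * O.
  have : (\int[mu]_(x in box d) (`|a|%:E * (\1_(box d `\` box c) x)%:E) <= (O * d.2 ^+ n)%:E)%E.
    rewrite -OE; apply: ge0_le_integral => //.
    - apply/measurable_EFinP; apply: measurable_funM => //.
      by apply: measurable_indic; exact: measurableD.
    - move=> x _; rewrite -EFinM lee_fin indicE; case: (boolP (_ \in _)) => xdc; last by rewrite mulr0.
      by have [_ /fc ->] := set_mem xdc; rewrite mulr1 sub0r normrN.
  rewrite ge0_integralZl//; last first.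
    by apply/measurable_EFinP; apply: measurable_indic; exact: measurableD.
  rewrite integral_indic//; last exact: measurableD.
  rewrite (setIidl (@subDsetl _ _ _)).
  have : (mu (box d) <= mu (box c) + mu (box d `\` box c))%E.
    apply: (@le_trans _ _ (mu (box c `|` (box d `\` box c)))).
      apply: le_measure; rewrite ?inE//; first by apply: measurableU => //; exact: measurableD.
      by move=> x dx; have [cx|ncx] := pselect (box c x); [left|right].
    by apply: measureU2 => //; exact: measurableD.
  have : (mu (box d `\` box c) <= mu (box d))%E.
    by apply: le_measure; rewrite ?inE//; exact: measurableD.
  rewrite !mu_box ?(ltW c0) ?(ltW d0)// => h.
  have hf := le_fineK (measure_ge0 mu _) h; set w := fine _ in hf *; move: h; rewrite hf => h h1 h2.
  have {h2} : (`|a|%:E * w%:E <= (O * d.2 ^+ n)%:E)%E by rewrite -hf.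
  move: h1; rewrite -EFinD -EFinM !lee_fin => h1 h2.
  have a0 := normr_ge0 a; have : d.2 ^+ n / 2 <= w by lra.
  move=> /(ler_wpM2l a0) /le_trans/(_ h2) h3.
  by rewrite -(ler_pM2r v0); lra.
split => //.
rewrite (_ : (\int[mu]_x _)%E = (\int[mu]_(x in box d) `|f x|%:E)%E); last first.
  rewrite [RHS]integral_mkcond; apply: eq_integral => x _; rewrite /patch; case: ifPn => //.
  rewrite notin_setE => ndx; rewrite fc ?normr0// => cx; exact/ndx/cd.
apply: (@le_trans _ _ (\int[mu]_(x in box d) (`|f x - a|%:E + `|a|%:E))%E).
  apply: ge0_le_integral => //.
  - by apply/measurable_EFinP; apply: measurableT_comp => //; exact: measurable_funTS.
  - exact: emeasurable_funD.
  - by move=> x _; rewrite -EFinD lee_fin -{1}(subrK a (f x)) ler_normD.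
rewrite ge0_integralD//.
have -> : (\int[mu]_(x in box d) `|a|%:E = (`|a| * d.2 ^+ n)%:E)%E.
  apply: (etrans (integral_cst mu (measurable_box d) `|a|%:E)).
  by rewrite EFinM; congr (_ * _)%E; apply: mu_box; exact: ltW.
rewrite OE -EFinD lee_fin -mulrDl ler_wpM2r ?(ltW v0)//.
by lra.
Qed.

End local_estimates.

(** * Comparison of a cube with a dyadic subcube *)

Section local_decay.
Context {R : realType} {n : nat}.
Local Notation Rn := 'rV[R]_n.
Local Notation mu := (lebesgue_rV (R := R) n).
Implicit Types (c d : Rn * R) (x y : Rn).
Hypothesis n_gt0 : (0 < n)%N.
Variables (T : (Rn -> R) -> Rn -> R) (K : Rn -> Rn -> R) (omega : R -> R).
Hypothesis omega_dini : dini_modulus omega.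
Hypothesis K_smooth : smooth_kernel omega K.
Hypothesis T_repr : represented_by T K.
Hypothesis T_lin : linear_on_L1 T.
Hypothesis T_meas : forall f, L1 f -> measurable_fun setT (T f).
Variable A : R.
Hypothesis A_gt0 : 0 < A.
Hypothesis T_weak : forall f, L1 f -> forall l : R, 0 < l ->
  (l%:E * mu [set x | (l < `|T f x|)%R] <= A%:E * \int[mu]_x `|f x|%:E)%E.
Hypothesis T1 : T1_eq0 T K.

Let C := tail_const (n := n) omega.
Let kappa : R := star_ratio (R := R) (n := n).
Let wc : R := weak_const (n := n) A.
Let small : R := small_level (R := R) (n := n).

Lemma tail_const_ge0 : 0 <= C.
Proof. by rewrite mulr_ge0 ?exprn_ge0// dini_sum_ge0. Qed.

(** Chosen so that, after the loss of 3 ^ n in Vitali's lemma and of [star_ratio] in the norm of the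
    localised function, the bad halos measure at most [small_level] / 2 of the cube. *)
Definition halo_const : R := 2 * 3 ^+ n * star_ratio (R := R) (n := n) / small_level (R := R) (n := n).

Lemma halo_const_gt0 : 0 < halo_const.
Proof.
by rewrite divr_gt0 ?small_level_gt0// mulr_gt0 ?star_ratio_gt0// mulr_gt0// exprn_gt0.
Qed.

Variable f : Rn -> R.
Hypothesis fL : L1 f.

Let osc c := mean_oscillation f (box (star c)).
Let loc c := centered f (star c).

Lemma loc_L1 c : 0 < c.2 -> L1 (loc c).
Proof. by move=> c0; apply: centered_L1 => //; exact: star_gt0. Qed.

Lemma loc_norm c : 0 < c.2 ->
  (\int[mu]_x `|loc c x|%:E = (osc c)%:E * mu (box (star c)))%E.
Proof. by move=> c0; apply: centered_norm => //; exact: star_gt0. Qed.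

Lemma loc_compact c : compact (supp (loc c)).
Proof.
apply: (@compact_supp_box _ _ (star c)) => x nx.
by rewrite /loc /centered indicE memNset// mulr0.
Qed.

Definition bad_halos c0 c : set Rn :=
  \bigcup_(i in [set i : seq {ffun 'I_n -> bool} * nat |
     ((halo_const * osc c)%:E * mu (box (halo (node c0 i.1) i.2)) <
      \int[mu]_(x in box (halo (node c0 i.1) i.2)) `|loc c x|%:E)%E])
   box (halo (node c0 i.1) i.2).

Definition bad c0 c : set Rn :=
  [set x | wc * osc c < `|T (loc c) x|] `|` bad_halos c0 c.

Lemma measurable_bad_halos c0 c : measurable (bad_halos c0 c).
Proof.
rewrite /bad_halos bigcup_mkcond; apply: countable_bigcupT_measurable => [|i]; first exact: countableP.
by case: ifP.
Qed.

Lemma measurable_bad c0 c : 0 < c.2 -> measurable (bad c0 c).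
Proof.
move=> c0_gt0; apply: measurableU; last exact: measurable_bad_halos.
by apply: measurable_weak => //; exact: loc_L1.
Qed.

Lemma mu_large c : 0 < c.2 -> (mu [set x | (wc * osc c < `|T (loc c) x|)%R] <= (small / 2)%:E * mu (box c))%E.
Proof.
move=> c0; apply: weak_star => //; [exact: loc_L1|exact: mean_oscillation_ge0|].
by rewrite loc_norm.
Qed.

Lemma mu_bad_halos c0 c : 0 < c0.2 -> 0 < c.2 ->
  (mu (bad_halos c0 c) <= (small / 2)%:E * mu (box c))%E.
Proof.
move=> c00 cc0.
have vc : mu (box c) = (c.2 ^+ n)%:E by rewrite mu_box// ltW.
have v0 : 0 < c.2 ^+ n by rewrite exprn_gt0.
have small0 : 0 < small := small_level_gt0.
have O0 : 0 <= osc c by exact: mean_oscillation_ge0.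
have mF : measurable_fun setT (fun x => `|loc c x|%:E).
  by apply/measurable_EFinP; apply: measurableT_comp => //; apply: L1_measurable; exact: loc_L1.
have intF := loc_norm cc0; rewrite mu_star// -EFinM in intF.
(* At level 0 Vitali's lemma says nothing, but then the localised function has norm zero and the
   strict inequality rules out every halo. *)
have [z0|nz] := eqVneq (osc c) 0.
  rewrite [bad_halos c0 c](_ : _ = set0) ?measure0; last first.
    apply/seteqP; split => // x [i /= + _].
    rewrite z0 mulr0 mul0e ltNge => /negP; apply.
    rewrite z0 mul0r in intF; apply: (@le_trans _ _ (\int[mu]_x `|loc c x|%:E)%E); last by rewrite intF.
    exact: ge0_subset_integral.
  by rewrite vc -EFinM lee_fin; apply: mulr_ge0; [rewrite divr_ge0// ltW|exact: ltW].
have {}O0 : 0 < osc c by rewrite lt0r nz O0.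
have l0 : 0 < halo_const * osc c by rewrite mulr_gt0// halo_const_gt0.
have h := @vitali_countable R n _ [set i : seq {ffun 'I_n -> bool} * nat |
     ((halo_const * osc c)%:E * mu (box (halo (node c0 i.1) i.2)) <
      \int[mu]_(x in box (halo (node c0 i.1) i.2)) `|loc c x|%:E)%E]
   (fun i => halo (node c0 i.1) i.2) (fun x => `|loc c x|%:E) (halo_const * osc c).
have {h} : ((halo_const * osc c)%:E * mu (bad_halos c0 c) <= (3 ^+ n)%:E * \int[mu]_x `|loc c x|%:E)%E.
  by apply: h => // [|i /ltW ii]; [exact: ltW|split => //; exact/halo_gt0/node_gt0].
rewrite intF -EFinM muleC -lee_pdivlMr// => /le_trans; apply.
rewrite vc -!EFinM lee_fin /halo_const -/kappa -/small.
have := star_ratio_gt0 (R := R) n_gt0; rewrite -/kappa => k0.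
have t0 : 0 < 3 ^+ n :> R by rewrite exprn_gt0.
by rewrite le_eqVlt; apply/orP; left; apply/eqP; field; rewrite !gt_eqF.
Qed.

Lemma mu_bad c0 c : 0 < c0.2 -> 0 < c.2 ->
  (mu (bad c0 c) <= small%:E * mu (box c))%E.
Proof.
move=> c00 cc0; have /le_trans : (mu (bad c0 c) <=
    mu [set x | (wc * osc c < `|T (loc c) x|)%R] + mu (bad_halos c0 c))%E.
  apply: measureU2; last exact: measurable_bad_halos.
  by apply: measurable_weak => //; exact: loc_L1.
apply; apply: le_trans (leeD (mu_large cc0) (mu_bad_halos c00 cc0)) _.
have s0 : (0 <= (small / 2)%:E)%E.
  by rewrite lee_fin mulr_ge0// ltW//; exact: small_level_gt0.
by rewrite -ge0_muleDl// -EFinD -splitr.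
Qed.

(* Otherwise the whole cube would lie in a bad halo. *)
Lemma good_halos c0 c t k : 0 < c0.2 -> 0 < c.2 ->
  (mu (box (node c0 t) `&` bad c0 c) <= 4^-1%:E * mu (box (node c0 t)))%E ->
  (\int[mu]_(x in box (halo (node c0 t) k)) `|loc c x|%:E <=
    (halo_const * osc c)%:E * mu (box (halo (node c0 t) k)))%E.
Proof.
move=> c00 cc0 h; have t0 := node_gt0 t c00.
rewrite leNgt; apply/negP => bh.
have sb : box (node c0 t) `<=` bad c0 c.
  by move=> x tx; right; exists (t, k) => //; exact: sub_halo.
move: h; rewrite (setIidl sb) mu_box ?(ltW t0)// -EFinM lee_fin.
by have := exprn_gt0 n t0; move: (_ ^+ n) => v v0 h; lra.
Qed.

(** With M = [halo_const] times [osc c], the cost is made of wc [osc c] and 2 wc M for the two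
    localised terms at the good point, 6 C M for the T(1) term, which is 3 C at each of the two
    points, and C M for the far part. *)
Lemma loc_step c d : 0 < c.2 -> 0 < d.2 -> box (star d) `<=` box (star c) ->
  (mu (box d `&` [set x | (wc * osc c < `|T (loc c) x|)%R]) <= 4^-1%:E * mu (box d))%E ->
  (forall k, \int[mu]_(x in box (halo d k)) `|loc c x|%:E <=
    (halo_const * osc c)%:E * mu (box (halo d k)))%E ->
  {ae mu, forall x, box d x -> `|T (loc c) x| <=
    (wc + 2 * wc * halo_const + 7 * C * halo_const) * osc c + `|T (loc d) x|}.
Proof.
move=> c0 d0 dc small_dev halos.
have sd0 := star_gt0 n_gt0 d0; have sc0 := star_gt0 n_gt0 c0.
set O := osc c; have O0 : 0 <= O by exact: mean_oscillation_ge0.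
have h0 := halo_const_gt0; have wc0 : 0 < wc by exact: weak_const_gt0.
set M := halo_const * O; have M0 : 0 <= M by rewrite mulr_ge0// ltW.
pose a := average f (box (star d)) - average f (box (star c)).
set v := (star d).2 ^+ n; have v0 : 0 < v by rewrite exprn_gt0.
have mloc := L1_measurable (loc_L1 c0).
have iloc : mu.-integrable (box (star d)) (EFin \o loc c) by exact/L1_integrable/loc_L1.
have iav : mu.-integrable (box (star d)) (EFin \o (fun x => `|loc c x|)) by exact: (integrable_norm iloc).
have icst (z : R) : mu.-integrable (box (star d)) (EFin \o cst z).
  by apply: (@box_integrable_bounded _ _ _ _ `|z|) => //; exact: ltW.
(* As [halo d 0] is [star d], the case k = 0 of the halo condition bounds both [a] and [osc d]; the
   larger halos serve for the far part. *)
have iv : \int[mu]_(x in box (star d)) `|loc c x| <= M * v.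
  have := halos 0; rewrite -/(star d) (mu_box (ltW sd0)) -EFinM => h.
  by rewrite -lee_fin /Rintegral fineK//; exact: integrable_fin_num.
have vcst (z : R) : \int[mu]_(x in box (star d)) cst z x = z * v.
  by rewrite Rintegral_cst//; congr (_ * _); exact: (congr1 fine (mu_box (ltW sd0))).
have locE x : box (star d) x -> loc c x = f x - average f (box (star c)).
  by move=> /dc cx; rewrite /loc /centered indicE mem_set ?mulr1.
have aM : `|a| <= M.
  rewrite -(ler_pM2r v0); apply: le_trans iv; rewrite -{1}(ger0_norm (ltW v0)) -normrM.
  rewrite (_ : a * v = \int[mu]_(x in box (star d)) loc c x); first exact: le_normr_Rintegral.
  under eq_Rintegral => x /set_mem xd do rewrite locE//.
  apply/esym/(etrans (RintegralB (measurable_box (star d))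
    (L1_integrable (measurable_box (star d)) fL) (icst (average f (box (star c)))))).
  by rewrite vcst box_average// -/v /a; ring.
have Od : osc d <= 2 * M.
  rewrite -(ler_pM2l v0) -box_average//.
  apply: (@le_trans _ _ (\int[mu]_(x in box (star d)) (`|loc c x| + cst `|a| x))).
    apply: le_Rintegral => //.
    - have h : mu.-integrable (box (star d)) (EFin \o (fun x => f x - average f (box (star d)))).
        exact: (integrableB (measurable_box (star d)) (L1_integrable (measurable_box (star d)) fL) (icst _)).
      exact: (integrable_norm h).
    - exact: (integrableD (measurable_box (star d)) iav (icst _)).
    - move=> x xd; rewrite locE//= (_ : f x - _ = f x - average f (box (star c)) - a); last by rewrite /a; ring.
      exact: ler_normB.
  rewrite RintegralD// vcst; apply: le_trans (lerD iv (ler_wpM2r (ltW v0) aM)) _.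
  by rewrite -mulrDl -mulr2n -[M *+ 2]mulr_natl mulrC.
pose far y := loc c y * \1_(~` box (star d)) y.
have farL : L1 far by apply: L1_restrict; [exact: loc_L1|exact: measurableC].
have oneL : L1 (\1_(box (star d)) : Rn -> R) by exact/L1_indic/ltW.
have decomp y : loc c y = a * \1_(box (star d)) y + (1 * loc d y + far y).
  rewrite /far [loc d y]/loc /centered !indicE in_setC.
  case: (boolP (y \in box (star d))) => [/set_mem yd|_] /=; last by rewrite !mulr0 !add0r mulr1.
  by rewrite locE// /a; ring.
have restL : L1 (fun y => 1 * loc d y + far y) by apply: L1_lin => //; exact: loc_L1.
have e1 := T_add T_lin oneL restL decomp.
have e2 := T_add T_lin (loc_L1 d0) farL (fun y => erefl (1 * loc d y + far y)).
have [b oscb] := T1_osc n_gt0 omega_dini K_smooth T_repr T_lin T_meas A_gt0 T_weak T1 d0.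
have farc : compact (supp far).
  by apply: compact_supp_mul; exact: loc_compact.
have osc_far x x' : box d x -> box d x' -> `|T far x - T far x'| <= C * M.
  move=> dx dx'; rewrite -lee_fin.
  have far0 y : box (star d) y -> far y = 0.
    by move=> yd; rewrite /far indicE in_setC mem_set ?mulr0.
  apply: le_trans (T_osc n_gt0 omega_dini K_smooth T_repr d0 farL farc far0 dx dx') _.
  apply: tail_integral => //; first by apply: measurableT_comp => //; exact: L1_measurable.
  move=> k; apply: le_trans (halos k.+1); apply: ge0_le_integral => //.
  - by apply/measurable_EFinP; apply: measurableT_comp => //; apply: measurable_funTS; exact: L1_measurable.
  - by apply/measurable_EFinP; apply: measurableT_comp => //; exact/measurable_funTS.
  - by move=> y _; rewrite lee_fin normrM ler_piMr// indic_le1.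
pose Q x := box d x -> [/\ T (loc c) x = a * T \1_(box (star d)) x + (T (loc d) x + T far x)
   & `|T \1_(box (star d)) x - b| <= 3 * C].
have aeQ : {ae mu, forall x, Q x}.
  by apply: (filterS _ (filterI (filterI e1 e2) oscb)) => x [[E1 E2] h] dx; split; [rewrite E1 E2 mul1r|exact: h].
(* The densities are at most 1/4 for [c], by assumption, and [small_level] / 2 for [d], by the weak
   type bound. *)
have [y [dy]] : exists y, [/\ box d y, ~ (wc * osc c < `|T (loc c) y|)%R,
    ~ (wc * osc d < `|T (loc d) y|)%R & Q y].
  have := @good_point R n d [set x | (wc * osc c < `|T (loc c) x|)%R]
    [set x | (wc * osc d < `|T (loc d) x|)%R] 4^-1 (small / 2) Q.
  have mW e : 0 < e.2 -> measurable [set x | (wc * osc e < `|T (loc e) x|)%R].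
    by move=> e0; apply: measurable_weak => //; exact: loc_L1.
  apply => //; [exact: mW|exact: mW| |].
    have := small_level_le (R := R) (n := n); have := stop_level_le (R := R) (n := n); rewrite -/small.
    by move: small (stop_level (R := R) (n := n)) => u w h1 h2; lra.
  apply: le_trans (mu_large d0); apply: le_measure; rewrite ?inE//.
    by apply: measurableI => //; exact: mW.
  exact: mW.
move=> /negP; rewrite -leNgt => yc /negP; rewrite -leNgt => yd /(_ dy)[yE yb].
apply: filterS aeQ => x /[swap] dx /(_ dx)[xE xb].
have wcd : wc * osc d <= wc * (2 * M) by rewrite ler_pM2l.
have h1 : `|a * (T \1_(box (star d)) x - T \1_(box (star d)) y)| <= M * (6 * C).
  rewrite normrM; apply: ler_pM aM _ => //.
  apply: le_trans (ler_distD b _ _) _; rewrite (distrC b).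
  by apply: le_trans (lerD xb yb) _; rewrite -mulrDl -natrD.
have h2 := osc_far x y dx dy.
have -> : T (loc c) x = T (loc d) x + (T (loc c) y - T (loc d) y +
   (a * (T \1_(box (star d)) x - T \1_(box (star d)) y) + (T far x - T far y))).
  by rewrite xE yE; ring.
apply: le_trans (ler_normD _ _) _; rewrite addrC lerD2r.
apply: le_trans (ler_normD _ _) _.
have h3 := le_trans (ler_normB _ _) (lerD yc (le_trans yd wcd)).
have h4 := le_trans (ler_normD _ _) (lerD h1 h2).
apply: le_trans (lerD h3 h4) _.
rewrite /M -/O; move: (wc) (C) (halo_const) (O) => w k h o.
by rewrite le_eqVlt; apply/orP; left; apply/eqP; ring.
Qed.

End local_decay.

Section domination.
Context {R : realType} {n : nat}.
Local Notation Rn := 'rV[R]_n.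
Local Notation mu := (lebesgue_rV (R := R) n).
Implicit Types (c d : Rn * R) (x y : Rn).
Hypothesis n_gt0 : (0 < n)%N.
Variables (T : (Rn -> R) -> Rn -> R) (K : Rn -> Rn -> R) (omega : R -> R).
Hypothesis omega_dini : dini_modulus omega.
Hypothesis K_smooth : smooth_kernel omega K.
Hypothesis T_repr : represented_by T K.
Hypothesis T_lin : linear_on_L1 T.
Hypothesis T_meas : forall f, L1 f -> measurable_fun setT (T f).
Variable A : R.
Hypothesis A_gt0 : 0 < A.
Hypothesis T_weak : forall f, L1 f -> forall l : R, 0 < l ->
  (l%:E * mu [set x | (l < `|T f x|)%R] <= A%:E * \int[mu]_x `|f x|%:E)%E.
Hypothesis T1 : T1_eq0 T K.

Let C := tail_const (n := n) omega.
Let kappa : R := star_ratio (R := R) (n := n).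
Let wc : R := weak_const (n := n) A.
Let small : R := small_level (R := R) (n := n).

Variable f : Rn -> R.
Hypothesis fL : L1 f.

Let osc c := mean_oscillation f (box (star c)).
Let loc c := centered f (star c).

Let hc : R := halo_const (R := R) (n := n).

Definition decay_const : R := wc + 2 * wc * hc + 7 * C * hc.

Lemma local_domination q : 0 < q.2 ->
  exists (F : pred (seq {ffun 'I_n -> bool})) (B : seq {ffun 'I_n -> bool} -> set Rn),
  [/\ F [::],
    forall s, [/\ measurable (B s), B s `<=` box (node q s) &
       (mu (box (node q s)) <= 2%:E * mu (B s))%E],
    trivIset [set s | F s] B &
    {ae mu, forall x, box q x -> exists m, `|T (loc q) x| <=
       \sum_(k < m | F (addr q x k)) decay_const * osc (node q (addr q x k))}].
Proof.
move=> q0.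
have wc0 : 0 < wc by exact: weak_const_gt0.
have h0 : 0 < hc by exact: halo_const_gt0.
have C0 : 0 <= C by exact: tail_const_ge0.
have := @stopping_time R n q (fun s => bad T A f q (node q s)) q0.
case=> [s|s|F [B [F0 HB tB _ dom]]].
- by apply: measurable_bad => //; exact: node_gt0.
- have s0 := node_gt0 s q0.
  apply: le_trans (mu_bad n_gt0 T_meas A_gt0 T_weak fL q0 s0).
  have mb : measurable (bad T A f q (node q s)) by exact: measurable_bad.
  by apply: le_measure; rewrite ?inE//; exact: measurableI.
exists F, B; split => //.
apply: (dom (fun s x => `|T (loc (node q s)) x|) (fun s => decay_const * osc (node q s))).
  move=> s; apply: aeW => x _ nx.
  have nl : ~ (wc * osc (node q s) < `|T (loc (node q s)) x|) by move=> h; apply: nx; left.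
  rewrite leNgt; apply/negP => /(le_lt_trans _) h; apply: nl; apply: h.
  rewrite ler_wpM2r ?mean_oscillation_ge0// /decay_const -addrA lerDl.
  move: (wc) (hc) (C) (ltW wc0) (ltW h0) C0 => a b d a0 b0 d0.
  by rewrite addr_ge0 ?mulr_ge0.
move=> s t h; have s0 := node_gt0 s q0; have st0 := node_gt0 (s ++ t) q0.
apply: (loc_step n_gt0 omega_dini K_smooth T_repr T_lin T_meas A_gt0 T_weak T1 fL) => //.
- by rewrite node_cat /star /halo; apply: dil_node_sub => //; rewrite (le_trans _ (halo_ratio2_ge1 n_gt0 0)).
- apply: le_trans h; apply: le_measure; rewrite ?inE//.
  + by apply: measurableI => //; apply: measurable_weak => //; exact: loc_L1.
  + by apply: measurableI => //; exact: measurable_bad.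
  + by apply: setIS; left.
- by move=> k; exact: good_halos h.
Qed.

Lemma star_ratio_ge2 : 2 <= kappa.
Proof.
have h1 := halo_ratio_ge1 (R := R) n_gt0.
rewrite /kappa /star_ratio; move: (halo_ratio (R := R) (n := n)) h1 => r r1.
case: n n_gt0 => // k _; rewrite exprS.
have : 1 <= (1 + 2 * r) ^+ k by apply: exprn_ege1; lra.
by move: (_ ^+ k) => w w1; nra.
Qed.

Lemma star_side c : (star c).2 ^+ n = kappa * c.2 ^+ n.
Proof. by rewrite /star /halo /dil /= expr0 mulr1 exprMn. Qed.

(** [f] differs from its localisation by an average times the indicator of a star. [T] of that
    indicator is bounded, and not only of bounded oscillation, because the weak type bound provides
    a point where it is at most [wc]. *)
Lemma initial_domination c : 0 < c.2 -> (forall x, ~ box c x -> f x = 0) ->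
  {ae mu, forall x, box (star c) x ->
     `|T f x| <= `|T (loc (star c)) x| + 2 * (wc + 6 * C) * osc (star c)}.
Proof.
move=> c0 fc; pose q := star c; have q0 : 0 < q.2 by exact: star_gt0.
have sq0 : 0 < (star q).2 by exact: star_gt0.
have oneL : L1 (\1_(box (star q)) : Rn -> R) by exact/L1_indic/ltW.
have cq : box c `<=` box (star q) by apply: subset_trans (sub_halo _ _ _) (sub_halo _ _ _).
set a := average f (box (star q)).
have [aO _] : `|a| <= 2 * osc q /\ (\int[mu]_x `|f x|%:E <= (3 * osc q * (star q).2 ^+ n)%:E)%E.
  apply: (oscillation_large fL c0 sq0 fc cq).
  rewrite !star_side mulrA ler_wpM2r ?exprn_ge0 ?(ltW c0)//.
  by have := star_ratio_ge2; move: kappa => k k2; nra.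
have decomp y : f y = a * \1_(box (star q)) y + loc q y.
  rewrite /loc /centered indicE; case: (boolP (y \in _)) => [_|/=]; first by rewrite -/a /=; ring.
  by rewrite notin_setE => ny; rewrite fc ?mulr0 ?addr0// => /cq.
have e1 := T_add T_lin oneL (loc_L1 n_gt0 fL q0) decomp.
have [b oscb] := T1_osc n_gt0 omega_dini K_smooth T_repr T_lin T_meas A_gt0 T_weak T1 q0.
pose Q x := box q x -> `|T \1_(box (star q)) x - b| <= 3 * C.
have [y [qy _ y1 Qy]] : exists y, [/\ box q y, ~ False, ~ (wc * 1 < `|T \1_(box (star q)) y|)%R & Q y].
  apply: (@good_point R n q set0 [set x | (wc * 1 < `|T \1_(box (star q)) x|)%R] 0 (small / 2) Q) => //.
  - exact: measurable_weak.
  - have := small_level_le (R := R) (n := n); have := stop_level_le (R := R) (n := n); rewrite -/small.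
    by move: small (stop_level (R := R) (n := n)) => u w h1 h2; lra.
  - by rewrite setI0 measure0 mul0e.
  - apply: (@le_trans _ _ (mu [set x | (wc * 1 < `|T \1_(box (star q)) x|)%R])).
      by apply: le_measure; rewrite ?inE//; [apply: measurableI => //; exact: measurable_weak|exact: measurable_weak].
    apply: weak_star => //; rewrite mul1e.
    under eq_integral do rewrite ger0_norm//.
    by rewrite integral_indic// setIT.
move: y1 => /negP; rewrite -leNgt mulr1 => y1.
apply: (filterS _ (filterI e1 oscb)) => x [-> h] qx.
apply: le_trans (ler_normD _ _) _; rewrite [leRHS]addrC lerD2r normrM.
have h1 : `|T \1_(box (star q)) x| <= wc + 6 * C.
  rewrite -[T _ x](subrK (T \1_(box (star q)) y)) addrC.
  apply: le_trans (ler_normD _ _) (lerD y1 _).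
  apply: le_trans (ler_distD b _ _) _; rewrite (distrC b).
  by apply: le_trans (lerD (h qx) (Qy qy)) _; rewrite -mulrDl -natrD.
by rewrite -mulrA mulrCA mulrC; apply: ler_pM.
Qed.

(** The weak type bound gives a good point in a small cube at [x], and the Dini bound carries it to
    [x]. In the constant, 3 comes from [oscillation_large], kappa^2 from the volume of the double
    star and 2 ^ n from halving the side. *)
Lemma outer_domination c x : 0 < c.2 -> (forall x, ~ box c x -> f x = 0) ->
  ~ box (star c) x ->
  `|T f x| <= (wc + C) * (3 * kappa ^+ 2 * 2 ^+ n) * osc (star c).
Proof.
(* With r = [halo_ratio] >= 1, the side and margin of [star d] add up to (1 + r) c.2 / 2 <= r c.2,
   so [star d] misses [box c]. *)
move=> c0 fc ncx; pose d : Rn * R := (x, c.2 / 2).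
have d0 : 0 < d.2 by rewrite divr_gt0.
have s1 := star_gt0 n_gt0 c0; have s2 := star_gt0 n_gt0 s1.
have fd y : box (star d) y -> f y = 0.
  move=> dy; apply: fc => cy; apply: ncx => i.
  have /andP[] := dy i; have /andP[] := cy i; rewrite !mxE /= expr0 mulr1.
  have := halo_ratio_ge1 (R := R) n_gt0; move: (halo_ratio (R := R) (n := n)) => r r1.
  have rc : c.2 <= r * c.2 by rewrite ler_peMl// ltW.
  by move: ((x : Rn) ord0 i) (y ord0 i) => xi yi h1 h2 h3 h4; apply/andP; split; lra.
have [_ fO] : `|average f (box (star (star c)))| <= 2 * osc (star c) /\
    (\int[mu]_x `|f x|%:E <= (3 * osc (star c) * (star (star c)).2 ^+ n)%:E)%E.
  apply: (oscillation_large fL c0 s2 fc).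
    by apply: subset_trans (sub_halo _ _ _) (sub_halo _ _ _).
  rewrite !star_side mulrA ler_wpM2r ?exprn_ge0 ?(ltW c0)//.
  by have := star_ratio_ge2; move: kappa => k k2; nra.
set L := 3 * kappa ^+ 2 * 2 ^+ n * osc (star c).
have k0 : 0 < kappa by exact: star_ratio_gt0.
have k2 := star_ratio_ge2.
have L0 : 0 <= L.
  apply: mulr_ge0; last exact: mean_oscillation_ge0.
  by move: (kappa) (ltW k0) => k k_ge0; rewrite !mulr_ge0// exprn_ge0.
have fLd : (\int[mu]_x `|f x|%:E <= L%:E * mu (box d))%E.
  apply: le_trans fO _; rewrite mu_box ?(ltW d0)// -EFinM lee_fin !star_side /L /d /=.
  rewrite expr_div_n; have := exprn_gt0 n c0.
  have : 0 < 2 ^+ n :> R by rewrite exprn_gt0.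
  move: (kappa) (osc (star c)) (_ ^+ n) (_ ^+ n) => k o u w u0 w0.
  by rewrite le_eqVlt; apply/orP; left; apply/eqP; field; rewrite gt_eqF.
have fLdk k : (\int[mu]_(y in box (halo d k)) `|f y|%:E <= L%:E * mu (box (halo d k)))%E.
  apply: (@le_trans _ _ (L%:E * mu (box d))%E); last first.
    by rewrite lee_wpmul2l ?lee_fin//; apply: le_measure; rewrite ?inE//; exact: sub_halo.
  apply: le_trans fLd; apply: ge0_subset_integral => //.
  by apply/measurable_EFinP; apply: measurableT_comp => //; exact: L1_measurable.
have [y [dy _ yL _]] : exists y, [/\ box d y, ~ False, ~ (wc * L < `|T f y|)%R & True].
  apply: (@good_point R n d set0 [set x | (wc * L < `|T f x|)%R] 0 (small / 2) (fun=> True)) => //.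
  - exact: measurable_weak.
  - have := small_level_le (R := R) (n := n); have := stop_level_le (R := R) (n := n); rewrite -/small.
    by move: small (stop_level (R := R) (n := n)) => u w h1 h2; lra.
  - by rewrite setI0 measure0 mul0e.
  - apply: (@le_trans _ _ (mu [set x | (wc * L < `|T f x|)%R])).
      by apply: le_measure; rewrite ?inE//; [apply: measurableI => //; exact: measurable_weak|exact: measurable_weak].
    apply: weak_star => //; apply: le_trans fLd _.
    by rewrite lee_wpmul2l ?lee_fin//; apply: le_measure; rewrite ?inE//; exact: sub_halo.
  - exact: aeW.
move: yL => /negP; rewrite -leNgt => yL.
have fs : compact (supp f) by exact: compact_supp_box fc.
have dx : box d x := box_corner d0.
have h : `|T f x - T f y| <= C * L.
  rewrite -lee_fin; apply: le_trans (T_osc n_gt0 omega_dini K_smooth T_repr d0 fL fs fd dx dy) _.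
  apply: tail_integral => //; first by apply: measurableT_comp => //; exact: L1_measurable.
rewrite -mulrA -/L -[T f x](subrK (T f y)) addrC mulrDl.
exact: le_trans (ler_normD _ _) (lerD yL h).
Qed.

End domination.

(** * From indexed cubes to a sparse set of cubes *)

Section families.
Context {R : realType} {n : nat}.
Local Notation Rn := 'rV[R]_n.
Local Notation mu := (lebesgue_rV (R := R) n).
Implicit Types (c d : Rn * R) (x y : Rn).
Hypothesis n_gt0 : (0 < n)%N.

(** Different indices may give the same cube, so the disjoint set attached to a cube is the union of
    those of all its indices. *)
Lemma sparse_family (I : countType) (eta : R) (D : set I) (q : I -> Rn * R) (B : I -> set Rn) :
  (forall i, D i -> [/\ 0 < (q i).2, measurable (B i), B i `<=` box (q i) &
    (eta%:E * mu (box (q i)) <= mu (B i))%E]) ->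
  trivIset D B -> sparse eta [set box (q i) | i in D].
Proof.
move=> H tB; split; first by move=> _ [i /H[qi _ _ _] <-]; exact: cube_box.
exists (fun Q => \bigcup_(i in [set i | D i /\ box (q i) = Q]) B i); split.
  move=> _ [i Di <-]; have [qi mBi Bi ei] := H _ Di.
  have mU : measurable (\bigcup_(j in [set j | D j /\ box (q j) = box (q i)]) B j).
    rewrite bigcup_mkcond; apply: countable_bigcupT_measurable => [|j]; first exact: countableP.
    by case: ifPn => // /set_mem[/H[]].
  split => //; first by move=> x [j [/H[_ _ + _] <-]]; apply.
  apply: le_trans ei _; apply: le_measure; rewrite ?inE//.
  by apply: bigcup_sup.
move=> Q Q' _ _ [x [[i [Di <-] Bi] [j [Dj <-] Bj]]].
by congr (box (q _)); apply: tB => //; exists x.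
Qed.

Lemma box_side_inj c d : 0 < c.2 -> 0 < d.2 -> box c = box d -> c.2 = d.2.
Proof.
move=> c0 d0 cd; have : mu (box c) = mu (box d) by rewrite cd.
rewrite !mu_box ?(ltW c0) ?(ltW d0)// => -[] /eqP.
by rewrite eqrXn2 ?(ltW c0) ?(ltW d0)// => /eqP.
Qed.

(** The side determines the generation, so the dilates along one address are distinct, as
    [sum_le_esum] requires. *)
Lemma box_star_node_inj c s t : 0 < c.2 ->
  box (star (node c s)) = box (star (node c t)) -> size s = size t.
Proof.
move=> c0 /box_side_inj; rewrite !star_gt0 ?node_gt0// => /(_ isT isT).
rewrite /star /halo /dil /= !node_side.
have r1 := halo_ratio2_ge1 (R := R) n_gt0 0.
have r0 : 1 + 2 * (halo_ratio (R := R) (n := n) * 2 ^+ 0) != 0 by rewrite gt_eqF//; lra.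
move=> /(mulfI r0)/(mulfI (lt0r_neq0 c0))/invr_inj; apply: ieexprIn => //.
by rewrite gt_eqF// ltr1n.
Qed.

Lemma iter_star_gt0 c j : 0 < c.2 -> 0 < (iter j star c).2.
Proof. by move=> c0; elim: j => //= j IH; exact: star_gt0. Qed.

Lemma iter_star_sub c i j : (i <= j)%N -> 0 < c.2 ->
  box (iter i star c) `<=` box (iter j star c).
Proof.
move=> ij c0; rewrite -(subnK ij); elim: (j - i)%N => [//|k IH].
by rewrite addSn /=; apply: subset_trans IH (sub_halo _ _ _) => //; exact: iter_star_gt0.
Qed.

Lemma iter_star_cover c y : 0 < c.2 -> exists j, box (iter j star c) y.
Proof.
move=> c0; have [k ky] := halo_cover n_gt0 y c0; exists k.+1.
have [r [rk ->]] : exists r, halo_ratio (R := R) (n := n) * 2 ^+ k <= r /\ iter k.+1 star c = dil r c.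
  elim: (k) => [|j [r [rj rE]]]; first by exists (halo_ratio (R := R) (n := n) * 2 ^+ 0).
  have h1 := halo_ratio_ge1 (R := R) n_gt0.
  exists (r + halo_ratio (R := R) (n := n) * (1 + 2 * r)); split.
    have : 0 <= halo_ratio (R := R) (n := n) * 2 ^+ j by apply: le_trans (halo_ratio2_ge1 n_gt0 j).
    by rewrite exprS mulrCA; nra.
  rewrite iterS rE /star /halo /dil /= expr0 mulr1; congr (_, _); last by ring.
  by apply/rowP => i; rewrite !mxE; ring.
by apply: dil_sub ky => //; exact: ltW.
Qed.

End families.

Section sparse_domination.
Context {R : realType} {n : nat}.
Local Notation Rn := 'rV[R]_n.
Local Notation mu := (lebesgue_rV (R := R) n).
Implicit Types (c d : Rn * R) (x y : Rn).
Hypothesis n_gt0 : (0 < n)%N.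
Variables (T : (Rn -> R) -> Rn -> R) (K : Rn -> Rn -> R) (omega : R -> R).
Hypothesis omega_dini : dini_modulus omega.
Hypothesis K_smooth : smooth_kernel omega K.
Hypothesis T_repr : represented_by T K.
Hypothesis T_lin : linear_on_L1 T.
Hypothesis T_meas : forall f, L1 f -> measurable_fun setT (T f).
Variable A : R.
Hypothesis A_gt0 : 0 < A.
Hypothesis T_weak : forall f, L1 f -> forall l : R, 0 < l ->
  (l%:E * mu [set x | (l < `|T f x|)%R] <= A%:E * \int[mu]_x `|f x|%:E)%E.
Hypothesis T1 : T1_eq0 T K.

Let C := tail_const (n := n) omega.
Let kappa : R := star_ratio (R := R) (n := n).
Let wc : R := weak_const (n := n) A.
Let D1 : R := decay_const (n := n) omega A.
Let D2 : R := 2 * (wc + 6 * C).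
Let D3 : R := (wc + C) * (3 * kappa ^+ 2 * 2 ^+ n).

Lemma sparse_domination f : L1 f -> compact (supp f) ->
  exists S : set (set Rn), sparse (2 * kappa)^-1 S /\
    {ae mu, forall x, (`|T f x|%:E <=
       (D1 + D2 + D3)%:E * \esum_(Q in S) (mean_oscillation f Q * \1_Q x)%:E)%E}.
Proof.
move=> fL fs; have [c [c0 fc]] := supp_in_box fs.
pose q0 := star c; have q00 : 0 < q0.2 by exact: star_gt0.
have [F [B [F0 HB tB dom]]] := local_domination n_gt0 omega_dini K_smooth T_repr T_lin T_meas A_gt0 T_weak T1 fL q00.
have init := initial_domination n_gt0 omega_dini K_smooth T_repr T_lin T_meas A_gt0 T_weak T1 fL c0 fc.
have k2 : 2 <= kappa by exact: star_ratio_ge2.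
have wc0 : 0 < wc by exact: weak_const_gt0.
have C0 : 0 <= C by exact: tail_const_ge0.
have k0 : 0 <= kappa by apply: le_trans k2.
have D10 : 0 <= D1.
  rewrite /D1 /decay_const -/wc -/C; have := halo_const_gt0 (R := R) n_gt0.
  by move: (wc) (C) (halo_const) wc0 C0 => w k h w0 k_ge0 h0; rewrite !addr_ge0 ?mulr_ge0// ltW.
have D20 : 0 <= D2.
  by rewrite /D2; move: (wc) (C) wc0 C0 => w k w0 k_ge0; lra.
have D30 : 0 <= D3.
  rewrite /D3; move: (wc) (C) (kappa) wc0 C0 k0 => w k h w0 k_ge0 h0.
  by rewrite !mulr_ge0 ?exprn_ge0// addr_ge0// ltW.
have D12 : 0 <= D1 + D2 by exact: addr_ge0.
pose it j := iter j star c.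
have it0 j : 0 < (it j).2 by exact: iter_star_gt0.
pose Dm : set (seq {ffun 'I_n -> bool} + nat) := [set i | if i is inl s then F s else true].
(* The root is [it 1] and its own star [it 2] is the cube of index [inl [::]], so the outer cubes
   begin with [it 3]. Their annuli avoid the root, which contains all the sets [B s]. *)
pose q (i : seq {ffun 'I_n -> bool} + nat) : Rn * R :=
  match i with inl s => star (node q0 s) | inr j => it j.+3 end.
pose E (i : seq {ffun 'I_n -> bool} + nat) : set Rn :=
  match i with inl s => B s | inr j => box (it j.+3) `\` box (it j.+2) end.
exists [set box (q i) | i in Dm]; split.
  apply: (sparse_family (B := E)).
    move=> [s|j] Di /=.
      have [mB Bs muB] := HB s; have s0 := node_gt0 s q00.
      split => //; [exact: star_gt0|by apply: subset_trans Bs (sub_halo _ _ _)|].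
      rewrite mu_star// -EFinM mulrA invfM mulrVK ?unitfE ?gt_eqF ?star_ratio_gt0//.
      by rewrite EFinM lee_pdivrMl//; move: muB; rewrite (mu_box (ltW s0)).
    have sub : box (it j.+2) `<=` box (it j.+3) by exact: iter_star_sub.
    split => //; [exact: (it0 j.+3)|exact: measurableD|].
    have -> : mu (box (it j.+3) `\` box (it j.+2)) = (mu (box (it j.+3)) - mu (box (it j.+2)))%E.
      rewrite -[in RHS](setIidr sub); apply: measureD => //.
      by apply: mu_box_lty; exact: ltW (it0 j.+3).
    rewrite -/(it j.+2) (mu_star n_gt0 (it0 j.+2)) (mu_box (ltW (it0 j.+2))).
    have := exprn_gt0 n (it0 j.+2); move: (_ ^+ n) => v v0.
    rewrite -EFinM -EFinB lee_fin mulrA invfM mulrVK ?unitfE ?gt_eqF//; last exact: star_ratio_gt0.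
    by rewrite -/kappa; move: (kappa) k2 => k k2; nra.
  move=> [s|j] [t|k] Ds Dt /= [x [hx hy]].
  - by congr inl; apply: tB => //; exists x.
  - exfalso; case: hy => _; apply; apply: (@iter_star_sub R n n_gt0 c 1 k.+2 isT c0 x).
    by apply: (node_sub q00); case: (HB s) => _ + _; apply; exact: hx.
  - exfalso; case: hx => _; apply; apply: (@iter_star_sub R n n_gt0 c 1 j.+2 isT c0 x).
    by apply: (node_sub q00); case: (HB t) => _ + _; apply; exact: hy.
  - congr inr; case: hx => x1 x2; case: hy => y1 y2; case: (ltngtP j k) => // jk; exfalso.
    + exact/y2/(@iter_star_sub R n n_gt0 c j.+3 k.+2 jk c0 x).
    + exact/x2/(@iter_star_sub R n n_gt0 c k.+3 j.+2 jk c0 x).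
set S := [set box (q i) | i in Dm].
have oscS0 x Q : (0 <= (mean_oscillation f Q * \1_Q x)%:E)%E.
  by rewrite lee_fin mulr_ge0// mean_oscillation_ge0.
have esum0 x : (0 <= \esum_(Q in S) (mean_oscillation f Q * \1_Q x)%:E)%E.
  by apply: esum_ge0 => Q _.
apply: (filterS _ (filterI dom init)) => x [domx initx].
have [q0x|nq0x] := pselect (box q0 x).
  have {}initx := initx q0x; have [m {}domx] := domx q0x.
  set a := fun k => mean_oscillation f (box (star (node q0 (addr q0 x k)))).
  have a0 k : 0 <= a k by exact: mean_oscillation_ge0.
  (* One term more than [domx] gives: [m] may be 0, while the cost of [initial_domination] is
     charged to the root, the term k = 0. *)
  pose s := \sum_(k < m.+1 | F (addr q0 x k)) a k.
  have sS : (s%:E <= \esum_(Q in S) (mean_oscillation f Q * \1_Q x)%:E)%E.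
    have := @sum_le_esum R _ S (fun Q => (mean_oscillation f Q * \1_Q x)%:E)
      (fun k => box (star (node q0 (addr q0 x k)))) m.+1 (fun k => F (addr q0 x k)).
    move=> h; apply: le_trans (h _ _).
    - rewrite /s -sumEFin le_eqVlt; apply/orP; left; apply/eqP; apply: eq_bigr => k _ /=.
      by rewrite indicE mem_set ?mulr1//; apply: sub_halo; [|exact: node_gt0|exact: node_addr].
    - by move=> k _ Fk; exists (inl (addr q0 x k)).
    - by move=> k l _ _ /(box_star_node_inj n_gt0 q00); rewrite !size_addr.
  have as_ : a 0 <= s.
    by rewrite /s (bigD1 ord0)//= lerDl sumr_ge0.
  have ss : \sum_(k < m | F (addr q0 x k)) a k <= s.
    by rewrite /s [leRHS]big_mkcond big_ord_recr -big_mkcond/= lerDl; case: ifP.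
  have TfS : `|T f x| <= (D1 + D2) * s.
    apply: le_trans initx _; rewrite [leRHS]mulrDl; apply: lerD; last by apply: ler_wpM2l.
    by apply: le_trans domx _; rewrite -mulr_sumr; apply: ler_wpM2l.
  apply: (@le_trans _ _ ((D1 + D2)%:E * s%:E)%E); first by rewrite -EFinM lee_fin.
  apply: lee_pmul => //; rewrite ?lee_fin ?lerDl//.
  exact: le_trans (a0 0) as_.
(* The first iterate containing [x] has index at least 2. It is the double star of [it j], and [x]
   is outside [star (it j)], as [outer_domination] asks. *)
have [j [j1 jx]] : exists j, ~ box (it j.+1) x /\ box (it j.+2) x.
  have ex : exists j, `[<box (it j) x>].
    by have [j jx] := iter_star_cover n_gt0 x c0; exists j; exact/asboolP.
  case: (ex_minnP ex) => -[|[|j]] /asboolP jx jmin.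
  - by exfalso; apply: nq0x; exact: sub_halo jx.
  - by exfalso; exact: nq0x jx.
  - exists j; split => // j1x; have := jmin j.+1; rewrite ltnn => h.
    by have := h (introT (asboolP _) j1x).
have Sj : S (box (it j.+2)).
  by case: (j) => [|k]; [exists (inl [::])|exists (inr k)].
have fj y : ~ box (it j) y -> f y = 0.
  by move=> ny; apply: fc => cy; exact/ny/(@iter_star_sub R n n_gt0 c 0 j (leq0n _) c0 y cy).
have h := outer_domination n_gt0 omega_dini K_smooth T_repr T_meas A_gt0 T_weak fL (it0 j) fj j1.
apply: (@le_trans _ _ (D3%:E * (mean_oscillation f (box (it j.+2)) * \1_(box (it j.+2)) x)%:E)%E).
  by rewrite -EFinM lee_fin indicE mem_set// mulr1.
apply: lee_pmul => //; rewrite ?lee_fin ?lerDr//.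
have := @sum_le_esum R _ S (fun Q => (mean_oscillation f Q * \1_Q x)%:E)
      (fun k => box (it j.+2)) 1 predT.
rewrite big_ord1; apply => // k l; rewrite !inE.
by case: k l => [|//] [].
Qed.

End sparse_domination.

Theorem theorem1p1 (R : realType) (n : nat) (n_gt0 : (0 < n)%N) :
  exists eta : R, 0 < eta < 1 /\
  forall (T : ('rV[R]_n -> R) -> ('rV[R]_n -> R))
         (K : 'rV[R]_n -> 'rV[R]_n -> R),
    calderon_zygmund T K -> T1_eq0 T K ->
  exists C : R, 0 < C /\
  forall f : 'rV[R]_n -> R, L1 f -> compact (supp f) ->
  exists S : set (set 'rV[R]_n), sparse eta S /\
    {ae lebesgue_rV n, forall x,
      (`|T f x|%:E <=
       C%:E * \esum_(Q in S) (mean_oscillation f Q * \1_Q x)%:E)%E}.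
Proof.
exists (2 * star_ratio (R := R) (n := n))^-1; split.
  have k2 := star_ratio_ge2 (R := R) n_gt0.
  rewrite invr_gt0 mulr_gt0// ?star_ratio_gt0//= invf_lt1 ?mulr_gt0 ?star_ratio_gt0//.
  by lra.
move=> T K [T_lin [T_meas [A T_weak]] T_repr [omega [omega_dini K_smooth]]] T1.
(* The weak type constant comes without a sign; enlarging it makes it positive. *)
pose A' := `|A| + 1; have A0 : 0 < A' by rewrite ltr_wpDl.
have T_weak' f : L1 f -> forall l : R, 0 < l ->
    (l%:E * lebesgue_rV n [set x | (l < `|T f x|)%R] <= A'%:E * \int[lebesgue_rV n]_x `|f x|%:E)%E.
  move=> fL l l0; apply: le_trans (T_weak f fL l l0) _; apply: lee_wpmul2r.
    exact: integral_ge0.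
  by rewrite lee_fin (le_trans (ler_norm _))// lerDl.
have H := sparse_domination n_gt0 omega_dini K_smooth T_repr T_lin T_meas A0 T_weak' T1.
set C := (X in X%:E) in H.
exists (`|C| + 1); split; first by rewrite ltr_wpDl.
move=> f fL fs; have [S [sS HS]] := H f fL fs; exists S; split => //.
apply: filterS HS => x /le_trans; apply; apply: lee_wpmul2r.
  by apply: esum_ge0 => Q _; rewrite lee_fin mulr_ge0// mean_oscillation_ge0.
by rewrite lee_fin (le_trans (ler_norm _))// lerDl.
Qed.
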